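(* Let $\mathbb k$ be a field and let $0<r\le s$ be real numbers. The completed orbit category $\mathcal B_{\le r}^{(2)}/F_s^{\wedge}$ is a Frobenius category whose stable category is equivalent to the orbit category $\mathcal C_{r,s}=\mathcal D_r^{(2)}/\underline F_s$. Consequently $\mathcal C_{r,s}\cong\mathcal C_{r\pi/s}$ (equivalence of categories).
   Context: $\mathcal B_{\le r}^{(2)}$: the additive $\mathbb k$-category with indecomposable objects $M(x,y)_+$ and $M(x,y)_-$ for $x,y\in\mathbb R$ with $|x-y|\le r$; $\mathrm{Hom}(M(x,y)_\epsilon,M(x',y')_{\epsilon'})=\mathbb k$ if $x\le x'$ and $y\le y'$, and $0$ otherwise; composition is multiplication of scalars. The morphism corresponding to $1\in\mathbb k$ is called basic. $\mathcal D_r^{(2)}$ is the quotient of $\mathcal B_{\le r}^{(2)}$ by the morphisms factoring through direct sums of objects $M(x,y)_\epsilon$ with $|x-y|=r$ (the stable category of the Frobenius category $\mathcal B_{\le r}^{(2)}$). $F_s$ is the $\mathbb k$-linear automorphism of $\mathcal B_{\le r}^{(2)}$ with $F_s(M(x,y)_\epsilon)=M(y+s,x+s)_{-\epsilon}$, sending basic morphisms to basic morphisms; $\underline F_s$ is the induced automorphism of $\mathcal D_r^{(2)}$. The completed orbit category $\mathcal B_{\le r}^{(2)}/F_s^{\wedge}$ has the same objects as $\mathcal B_{\le r}^{(2)}$, with $\mathrm{Hom}(X,Y)=\prod_{n\in\mathbb Z}\mathcal B_{\le r}^{(2)}(X,F_s^nY)$ and composition $(g_j)(f_k)=(h_n)$,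 $h_n=\sum_{j+k=n}F_s^k g_j\circ f_k$. The orbit category $\mathcal D_r^{(2)}/\underline F_s$ has the objects of $\mathcal D_r^{(2)}$ and $\mathrm{Hom}(X,Y)=\bigoplus_{n\in\mathbb Z}\mathcal D_r^{(2)}(X,\underline F_s^nY)$, with the analogous composition. $\mathcal F_c,\mathcal C_c$: let $R=\mathbb k[[t]]$, $S^1=\mathbb R/2\pi\mathbb Z$. $\mathcal P_{S^1}$ is the additive $R$-category with indecomposable objects $P_{[x]}$, $[x]\in S^1$, and a morphism $e^\alpha:P_{[x]}\to P_{[x+\alpha]}$ for every real $\alpha\ge 0$, with $e^\alpha e^\beta=e^{\alpha+\beta}$ and $e^{2\pi}=$ multiplication by $t$; $\mathrm{Hom}(P_{[x]},P_{[y]})$ is the free $R$-module of rank 1 generated by $e^\alpha$ with $\alpha\ge0$ smallest such that $[x+\alpha]=[y]$. $\mathcal F$ is the category of pairs $(V,d)$, $V\in\mathcal P_{S^1}$, $d\in\mathrm{End}(V)$, $d^2=t$, with morphisms those of $\mathcal P_{S^1}$ commuting with $d$; a sequence in $\mathcal F$ is exact if the underlying sequence in $\mathcal P_{S^1}$ is split exact. For $x\le y\le x+2\pi$ put $E(x,y)=\left(P_{[x]}\oplus P_{[y]},\begin{bmatrix}0&e^{x+2\pi-y}\\ e^{y-x}&0\end{bmatrix}\right)$. For $0<c\le\pi$ and $\theta=\pi-c$, $\mathcal F_c$ is the full additive subcategory of $\mathcal F$ generated by the $E(x,y)$ with $x+\theta\le y\le x+2\pi-\theta$, with exact sequences those of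 $\mathcal F$ with all terms in $\mathcal F_c$; it is known to be a Frobenius category with indecomposable projective-injectives the $E(x,y)$ with $|y-x-\pi|=c$. $\mathcal C_c$ is its stable category. The exact structure on $\mathcal B_{\le r}^{(2)}/F_s^{\wedge}$ is the one transported from $\mathcal F_{r\pi/s}$ along the equivalence $\hat G:\mathcal B_{\le r}^{(2)}/F_s^{\wedge}\to\mathcal F_{r\pi/s}$ given on objects by $M(x,y)_+\mapsto E(\frac\pi s x,\frac\pi s y+\pi)$, $M(x,y)_-\mapsto E(\frac\pi s y-\pi,\frac\pi s x)$ and on the basic morphism $f:M(x,y)_\epsilon\to M(a,b)_{\epsilon'}$ of $\mathcal B_{\le r}^{(2)}$ by $\begin{bmatrix}0&1\\1&0\end{bmatrix}^{(\epsilon'=-)}\begin{bmatrix}e^{\frac\pi s(a-x)}&0\\0&e^{\frac\pi s(b-y)}\end{bmatrix}\begin{bmatrix}0&1\\1&0\end{bmatrix}^{(\epsilon=-)}$, where $(\epsilon=-)$ is $1$ if true and $0$ otherwise, extended to the completed orbit category by $(f_n)_n\mapsto\sum_n \hat G f_n$. *)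

(* Defs.v *)
From HB Require Import structures.
From mathcomp Require Import all_boot all_order all_algebra.
From mathcomp Require Import generic_quotient.
From mathcomp Require Import boolp classical_sets functions cardinality fsbigop.
From mathcomp Require Import reals trigo.
From mathcomp Require Import ring lra.

Set Implicit Arguments.
Unset Strict Implicit.
Unset Printing Implicit Defensive.

Import Order.TTheory GRing.Theory Num.Theory.

Local Open Scope classical_set_scope.
Local Open Scope ring_scope.

(* A [k]-category is presented by subquotients: the morphisms [X -> Y] are the
   elements of the subspace [hom X Y] of the vector space [arr X Y], and two of
   them are equal in the category when their difference lies in the subspace
   [null X Y].  A quotient category changes only [null].  [is_kcat] below
   states that these data do define a [k]-category. *)
Record kcat (k : fieldType) := KCat {
  ob :> Type;
  arr : ob -> ob -> lmodType k;
  hom : forall X Y, set (arr X Y);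
  null : forall X Y, set (arr X Y);
  idm : forall X, arr X X;
  comp : forall X Y Z, arr Y Z -> arr X Y -> arr X Z }.

Arguments arr {k} _ _ _.
Arguments hom {k} _ _ _ _.
Arguments null {k} _ _ _ _.
Arguments idm {k} _ _.
Arguments comp {k} _ {X Y Z} _ _.

Section Categories.
Context {k : fieldType}.

Definition heq (C : kcat k) (X Y : C) (f g : arr C X Y) : Prop :=
  null C X Y (f - g).

Definition is_subspace (V : lmodType k) (A : set V) : Prop :=
  A 0 /\ forall (a : k) (u v : V), A u -> A v -> A (a *: u + v).

Record is_kcat (C : kcat k) : Prop := IsKCat {
  hom_subspace : forall X Y : C, is_subspace (hom C X Y);
  null_subspace : forall X Y : C, is_subspace (null C X Y);
  null_hom : forall X Y : C, null C X Y `<=` hom C X Y;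
  idm_hom : forall X : C, hom C X X (idm C X);
  comp_hom : forall (X Y Z : C) g f,
    hom C Y Z g -> hom C X Y f -> hom C X Z (comp C g f);
  comp_linear_r : forall (X Y Z : C) a g f f',
    hom C Y Z g -> hom C X Y f -> hom C X Y f' ->
    heq (comp C g (a *: f + f')) (a *: comp C g f + comp C g f');
  comp_linear_l : forall (X Y Z : C) a g g' f,
    hom C Y Z g -> hom C Y Z g' -> hom C X Y f ->
    heq (comp C (a *: g + g') f) (a *: comp C g f + comp C g' f);
  comp_null_r : forall (X Y Z : C) g f,
    hom C Y Z g -> null C X Y f -> null C X Z (comp C g f);
  comp_null_l : forall (X Y Z : C) g f,
    null C Y Z g -> hom C X Y f -> null C X Z (comp C g f);
  comp_assoc : forall (W X Y Z : C) h g f,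
    hom C Y Z h -> hom C X Y g -> hom C W X f ->
    heq (comp C h (comp C g f)) (comp C (comp C h g) f);
  comp_idm_l : forall (X Y : C) f, hom C X Y f -> heq (comp C (idm C Y) f) f;
  comp_idm_r : forall (X Y : C) f, hom C X Y f -> heq (comp C f (idm C X)) f }.

Definition is_iso (C : kcat k) (X Y : C) (f : arr C X Y) : Prop :=
  hom C X Y f /\
  exists2 g, hom C Y X g &
    heq (comp C g f) (idm C X) /\ heq (comp C f g) (idm C Y).

Definition is_dsum (C : kcat k) (I : finType) (Xs : I -> C) (Y : C) : Prop :=
  exists (inj : forall i, arr C (Xs i) Y) (prj : forall i, arr C Y (Xs i)),
    [/\ forall i, hom C (Xs i) Y (inj i) /\ hom C Y (Xs i) (prj i),
        forall i, heq (comp C (prj i) (inj i)) (idm C (Xs i)),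
        forall i j, i != j -> heq (comp C (prj j) (inj i)) 0
      & heq (\sum_i comp C (inj i) (prj i)) (idm C Y)].

(* The empty index type gives a zero object. *)
Definition additive (C : kcat k) : Prop :=
  forall (I : finType) (Xs : I -> C), exists Y, is_dsum Xs Y.

Definition full_sub (C : kcat k) (P : C -> Prop) : kcat k :=
  @KCat k {X : C | P X} (fun X Y => arr C (sval X) (sval Y))
    (fun X Y => hom C (sval X) (sval Y)) (fun X Y => null C (sval X) (sval Y))
    (fun X => idm C (sval X)) (fun X Y Z g f => comp C g f).

Record functor (C D : kcat k) := Functor {
  fob :> C -> D;
  fmor : forall X Y, arr C X Y -> arr D (fob X) (fob Y);
  fmor_hom : forall X Y f, hom C X Y f -> hom D (fob X) (fob Y) (fmor f);
  fmor_null : forall X Y f, null C X Y f -> null D (fob X) (fob Y) (fmor f);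
  fmor_linear : forall X Y a f g, hom C X Y f -> hom C X Y g ->
    heq (fmor (a *: f + g)) (a *: fmor f + fmor g);
  fmor_idm : forall X, heq (fmor (idm C X)) (idm D (fob X));
  fmor_comp : forall X Y Z g f, hom C Y Z g -> hom C X Y f ->
    heq (fmor (comp C g f)) (comp D (fmor g) (fmor f)) }.

Arguments fmor {C D} _ {X Y} _.

Definition equivalent (C D : kcat k) : Prop :=
  [/\ is_kcat C, is_kcat D
    & exists (F : functor C D) (G : functor D C)
        (eta : forall X, arr C (G (F X)) X) (eps : forall Y, arr D (F (G Y)) Y),
      [/\ forall X, is_iso (eta X),
          forall Y, is_iso (eps Y),
          forall X X' f, hom C X X' f ->
            heq (comp C (eta X') (fmor G (fmor F f))) (comp C f (eta X))
        & forall Y Y' g, hom D Y Y' g ->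
            heq (comp D (eps Y') (fmor F (fmor G g))) (comp D g (eps Y))]].

Definition seq_class (C : kcat k) : Type :=
  forall X Y Z : C, arr C X Y -> arr C Y Z -> Prop.

Definition split_exact (C : kcat k) : seq_class C := fun X Y Z f g =>
  [/\ hom C X Y f, hom C Y Z g, heq (comp C g f) 0
    & exists rho sigma,
      [/\ hom C Y X rho, hom C Z Y sigma,
          heq (comp C rho f) (idm C X), heq (comp C g sigma) (idm C Z)
        & heq (comp C f rho + comp C sigma g) (idm C Y)]].

Section Exact.
Variables (C : kcat k) (ex : seq_class C).

Definition is_kernel (X Y Z : C) (f : arr C X Y) (g : arr C Y Z) : Prop :=
  [/\ hom C X Y f, hom C Y Z g, heq (comp C g f) 0
    & forall W (u : arr C W Y), hom C W Y u -> heq (comp C g u) 0 ->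
      (exists2 v, hom C W X v & heq (comp C f v) u) /\
      (forall v v', hom C W X v -> hom C W X v' ->
         heq (comp C f v) u -> heq (comp C f v') u -> heq v v')].

Definition is_cokernel (X Y Z : C) (f : arr C X Y) (g : arr C Y Z) : Prop :=
  [/\ hom C X Y f, hom C Y Z g, heq (comp C g f) 0
    & forall W (u : arr C Y W), hom C Y W u -> heq (comp C u f) 0 ->
      (exists2 v, hom C Z W v & heq (comp C v g) u) /\
      (forall v v', hom C Z W v -> hom C Z W v' ->
         heq (comp C v g) u -> heq (comp C v' g) u -> heq v v')].

Definition adm_mono (X Y : C) (f : arr C X Y) : Prop := exists Z g, @ex X Y Z f g.
Definition adm_epi (Y Z : C) (g : arr C Y Z) : Prop := exists X f, @ex X Y Z f g.

Definition is_pushout (A B A' B' : C) (i : arr C A B) (u : arr C A A')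
    (i' : arr C A' B') (u' : arr C B B') : Prop :=
  [/\ hom C A' B' i', hom C B B' u', heq (comp C i' u) (comp C u' i)
    & forall W (p : arr C A' W) (q : arr C B W),
      hom C A' W p -> hom C B W q -> heq (comp C p u) (comp C q i) ->
      (exists2 v, hom C B' W v & heq (comp C v i') p /\ heq (comp C v u') q) /\
      (forall v v', hom C B' W v -> hom C B' W v' ->
         heq (comp C v i') p -> heq (comp C v u') q ->
         heq (comp C v' i') p -> heq (comp C v' u') q -> heq v v')].

Definition is_pullback (B A B' A' : C) (e : arr C B A) (u : arr C A' A)
    (e' : arr C B' A') (u' : arr C B' B) : Prop :=
  [/\ hom C B' A' e', hom C B' B u', heq (comp C u e') (comp C e u')
    & forall W (p : arr C W A') (q : arr C W B),
      hom C W A' p -> hom C W B q -> heq (comp C u p) (comp C e q) ->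
      (exists2 v, hom C W B' v & heq (comp C e' v) p /\ heq (comp C u' v) q) /\
      (forall v v', hom C W B' v -> hom C W B' v' ->
         heq (comp C e' v) p -> heq (comp C u' v) q ->
         heq (comp C e' v') p -> heq (comp C u' v') q -> heq v v')].

(* Quillen's axioms, in Buehler's form. *)
Record is_exact_structure : Prop := IsExactStructure {
  exact_kernel : forall X Y Z f g, @ex X Y Z f g -> is_kernel f g;
  exact_cokernel : forall X Y Z f g, @ex X Y Z f g -> is_cokernel f g;
  exact_iso : forall (X Y Z X' Y' Z' : C) f g f' g' a b c,
    @ex X Y Z f g -> hom C X' Y' f' -> hom C Y' Z' g' ->
    @is_iso C X X' a -> @is_iso C Y Y' b -> @is_iso C Z Z' c ->
    heq (comp C b f) (comp C f' a) -> heq (comp C c g) (comp C g' b) ->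
    ex f' g';
  idm_adm_mono : forall X, adm_mono (idm C X);
  idm_adm_epi : forall X, adm_epi (idm C X);
  comp_adm_mono : forall X Y Z (f : arr C X Y) (g : arr C Y Z),
    adm_mono f -> adm_mono g -> adm_mono (comp C g f);
  comp_adm_epi : forall X Y Z (f : arr C X Y) (g : arr C Y Z),
    adm_epi f -> adm_epi g -> adm_epi (comp C g f);
  pushout_adm_mono : forall A B A' (i : arr C A B) (u : arr C A A'),
    adm_mono i -> hom C A A' u ->
    exists B' (i' : arr C A' B') (u' : arr C B B'),
      is_pushout i u i' u' /\ adm_mono i';
  pullback_adm_epi : forall B A A' (e : arr C B A) (u : arr C A' A),
    adm_epi e -> hom C A' A u ->
    exists B' (e' : arr C B' A') (u' : arr C B' B),
      is_pullback e u e' u' /\ adm_epi e' }.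

Definition projective (P : C) : Prop :=
  forall Y Z (g : arr C Y Z) (h : arr C P Z), adm_epi g -> hom C P Z h ->
    exists2 l, hom C P Y l & heq (comp C g l) h.

Definition injective_ob (Q : C) : Prop :=
  forall X Y (f : arr C X Y) (h : arr C X Q), adm_mono f -> hom C X Q h ->
    exists2 l, hom C Y Q l & heq (comp C l f) h.

Record frobenius : Prop := Frobenius {
  frob_kcat : is_kcat C;
  frob_additive : additive C;
  frob_exact : is_exact_structure;
  frob_enough_proj : forall X, exists P (g : arr C P X), projective P /\ adm_epi g;
  frob_enough_inj : forall X, exists Q (f : arr C X Q), injective_ob Q /\ adm_mono f;
  frob_proj_inj : forall X, projective X <-> injective_ob X }.

Definition stable : kcat k :=
  @KCat k (ob C) (arr C) (hom C)
    (fun X Y f => hom C X Y f /\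
       exists P g h, [/\ projective P, injective_ob P,
         hom C X P g, hom C P Y h & heq f (comp C h g)])
    (idm C) (@comp k C).

End Exact.

(* Data from which an additive category with prescribed indecomposable objects
   is built: all morphisms are given by coordinates in one vector space. *)
Record indcat := IndCat {
  lab : Type;
  coef : lmodType k;
  ihom : lab -> lab -> set coef;
  iid : lab -> coef;
  icomp : forall x y z : lab, coef -> coef -> coef }.

Record fam (T : Type) := Fam { idx : finType; elt :> idx -> T }.

(* Formal finite direct sums; [f i j] is the component from the [i]-th summand
   of the source to the [j]-th summand of the target. *)
Definition add_closure (C : indcat) : kcat k :=
  @KCat k (fam (lab C)) (fun X Y => (idx X -> idx Y -> coef C) : lmodType k)
    (fun X Y f => forall i j, ihom (X i) (Y j) (f i j))
    (fun X Y f => f = 0)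
    (fun X i j => if i == j then iid (X i) else 0)
    (fun X Y Z g f i j =>
       \sum_(l : idx Y) icomp (X i) (Y l) (Z j) (g l j) (f i l)).

(* Pairs (V, d) with d an endomorphism of V. *)
Definition endo_cat (C : kcat k) : kcat k :=
  @KCat k {V : C & arr C V V} (fun X Y => arr C (tag X) (tag Y))
    (fun X Y f => hom C (tag X) (tag Y) f /\
       heq (comp C f (tagged X)) (comp C (tagged Y) f))
    (fun X Y => null C (tag X) (tag Y))
    (fun X => idm C (tag X)) (fun X Y Z g f => comp C g f).

End Categories.

Section Strip.
Variables (R : realType) (k : fieldType).

(* M(mx, my)_+ if [msgn], M(mx, my)_- otherwise. *)
Record mob (r : R) := Mob {
  mx : R; my : R; msgn : bool; mob_bound : `|mx - my| <= r }.

Definition mle (r : R) (M N : mob r) : Prop := mx M <= mx N /\ my M <= my N.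

Definition B_ind (r : R) : indcat :=
  @IndCat k (mob r) (k^o : lmodType k)
    (fun M N => [set a | ~ mle M N -> a = 0])
    (fun _ => 1) (fun _ _ _ b a => b * a).

Definition B2 (r : R) : kcat k := add_closure (B_ind r).

Definition D2 (r : R) : kcat k :=
  @KCat k (B2 r) (arr (B2 r)) (hom (B2 r))
    (fun X Y f => exists (Z : B2 r) g h,
       [/\ forall i : idx Z, `|mx (Z i) - my (Z i)| = r,
           hom (B2 r) X Z g, hom (B2 r) Z Y h & f = comp (B2 r) h g])
    (idm (B2 r)) (@comp k (B2 r)).

Lemma Fs_bound (r s : R) (M : mob r) : `|(my M + s) - (mx M + s)| <= r.
Proof. by rewrite opprD addrACA subrr addr0 distrC mob_bound. Qed.

Definition Fs (r s : R) (M : mob r) : mob r := Mob (~~ msgn M) (Fs_bound s M).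

(* The inverse of F_s is F_(-s). *)
Definition Fs_pow (r s : R) (n : int) (M : mob r) : mob r :=
  match n with
  | Posz m => iter m (Fs s) M
  | Negz m => iter m.+1 (Fs (- s)) M
  end.

Definition FB_ob (r s : R) (n : int) (X : B2 r) : B2 r :=
  @Fam (mob r) (idx X) (fun i => Fs_pow s n (X i)).

Arguments FB_ob {r} s n X.

(* F_s is k-linear and preserves basic morphisms, hence coordinates. *)
Definition FB_mor (r s : R) (n : int) (X Y : B2 r) (f : arr (B2 r) X Y) :
  arr (B2 r) (FB_ob s n X) (FB_ob s n Y) := f.

Arguments FB_mor {r} s n {X Y} f.

(* For [g] and [f] in [hom], f_j vanishes for j << 0 and so does g_(n - j) for
   j >> 0, so that the sum has finite support. *)
Definition orb_comp (r s : R) (X Y Z : B2 r)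
    (g : int -> arr (B2 r) Y Z) (f : int -> arr (B2 r) X Y) (n : int) :
    arr (B2 r) X (FB_ob s n Z) :=
  \sum_(j \in [set: int])
     comp (B2 r) (X := X) (Y := FB_ob s j Y) (Z := FB_ob s n Z)
       (FB_mor s j (g (n - j))) (f j).

(* As F_s does not change index types, [arr X (FB_ob s n Y)] is [arr X Y]. *)
Definition BFhat (r s : R) : kcat k :=
  @KCat k (B2 r) (fun X Y => (int -> arr (B2 r) X Y) : lmodType k)
    (fun X Y f => forall n, hom (B2 r) X (FB_ob s n Y) (f n))
    (fun X Y f => f = 0)
    (fun X n => if n == 0 then idm (B2 r) X else 0)
    (@orb_comp r s).

(* The direct sum over n of the spaces D2(X, F_s^n Y), as families of
   representatives in B2. *)
Definition Crs (r s : R) : kcat k :=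
  @KCat k (D2 r) (fun X Y => (int -> arr (D2 r) X Y) : lmodType k)
    (fun X Y f => (forall n, hom (D2 r) X (FB_ob s n Y) (f n)) /\
       finite_set [set n | ~ null (D2 r) X (FB_ob s n Y) (f n)])
    (fun X Y f => forall n, null (D2 r) X (FB_ob s n Y) (f n))
    (fun X n => if n == 0 then idm (D2 r) X else 0)
    (@orb_comp r s).

End Strip.

Section Circle.
Variable (R : realType).

Definition circle_rel (x y : R) : bool := (y - x) / (2 * pi) \is a Num.int.

Lemma circle_rel_equiv : equiv_class_of circle_rel.
Proof.
split => [x|x y|y x z]; rewrite /circle_rel.
- by rewrite subrr mul0r rpred0.
- by rewrite -opprB mulNr rpredN.
- move=> xy yz; have -> : z - x = (y - x) + (z - y) by rewrite [RHS]addrC subrKA.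
  by rewrite mulrDl rpredD.
Qed.

Canonical circle_equiv := EquivRelPack circle_rel_equiv.

Definition S1 : Type := {eq_quot circle_equiv}%qT.

Definition pt (x : R) : S1 := (\pi_({eq_quot circle_equiv}) x)%qT.
Definition rep (a : S1) : R := repr (a : {eq_quot circle_equiv}%qT).

(* The smallest alpha >= 0 with [x + alpha] = [y], for a = [x] and b = [y]. *)
Definition arc (a b : S1) : R :=
  let v := rep b - rep a in v - 2 * pi * (Num.floor (v / (2 * pi)))%:~R.

End Circle.

Lemma pi2_gt0 (R : realType) : 0 < 2 * pi :> R.
Proof. by rewrite mulr_gt0 ?pi_gt0. Qed.

Lemma rep_pt (R : realType) (x : R) :
  exists n : int, rep (pt x) = x + 2 * pi * n%:~R.
Proof.
have : circle_rel x (rep (pt x)).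
  by have /eqquotP := esym (reprK (pt x : {eq_quot circle_equiv R}%qT)).
rewrite /circle_rel => /intrP[n Hn]; exists n.
by rewrite -Hn mulrC divfK ?gt_eqF ?pi2_gt0// addrC subrK.
Qed.

Lemma floorDz (R : realType) (x : R) (n : int) :
  Num.floor (x + n%:~R) = Num.floor x + n.
Proof. by rewrite floorDrz ?intr_int// intrKfloor. Qed.

Lemma arcE (R : realType) (x y : R) :
  arc (pt x) (pt y) = (y - x) - 2 * pi * (Num.floor ((y - x) / (2 * pi)))%:~R.
Proof.
rewrite /arc; have [n ->] := rep_pt x; have [m ->] := rep_pt y.
have -> : y + 2 * pi * m%:~R - (x + 2 * pi * n%:~R)
   = (y - x) + (m - n)%:~R * (2 * pi) :> R.
  by rewrite opprD addrACA -mulrBr -intrB mulrC.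
rewrite [X in Num.floor X]mulrDl mulfK ?gt_eqF ?pi2_gt0//.
rewrite floorDz (intrD _ _ (m - n)) (mulrDr (2 * pi)) opprD addrACA.
by rewrite [2 * pi * (m - n)%:~R]mulrC subrr addr0.
Qed.

Lemma arc_bounds (R : realType) (a b : S1 R) : 0 <= arc a b < 2 * pi.
Proof.
rewrite /arc; move: (rep b - rep a) => v.
have := floor_itv (v / (2 * pi)); rewrite intrD ler_pdivlMr ?pi2_gt0//.
rewrite ltr_pdivrMr ?pi2_gt0// (mulrDl _ _ (2 * pi)) mul1r [_%:~R * _]mulrC.
by rewrite subr_ge0 ltrBlDl => /andP[-> ->].
Qed.

Lemma arcxx (R : realType) (a : S1 R) : arc a a = 0.
Proof. by rewrite /arc subrr mul0r floor0 mulr0 subrr. Qed.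

Section CircleCat.
Variables (R : realType) (k : fieldType).
Local Notation pi := (@pi R).

(* k[[t]], by coefficients. *)
Definition pseries : lmodType k := (nat -> k^o) : lmodType k.

Definition psmul (f g : pseries) : pseries :=
  fun n => \sum_(i < n.+1) f i * g (n - i)%N.

Definition tpow (m : nat) : pseries := fun n => (n == m)%:R.

(* Hom(P_a, P_b) is identified with k[[t]] through its generator e^(arc a b).
   If [x + alpha] = [y] then alpha = arc [x] [y] + 2 pi m for m the integral
   part of alpha / (2 pi), so that the coordinate of e^alpha is t^m. *)
Definition epow (alpha : R) : pseries := tpow (Num.truncn (alpha / (2 * pi))).

(* (g e^beta) (f e^alpha) = g f e^(alpha + beta) for alpha = arc a b and
   beta = arc b c. *)
Definition P_comp (a b c : S1 R) (g f : pseries) : pseries :=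
  psmul (psmul g f) (epow (arc a b + arc b c)).
Arguments P_comp : simpl never.

Definition P_ind : indcat :=
  @IndCat k (S1 R) pseries (fun _ _ => setT) (fun _ => tpow 0) P_comp.

Definition PS1 : kcat k := add_closure P_ind.

Definition t_endo (V : PS1) : arr PS1 V V :=
  fun i j => if i == j then tpow 1 else 0.
Arguments t_endo V : clear implicits.

Lemma psmul_tpow (a b : nat) : psmul (tpow a) (tpow b) = tpow (a + b).
Proof.
apply/funext => n; rewrite /psmul /tpow.
have [an|na] := leqP a n.
- rewrite (bigD1 (inord a)) //= big1 => [|i].
    rewrite inordK ?ltnS// eqxx mul1r addr0 -[in RHS](subnK an) addnC.
    by rewrite eqn_add2l.
  by rewrite -val_eqE /= inordK ?ltnS// => /negPf ->; rewrite mul0r.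
- rewrite big1 => [|i _]; last first.
    by rewrite ltn_eqF ?mul0r// (leq_ltn_trans _ na)// -ltnS.
  by rewrite ltn_eqF// (leq_trans na)// leq_addr.
Qed.

Lemma psmul1 (f : pseries) : psmul f (tpow 0) = f.
Proof.
apply/funext => n; rewrite /psmul (bigD1 ord_max)//= big1 => [|i].
  by rewrite subnn /tpow mulr1 addr0.
rewrite -val_eqE /= => ni; rewrite /tpow subn_eq0 leqNgt.
by rewrite ltn_neqAle ni -ltnS ltn_ord/= mulr0.
Qed.

Lemma psmul1l (f : pseries) : psmul (tpow 0) f = f.
Proof.
apply/funext => n; rewrite /psmul (bigD1 ord0)//= big1 => [|i].
  by rewrite subn0 /tpow mul1r addr0.
by rewrite -val_eqE /tpow /= => /negPf ->; rewrite mul0r.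
Qed.

Lemma psmul0 (f : pseries) : psmul f 0 = 0.
Proof. by apply/funext => n; rewrite /psmul big1// => i _; rewrite mulr0. Qed.

Lemma psmul0l (f : pseries) : psmul 0 f = 0.
Proof. by apply/funext => n; rewrite /psmul big1// => i _; rewrite mul0r. Qed.

Lemma epow_small (alpha : R) : 0 <= alpha < 2 * pi -> epow alpha = tpow 0.
Proof.
move=> /andP[a0 a1]; congr tpow.
have a0' : 0 <= alpha / (2 * pi) by rewrite divr_ge0// ltW// pi2_gt0.
by apply: truncn_def; rewrite a0' ltr_pdivrMr ?pi2_gt0// mul1r.
Qed.


Lemma P_comp0 a b c g : P_comp a b c g 0 = 0.
Proof. by rewrite /P_comp psmul0 psmul0l. Qed.

Lemma P_comp0l a b c f : P_comp a b c 0 f = 0.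
Proof. by rewrite /P_comp !psmul0l. Qed.

Lemma P_comp1 a b g : P_comp a a b g (tpow 0) = g.
Proof. by rewrite /P_comp arcxx add0r epow_small ?arc_bounds// !psmul1. Qed.

Lemma P_comp1l a b f : P_comp a b b (tpow 0) f = f.
Proof. by rewrite /P_comp arcxx addr0 epow_small ?arc_bounds// psmul1 psmul1l. Qed.

(* The relation e^beta e^alpha = e^(alpha + beta). *)
Lemma P_comp_epow (x y z alpha beta : R) : 0 <= alpha -> 0 <= beta ->
  pt y = pt (x + alpha) -> pt z = pt (x + alpha + beta) ->
  P_comp (pt x) (pt y) (pt z) (epow beta) (epow alpha) = epow (alpha + beta).
Proof.
move=> a0 b0 -> ->.
rewrite /P_comp /epow !psmul_tpow !arcE; congr tpow.
rewrite [x + alpha - x]addrC addKr [x + alpha + beta - _]addrC addKr.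
have p0 : 2 * pi != 0 by rewrite gt_eqF ?pi2_gt0.
have pge : 0 <= 2 * pi by rewrite ltW ?pi2_gt0.
rewrite addrACA -opprD -(mulrDr (2 * pi)) -intrD mulrBl [2 * pi * _]mulrC mulfK//.
have A0 : 0 <= alpha / (2 * pi) by rewrite divr_ge0.
have B0 : 0 <= beta / (2 * pi) by rewrite divr_ge0.
rewrite !(mulrDl alpha beta).
move: (alpha / (2 * pi)) (beta / (2 * pi)) A0 B0 => A B A0 B0.
have fl (u : R) : 0 <= u -> (Num.floor u)%:~R = (Num.truncn u)%:R :> R.
  by move=> u0; rewrite truncn_floor u0 natr_absz ger0_norm// floor_ge0.
rewrite intrD !fl//; apply: esym; apply: truncn_def.
have /andP[hA hA'] := truncn_itv A0; have /andP[hB hB'] := truncn_itv B0.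
set C := A + B - _.
have C0 : 0 <= C by rewrite subr_ge0 lerD.
have /andP[hC hC'] := truncn_itv C0.
have CE : A + B = C + ((Num.truncn A)%:R + (Num.truncn B)%:R) by rewrite subrK.
rewrite -natr1 in hC'; rewrite -natr1 !natrD CE; apply/andP.
by clearbody C; split; lra.
Qed.
Definition is_F (X : endo_cat PS1) : Prop :=
  hom PS1 (tag X) (tag X) (tagged X) /\
  heq (comp PS1 (tagged X) (tagged X)) (t_endo (tag X)).

Definition Fcat : kcat k := full_sub is_F.

Definition F_exact : seq_class Fcat := fun X Y Z f g =>
  [/\ hom Fcat X Y f, hom Fcat Y Z g
    & @split_exact k PS1 (tag (sval X)) (tag (sval Y)) (tag (sval Z)) f g].

(* The direct sum over i of the E(x i, y i); the summand P_[x i] has index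
   (i, false) and the summand P_[y i] has index (i, true). *)
Definition EV (I : finType) (x y : I -> R) : PS1 :=
  @Fam (S1 R) (I * bool)%type (fun p => pt (if p.2 then y p.1 else x p.1)).

Definition Ed (I : finType) (x y : I -> R) : arr PS1 (EV x y) (EV x y) :=
  fun p q => if p.1 == q.1 then
      match p.2, q.2 with
      | false, true => epow (y p.1 - x p.1)
      | true, false => epow (x p.1 + 2 * pi - y p.1)
      | _, _ => 0
      end
    else 0.
Arguments Ed {I} x y _ _.

Lemma sum_pair (I : finType) (F : I * bool -> pseries) :
  \sum_p F p = \sum_i (F (i, false) + F (i, true)).
Proof.
rewrite (eq_bigr (fun p => F (p.1, p.2))) => [|[]//].
rewrite -(pair_bigA _ (fun i b => F (i, b)))/=.
by apply: eq_bigr => i _; rewrite big_bool/= addrC.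
Qed.

Lemma comp_EV (I : finType) (x y : I -> R) (V W : PS1)
    (g : arr PS1 (EV x y) W) (f : arr PS1 V (EV x y)) a b :
  comp PS1 g f a b =
  \sum_i (P_comp (V a) (pt (x i)) (W b) (g (i, false) b) (f a (i, false))
          + P_comp (V a) (pt (y i)) (W b) (g (i, true) b) (f a (i, true))).
Proof. exact: sum_pair. Qed.

Lemma pt_2pi (x : R) : pt (x + 2 * pi) = pt x.
Proof.
apply/esym/eqquotP; rewrite /= /circle_rel [x + _]addrC addrK.
by rewrite divff ?rpred1// gt_eqF ?pi2_gt0.
Qed.

Lemma epow_2pi : epow (2 * pi) = tpow 1.
Proof. by rewrite /epow divff ?gt_eqF ?pi2_gt0// truncn1. Qed.

Lemma Ed_sqr (I : finType) (x y : I -> R)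
    (H : forall i, x i <= y i <= x i + 2 * pi) :
  comp PS1 (Ed x y) (Ed x y) = t_endo (EV x y).
Proof.
apply/funext => -[i p]; apply/funext => -[j q].
have /andP[xy yx] := H i.
rewrite comp_EV /t_endo (bigD1 i)//= big1 ?addr0; last first.
  by move=> l li; rewrite /Ed /= [i == l]eq_sym (negPf li) !P_comp0 addr0.
rewrite /Ed /= eqxx xpair_eqE; have [<-{j}|ij]/= := eqVneq i j; last first.
  by rewrite !P_comp0l addr0.
case: p; case: q => /=; rewrite ?P_comp0 ?P_comp0l ?addr0 ?add0r//.
- rewrite (@P_comp_epow (y i) (x i) (y i)) ?subr_ge0//.
  + by rewrite -epow_2pi; congr epow; ring.
  + by rewrite -[LHS]pt_2pi; congr pt; ring.
  + by rewrite -[LHS]pt_2pi; congr pt; ring.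
- rewrite (@P_comp_epow (x i) (y i) (x i)) ?subr_ge0//.
  + by rewrite -epow_2pi; congr epow; ring.
  + by congr pt; ring.
  + by rewrite -[LHS]pt_2pi; congr pt; ring.
Qed.

Lemma Ed_is_F (I : finType) (x y : I -> R)
    (H : forall i, x i <= y i <= x i + 2 * pi) :
  is_F (Tagged (fun V => arr PS1 V V) (Ed x y)).
Proof.
split=> //; rewrite /heq; apply/eqP; rewrite subr_eq0; apply/eqP.
exact: Ed_sqr.
Qed.

Definition Esum (I : finType) (x y : I -> R)
    (H : forall i, x i <= y i <= x i + 2 * pi) : Fcat :=
  exist is_F _ (Ed_is_F H).

Definition E (x y : R) (H : x <= y <= x + 2 * pi) : Fcat :=
  @Esum unit (fun _ => x) (fun _ => y) (fun _ => H).

Section Esum_dsum.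
Variables (I : finType) (x y : I -> R).
Hypothesis (H : forall i, x i <= y i <= x i + 2 * pi).
Local Notation E1 i := (@EV unit (fun _ => x i) (fun _ => y i)).

Let inj (i : I) : arr PS1 (E1 i) (EV x y) :=
  fun p q => if (i == q.1) && (p.2 == q.2) then tpow 0 else 0.
Let prj (i : I) : arr PS1 (EV x y) (E1 i) :=
  fun q p => if (i == q.1) && (p.2 == q.2) then tpow 0 else 0.

Let comp_inj_r (i : I) W (g : arr PS1 (EV x y) W) p b :
  comp PS1 g (@inj i) p b = g (i, p.2) b.
Proof.
case: p => -[] e; rewrite comp_EV (bigD1 i)//= big1 ?addr0; last first.
  by move=> l li; rewrite /inj /= eq_sym (negPf li) !P_comp0 addr0.
by rewrite /inj /= eqxx; case: e; rewrite /= P_comp0 P_comp1 ?add0r ?addr0.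
Qed.

Let comp_inj_l (i : I) V (f : arr PS1 V (E1 i)) a q :
  comp PS1 (@inj i) f a q = if i == q.1 then f a (tt, q.2) else 0.
Proof.
case: q => j e; rewrite comp_EV (bigD1 tt)//= big1 ?addr0; last by case.
rewrite /inj /=; have [<-|_] := eqVneq i j; last by rewrite !P_comp0l addr0.
by case: e; rewrite /= P_comp0l P_comp1l ?add0r ?addr0.
Qed.

Let comp_prj_r (i : I) W (g : arr PS1 (E1 i) W) q b :
  comp PS1 g (@prj i) q b = if i == q.1 then g (tt, q.2) b else 0.
Proof.
case: q => j e; rewrite comp_EV (bigD1 tt)//= big1 ?addr0; last by case.
rewrite /prj /=; have [<-|_] := eqVneq i j; last by rewrite !P_comp0 addr0.
by case: e; rewrite /= P_comp0 P_comp1 ?add0r ?addr0.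
Qed.

Let comp_prj_l (i : I) V (f : arr PS1 V (EV x y)) a p :
  comp PS1 (@prj i) f a p = f a (i, p.2).
Proof.
case: p => -[] e; rewrite comp_EV (bigD1 i)//= big1 ?addr0; last first.
  by move=> l li; rewrite /prj /= eq_sym (negPf li) !P_comp0l addr0.
by rewrite /prj /= eqxx; case: e; rewrite /= P_comp0l P_comp1l ?add0r ?addr0.
Qed.

Let eq_heq (V W : PS1) (f g : arr PS1 V W) :
  (forall a b, f a b = g a b) -> heq f g.
Proof.
move=> fg; rewrite /heq; apply/eqP; rewrite subr_eq0; apply/eqP.
by apply/funext => a; apply/funext => b.
Qed.

Lemma Esum_dsum : is_dsum (fun i => E (H i)) (Esum H).
Proof.
exists @inj, @prj; split.
- move=> i; split; (split=> //; apply: (@eq_heq)).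
  + move=> [[] e] [j q]; rewrite comp_inj_l [RHS]comp_inj_r /= /Ed /=.
    by [].
  + move=> [j q] [[] e]; rewrite comp_prj_r [LHS]comp_prj_l /= /Ed /=.
    by rewrite eq_sym; case: eqVneq => [<-|].
- by move=> i; apply: (@eq_heq) => -[[] e] [[] q];
    rewrite [LHS]comp_prj_l /inj /= eqxx/= xpair_eqE.
- move=> i j ij; apply: (@eq_heq) => -[[] e] [[] q].
  by rewrite [LHS]comp_prj_l /inj /= (negPf ij).
- apply: (@eq_heq) => -[i p] [j q].
  have sumE (F : I -> arr PS1 (EV x y) (EV x y)) a b :
    (\sum_i F i) a b = \sum_i F i a b by rewrite !fct_sumE.
  rewrite [LHS]sumE (bigD1 i)// big1 => [|l li].
    rewrite [LHS]addr0 [LHS]comp_inj_l /prj /= xpair_eqE eqxx /=.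
    by rewrite [q == p]eq_sym; case: ifP.
  by rewrite [LHS]comp_prj_r /= (negPf li).
Qed.
End Esum_dsum.

(* theta is [pi - c]. *)
Definition is_Fc (c : R) (X : Fcat) : Prop :=
  exists (I : finType) (x y : I -> R)
         (H : forall i, x i <= y i <= x i + 2 * pi),
    (forall i, x i + (pi - c) <= y i <= x i + 2 * pi - (pi - c)) /\
    is_dsum (fun i => E (H i)) X.

Definition Fc (c : R) : kcat k := full_sub (@is_Fc c).

Definition Fc_exact (c : R) : seq_class (Fc c) := fun X Y Z f g =>
  @F_exact (sval X) (sval Y) (sval Z) f g.

Definition Cc (c : R) : kcat k := stable (@Fc_exact c).

End CircleCat.

Section Transport.
Variables (R : realType) (k : fieldType) (r s : R).
Hypotheses (r_gt0 : 0 < r) (r_le_s : r <= s).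
Local Notation pi := (@pi R).

(* On objects, G M is E (Gx M) (Gy M). *)
Definition Gx (M : mob r) : R :=
  if msgn M then pi / s * mx M else pi / s * my M - pi.
Definition Gy (M : mob r) : R :=
  if msgn M then pi / s * my M + pi else pi / s * mx M.

Lemma G_bound (M : mob r) :
  Gx M + (pi - r * pi / s) <= Gy M <= Gx M + 2 * pi - (pi - r * pi / s).
Proof.
have s0 : 0 < s := lt_le_trans r_gt0 r_le_s.
have := mob_bound M; rewrite ler_norml => /andP[h1 h2].
have p0 : 0 <= pi / s by rewrite divr_ge0 ?pi_ge0// ltW.
have := ler_wpM2l p0 h1; have := ler_wpM2l p0 h2.
rewrite [r * pi / s](_ : _ = pi / s * r); last by rewrite -mulrA mulrC.
rewrite !mulrBr mulrN /Gx /Gy; case: (msgn M) => h3 h4; apply/andP; split; lra.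
Qed.

Lemma G_bound2pi (M : mob r) : Gx M <= Gy M <= Gx M + 2 * pi.
Proof.
have s0 : 0 < s := lt_le_trans r_gt0 r_le_s.
have : r * pi / s <= pi by rewrite ler_pdivrMr// mulrC ler_wpM2l ?pi_ge0.
have /andP[] := G_bound M; move: (r * pi / s) => c h1 h2 h3.
by apply/andP; split; lra.
Qed.

Definition GF_ob (X : B2 k r) : Fcat R k :=
  Esum k (fun i : idx X => G_bound2pi (X i)).

Lemma GF_ob_Fc (X : B2 k r) : @is_Fc R k (r * pi / s) (GF_ob X).
Proof.
exists (idx X), (fun i => Gx (X i)), (fun i => Gy (X i)),
  (fun i => G_bound2pi (X i)).
by split; [move=> i; exact: G_bound | exact: Esum_dsum].
Qed.

Definition Ghat_ob (X : BFhat k r s) : Fc k (r * pi / s) :=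
  exist _ (GF_ob X) (GF_ob_Fc X).

(* The component from the [b]-th summand of G M to the [c]-th summand of G N of
   the image of the basic morphism M -> N.  The matrix [0 1; 1 0] exchanges the
   two indices, so that the middle diagonal matrix is read at the indices
   [b] and [c], exchanged when M, resp. N, has sign -. *)
Definition G_basic (M N : mob r) (b c : bool) : pseries k :=
  match b (+) ~~ msgn M, c (+) ~~ msgn N with
  | false, false => epow k (pi / s * (mx N - mx M))
  | true, true => epow k (pi / s * (my N - my M))
  | _, _ => 0
  end.

Definition GV (X : B2 k r) : PS1 R k := tag (sval (GF_ob X)).

Definition G_mor (X Y : B2 k r) (f : arr (B2 k r) X Y) :
    arr (PS1 R k) (GV X) (GV Y) :=
  fun p q => f p.1 q.1 *: G_basic (X p.1) (Y q.1) p.2 q.2.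

(* G (F_s^n Y) = G Y, and the sum over n is t-adically convergent for [f] in
   [hom]: for each exponent [m] of t almost all terms have coefficient 0. *)
Definition Ghat_mor (X Y : BFhat k r s) (f : arr (BFhat k r s) X Y) :
    arr (Fc k (r * pi / s)) (Ghat_ob X) (Ghat_ob Y) :=
  fun p q m =>
    \sum_(n \in [set: int]) @G_mor X (FB_ob s n Y) (f n) p q m.

Definition BFhat_exact : seq_class (BFhat k r s) := fun X Y Z f g =>
  [/\ hom (BFhat k r s) X Y f, hom (BFhat k r s) Y Z g
    & Fc_exact (Ghat_mor f) (Ghat_mor g)].

End Transport.

Arguments BFhat_exact {R} k {r s} r_gt0 r_le_s.
Arguments Crs {R} k r s.
Arguments Cc {R} k c.

(* Main.v *)
(* Put theta = pi - c with c = r pi / s, and call a morphism of P_{S^1} divisible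
   by theta if its entries are multiples of e^alpha for some alpha >= theta.  A
   pair (V, d) of F lies in F_c exactly when d is divisible by theta: a nonzero
   entry of d of least degree splits off a summand E(x, y).  Objects (V, d)
   built from the shift e^theta : V -> V[theta] and the complementary
   e^(2 pi - theta) : V[theta] -> V are relatively projective and injective,
   because the components of d, being divisible by theta, factor through
   e^theta; they cover every object, so F_c is Frobenius.  Since d^2 = t, the
   part of the axioms on epimorphisms follows from the part on monomorphisms by
   passing to opposite categories.

   The functor G^ is fully faithful because, between two given summands, each
   power t^m comes from exactly one degree n of the completed orbit category, and
   commuting with d identifies the two components belonging to the same entry.
   It is essentially surjective, so the Frobenius structure is transported to
   B/F_s^.  Every projective there is a retract of a sum of M(x, y) with
   |x - y| = r, so a stably trivial family (f_n) has all its f_n trivial in D_r.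
   Conversely f_n factors through one such sum for all large n simultaneously,
   f_n = 0 for n << 0, and only finitely many n remain.  Hence the product
   modulo projectives is the direct sum of the orbit category: the two stable
   categories have the same morphisms. *)

Require Import Defs.
From HB Require Import structures.
From mathcomp Require Import all_boot all_order all_algebra.
From mathcomp Require Import boolp classical_sets functions cardinality fsbigop.
From mathcomp Require Import reals trigo.
From mathcomp Require Import ring lra.
From mathcomp Require Import zify.

Set Implicit Arguments.
Unset Strict Implicit.
Unset Printing Implicit Defensive.

Import Order.TTheory GRing.Theory Num.Theory.
Import Defs.
Local Open Scope classical_set_scope.
Local Open Scope ring_scope.

(** * Categories presented by subquotients *)

(** Splitting off E(x, y) needs an entry of least degree alpha that lies off the diagonal, and
    nothing prevents a diagonal entry from having that degree too. If only diagonal entries had it,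
    then alpha = 2 pi n for some n, and the coefficient of t^(2n) in a diagonal entry of d^2 would
    be a nonzero square. But d^2 = t has only the exponent 1, which is not even. The same equation
    gives 2 alpha <= 2 pi, so alpha <= pi. Passing to the opposite category requires a setting that
    is itself symmetric, which matrices over k[[t]] with chosen generators are not on the nose. The
    Frobenius axioms are therefore proved for square roots of a central regular endomorphism lying
    in an ideal of an abstract additive category, with shifts into and out of every object; F_c is
    one instance, its opposite another. Hom spaces are subquotients of spaces of representatives.
    The two stable descriptions use the same representatives, so the comparison at the end is an
    equality and no functor has to be built for it. *)

Section Subspaces.
Context {k : fieldType} {V : lmodType k} {A : set V}.
Hypothesis sA : is_subspace A.

Lemma subspace0 : A 0. Proof. by case: sA. Qed.

Lemma subspaceD u v : A u -> A v -> A (u + v).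
Proof. by move=> Au Av; rewrite -[u]scale1r; apply: sA.2. Qed.

Lemma subspaceZ a u : A u -> A (a *: u).
Proof. by move=> Au; rewrite -[_ *: _]addr0; apply: sA.2 => //; apply: subspace0. Qed.

Lemma subspaceN u : A u -> A (- u).
Proof. by rewrite -scaleN1r; apply: subspaceZ. Qed.

Lemma subspaceB u v : A u -> A v -> A (u - v).
Proof. by move=> Au Av; apply: subspaceD => //; apply: subspaceN. Qed.

Lemma subspace_sum (I : Type) (s : seq I) (P : pred I) (F : I -> V) :
  (forall i, P i -> A (F i)) -> A (\sum_(i <- s | P i) F i).
Proof. by move=> AF; elim/big_ind: _ => //; [exact: subspace0|exact: subspaceD]. Qed.

End Subspaces.

Section HomEquality.
Context {k : fieldType} {C : kcat k}.
Hypothesis kC : is_kcat C.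
Implicit Types X Y Z W : C.

Lemma homB X Y (f g : arr C X Y) : hom C X Y f -> hom C X Y g -> hom C X Y (f - g).
Proof. exact/subspaceB/hom_subspace. Qed.

Lemma homD X Y (f g : arr C X Y) : hom C X Y f -> hom C X Y g -> hom C X Y (f + g).
Proof. exact/subspaceD/hom_subspace. Qed.

Lemma homZ X Y a (f : arr C X Y) : hom C X Y f -> hom C X Y (a *: f).
Proof. exact/subspaceZ/hom_subspace. Qed.

Lemma hom0 X Y : hom C X Y 0.
Proof. exact/subspace0/hom_subspace. Qed.

Lemma heq_refl X Y (f : arr C X Y) : heq f f.
Proof. by rewrite /heq subrr; exact/subspace0/null_subspace. Qed.

Lemma heq_sym X Y (f g : arr C X Y) : heq f g -> heq g f.
Proof. by rewrite /heq -(opprB g f) => fg; rewrite -[g - f]opprK;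
  exact/(subspaceN (null_subspace kC _ _)). Qed.

Lemma heq_trans X Y (f g h : arr C X Y) : heq f g -> heq g h -> heq f h.
Proof.
rewrite /heq => fg gh; rewrite -[f - h](subrKA g).
exact/(subspaceD (null_subspace kC _ _)).
Qed.

Lemma eq_heq X Y (f g : arr C X Y) : f = g -> heq f g.
Proof. by move->; exact: heq_refl. Qed.

Lemma heqD X Y (f g f' g' : arr C X Y) : heq f f' -> heq g g' -> heq (f + g) (f' + g').
Proof.
rewrite /heq => ff gg; rewrite opprD addrACA.
exact/(subspaceD (null_subspace kC _ _)).
Qed.

Lemma heqZ X Y a (f g : arr C X Y) : heq f g -> heq (a *: f) (a *: g).
Proof. by rewrite /heq -scalerBr; exact/subspaceZ/null_subspace. Qed.

Lemma heq0 X Y (f : arr C X Y) : heq f 0 <-> null C X Y f.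
Proof. by rewrite /heq subr0. Qed.

(** Composition is linear only up to [null], and in the form [a *: g + g']; the difference is
    therefore composed as [-1 *: g' + g]. *)
Lemma heq_compl X Y Z (g g' : arr C Y Z) (f : arr C X Y) :
  hom C Y Z g -> hom C Y Z g' -> hom C X Y f -> heq g g' ->
  heq (comp C g f) (comp C g' f).
Proof.
move=> hg hg' hf gg.
have N : null C X Z (comp C (-1 *: g' + g) f).
  by apply: comp_null_l => //; rewrite scaleN1r addrC.
have := comp_linear_l kC (-1) hg' hg hf => /heq_sym L.
have : heq (-1 *: comp C g' f + comp C g f) 0 by apply: heq_trans L _; apply/heq0.
by rewrite heq0 scaleN1r addrC.
Qed.

Lemma heq_compr X Y Z (g : arr C Y Z) (f f' : arr C X Y) :
  hom C Y Z g -> hom C X Y f -> hom C X Y f' -> heq f f' ->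
  heq (comp C g f) (comp C g f').
Proof.
move=> hg hf hf' ff.
have N : null C X Z (comp C g (-1 *: f' + f)).
  by apply: comp_null_r => //; rewrite scaleN1r addrC.
have := comp_linear_r kC (-1) hg hf' hf => /heq_sym L.
have : heq (-1 *: comp C g f' + comp C g f) 0 by apply: heq_trans L _; apply/heq0.
by rewrite heq0 scaleN1r addrC.
Qed.

End HomEquality.

(** * Fully faithful, essentially surjective functors are equivalences *)

Section Equivalences.
Context {k : fieldType} {C D : kcat k}.
Hypotheses (kC : is_kcat C) (kD : is_kcat D).
Variable F : functor C D.

Lemma fmor0 X Y : null D (F X) (F Y) (@fmor _ _ _ F X Y 0).
Proof. exact/fmor_null/subspace0/null_subspace. Qed.

Lemma fmor_heqB X Y (f g : arr C X Y) : hom C X Y f -> hom C X Y g ->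
  heq (fmor F (f - g)) (fmor F f - fmor F g).
Proof.
move=> hf hg; have := fmor_linear F (-1) hg hf.
by rewrite !scaleN1r addrC [X in heq _ X]addrC.
Qed.

Record fully_faithful : Prop := FullyFaithful {
  ff_full : forall X Y g, hom D (F X) (F Y) g ->
    exists2 f, hom C X Y f & heq (fmor F f) g;
  ff_faithful : forall X Y (f : arr C X Y), hom C X Y f ->
    null D (F X) (F Y) (fmor F f) -> null C X Y f }.

Definition inverse_pair (E : kcat k) (X Y : E) (f : arr E X Y) (g : arr E Y X) :=
  [/\ hom E X Y f, hom E Y X g, heq (comp E g f) (idm E X) & heq (comp E f g) (idm E Y)].

Definition essentially_surjective : Prop :=
  forall Y : D, exists (X : C) (f : arr D (F X) Y), is_iso f.

Lemma is_isoP (E : kcat k) (X Y : E) (f : arr E X Y) :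
  is_iso f <-> exists g, inverse_pair f g.
Proof.
split=> [[hf [g hg [gf fg]]]|[g [hf hg gf fg]]]; first by exists g.
by split=> //; exists g.
Qed.

Hypothesis ffF : fully_faithful.

Lemma ff_heq X Y (f g : arr C X Y) : hom C X Y f -> hom C X Y g ->
  heq (fmor F f) (fmor F g) -> heq f g.
Proof.
move=> hf hg fg; apply: (ff_faithful ffF); first exact: homB.
by rewrite -(heq0 (C := D)); apply: heq_trans (fmor_heqB hf hg) _ => //; apply/heq0.
Qed.

Lemma ff_iso X Y (f : arr C X Y) g : hom C X Y f -> hom C Y X g ->
  heq (comp D (fmor F g) (fmor F f)) (idm D (F X)) -> heq (comp C g f) (idm C X).
Proof.
move=> hf hg gf; apply: ff_heq.
- exact: comp_hom.
- exact: idm_hom.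
- apply: (heq_trans kD (fmor_comp F hg hf)); apply: (heq_trans kD gf).
  exact/(heq_sym kD)/fmor_idm.
Qed.

Lemma ff_inverse_pair X Y (f : arr D (F X) (F Y)) g : inverse_pair f g ->
  exists f' g', [/\ inverse_pair f' g', heq (fmor F f') f & heq (fmor F g') g].
Proof.
case=> hf hg gf fg.
have [f' hf' Ef] := ff_full ffF hf; have [g' hg' Eg] := ff_full ffF hg.
have Hf := fmor_hom F hf'; have Hg := fmor_hom F hg'.
exists f', g'; split=> //; split=> //; apply: ff_iso => //.
- apply: (heq_trans kD (heq_compr kD Hg Hf hf Ef)).
  exact: (heq_trans kD (heq_compl kD Hg hg hf Eg)).
- apply: (heq_trans kD (heq_compr kD Hf Hg hg Eg)).
  exact: (heq_trans kD (heq_compl kD Hf hf hg Ef)).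
Qed.

Hypothesis esF : essentially_surjective.

Let S Y : {X : C & {bc : arr D (F X) Y * arr D Y (F X) | inverse_pair bc.1 bc.2}}.
Proof.
have /cid[X H] := esF Y; exists X.
by apply: cid; case: H => b /is_isoP[c bc]; exists (b, c).
Qed.

Let Gob Y : C := tag (S Y).
Let b Y : arr D (F (Gob Y)) Y := (sval (tagged (S Y))).1.
Let c Y : arr D Y (F (Gob Y)) := (sval (tagged (S Y))).2.
Let bc Y : inverse_pair (b Y) (c Y) := svalP (tagged (S Y)).

(** The premise on [g] stands inside the existential so that choice yields a function on all of
    [arr D Y Y'], with arbitrary values outside [hom]. *)
Let G_ex Y Y' (g : arr D Y Y') : exists f : arr C (Gob Y) (Gob Y'), hom D Y Y' g ->
  hom C _ _ f /\ heq (fmor F f) (comp D (c Y') (comp D g (b Y))).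
Proof.
have [hg|ng] := pselect (hom D Y Y' g); last by exists 0.
have [hb _ _ _] := bc Y; have [_ hc _ _] := bc Y'.
have [f hf Ef] := ff_full ffF (comp_hom kD hc (comp_hom kD hg hb)).
by exists f.
Qed.

Let Gmor Y Y' (g : arr D Y Y') := sval (cid (G_ex g)).

Let Gmor_hom Y Y' (g : arr D Y Y') : hom D Y Y' g -> hom C _ _ (Gmor g).
Proof. by move=> /(svalP (cid (G_ex g)))[]. Qed.

Let GmorE Y Y' (g : arr D Y Y') : hom D Y Y' g ->
  heq (fmor F (Gmor g)) (comp D (c Y') (comp D g (b Y))).
Proof. by move=> /(svalP (cid (G_ex g)))[]. Qed.

Let bG Y Y' (g : arr D Y Y') : hom D Y Y' g ->
  heq (comp D (b Y') (fmor F (Gmor g))) (comp D g (b Y)).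
Proof.
move=> hg; have [hb hc cb bcY] := bc Y; have [hb' hc' cb' bcY'] := bc Y'.
have hgb := comp_hom kD hg hb; have hF := fmor_hom F (Gmor_hom hg).
have h1 := comp_hom kD hc' hgb.
apply: (heq_trans kD (heq_compr kD hb' hF h1 (GmorE hg))).
apply: (heq_trans kD (comp_assoc kD hb' hc' hgb)).
apply: (heq_trans kD (heq_compl kD (comp_hom kD hb' hc') (idm_hom kD _) hgb bcY')).
exact: comp_idm_l.
Qed.

Let b_mono Y X (f g : arr D X (F (Gob Y))) : hom D _ _ f -> hom D _ _ g ->
  heq (comp D (b Y) f) (comp D (b Y) g) -> heq f g.
Proof.
have [hb hc cb bcY] := bc Y; move=> hf hg E.
have K f' : hom D X (F (Gob Y)) f' -> heq (comp D (c Y) (comp D (b Y) f')) f'.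
  move=> hf'; apply: (heq_trans kD (comp_assoc kD hc hb hf')).
  apply: (heq_trans kD (heq_compl kD (comp_hom kD hc hb) (idm_hom kD _) hf' cb)).
  exact: comp_idm_l.
apply: (heq_trans kD (heq_sym kD (K _ hf))).
apply: (heq_trans kD (heq_compr kD hc (comp_hom kD hb hf) (comp_hom kD hb hg) E)).
exact: K.
Qed.

(** Since [b Y'] can be cancelled and [F] is faithful, naturality of [b] determines [Gmor g]. Each
    functor law of [Gfun] thus reduces to one naturality square. *)
Let G_heq Y Y' (f : arr C (Gob Y) (Gob Y')) (g : arr D Y Y') :
  hom C _ _ f -> hom D _ _ g ->
  heq (comp D (b Y') (fmor F f)) (comp D g (b Y)) -> heq (Gmor g) f.
Proof.
move=> hf hg E; apply: (ff_heq (Gmor_hom hg) hf).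
apply: b_mono; [exact/fmor_hom/Gmor_hom|exact/fmor_hom|].
exact: (heq_trans kD (bG hg) (heq_sym kD E)).
Qed.

Let Gfun : functor D C.
Proof.
refine (@Functor _ D C Gob (fun Y Y' g => Gmor g) (fun Y Y' g hg => Gmor_hom hg)
  _ _ _ _).
- move=> Y Y' g ng; have hg := null_hom kD ng; apply/heq0/G_heq => //.
    exact: hom0.
  have [hb _ _ _] := bc Y; have [hb' _ _ _] := bc Y'.
  apply: (heq_trans kD ((heq0 _).2 (comp_null_r kD hb' (fmor0 _ _)))).
  exact/(heq_sym kD)/heq0/comp_null_l.
- move=> Y Y' a g g' hg hg'; apply: G_heq.
  + by apply: homD => //; [apply: homZ => //|]; apply: Gmor_hom.
  + by apply: homD => //; apply: homZ.
  have [hb _ _ _] := bc Y; have [hb' _ _ _] := bc Y'.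
  have h1 := Gmor_hom hg; have h2 := Gmor_hom hg'.
  have H1 := fmor_hom F h1; have H2 := fmor_hom F h2.
  have h3 := homD kC (homZ kC a h1) h2.
  apply: (heq_trans kD (heq_compr kD hb' (fmor_hom F h3)
           (homD kD (homZ kD a H1) H2) (fmor_linear F a h1 h2))).
  apply: (heq_trans kD (comp_linear_r kD a hb' H1 H2)).
  apply: (heq_trans kD (heqD kD (heqZ kD a (bG hg)) (bG hg'))).
  exact/(heq_sym kD)/comp_linear_l.
- move=> Y; apply: G_heq; [exact: idm_hom|exact: idm_hom|].
  have [hb _ _ _] := bc Y.
  apply: (heq_trans kD (heq_compr kD hb (fmor_hom F (idm_hom kC _))
           (idm_hom kD _) (fmor_idm F _))).
  apply: (heq_trans kD (comp_idm_r kD hb)).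
  exact: (heq_sym kD (comp_idm_l kD hb)).
- move=> X Y Z g f hg hf; have h1 := Gmor_hom hg; have h2 := Gmor_hom hf.
  have H1 := fmor_hom F h1; have H2 := fmor_hom F h2.
  have [hbX _ _ _] := bc X; have [hbY _ _ _] := bc Y; have [hbZ _ _ _] := bc Z.
  apply: G_heq; [exact: comp_hom|exact: comp_hom|].
  apply: (heq_trans kD (heq_compr kD hbZ (fmor_hom F (comp_hom kC h1 h2))
           (comp_hom kD H1 H2) (fmor_comp F h1 h2))).
  apply: (heq_trans kD (comp_assoc kD hbZ H1 H2)).
  apply: (heq_trans kD (heq_compl kD (comp_hom kD hbZ H1) (comp_hom kD hg hbY) H2 (bG hg))).
  apply: (heq_trans kD (heq_sym kD (comp_assoc kD hg hbY H2))).
  apply: (heq_trans kD (heq_compr kD hg (comp_hom kD hbY H2) (comp_hom kD hf hbX) (bG hf))).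
  exact: comp_assoc.
Defined.

Lemma ff_es_equivalent : equivalent C D.
Proof.
(* The natural isomorphism on [C] is the preimage of [b (F X)] under [F], so that its naturality is
   inherited from that of [b]. *)
have P X : exists f : arr C (Gob (F X)) X, is_iso f /\ heq (fmor F f) (b (F X)).
  have [f [g [fg Ef _]]] := ff_inverse_pair (bc (F X)).
  by exists f; split=> //; apply/is_isoP; exists g.
split=> //; exists F, Gfun, (fun X => sval (cid (P X))), b; split.
- by move=> X; case: (svalP (cid (P X))).
- by move=> Y; apply/is_isoP; exists (c Y).
- move=> X X' f hf; case: (cid (P X)) => e [/= ie Ee]; case: (cid (P X')) => e' [/= ie' Ee'].
  have [he _] := ie; have [he' _] := ie'.
  have hF := fmor_hom F hf; have hG := Gmor_hom hF.
  have HG := fmor_hom F hG; have HE := fmor_hom F he; have HE' := fmor_hom F he'.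
  have [hb _ _ _] := bc (F X); have [hb' _ _ _] := bc (F X').
  apply: ff_heq; [exact: comp_hom|exact: comp_hom|].
  apply: (heq_trans kD (fmor_comp F he' hG)).
  apply: (heq_trans kD (heq_compl kD HE' hb' HG Ee')).
  apply: (heq_trans kD (bG hF)).
  apply: (heq_trans kD (heq_compr kD hF hb HE (heq_sym kD Ee))).
  exact/(heq_sym kD)/fmor_comp.
- by move=> Y Y' g hg; apply: bG.
Qed.

End Equivalences.

(** * Opposite categories *)

Section Opposite.
Context {k : fieldType}.

Definition op (C : kcat k) : kcat k :=
  @KCat k (ob C) (fun X Y => arr C Y X) (fun X Y => hom C Y X)
    (fun X Y => null C Y X) (idm C) (fun X Y Z g f => comp C f g).

Definition opex (C : kcat k) (ex : seq_class C) : seq_class (op C) :=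
  fun X Y Z f g => ex Z Y X g f.

Lemma is_kcat_op (C : kcat k) : is_kcat C -> is_kcat (op C).
Proof.
move=> kC; split=> /=.
- by move=> X Y; apply: hom_subspace.
- by move=> X Y; apply: null_subspace.
- by move=> X Y; apply: null_hom.
- by move=> X; apply: idm_hom.
- by move=> X Y Z g f hg hf; apply: comp_hom.
- by move=> X Y Z a g f f' hg hf hf'; apply: comp_linear_l.
- by move=> X Y Z a g f f' hg hf hf'; apply: comp_linear_r.
- by move=> X Y Z g f hg hf; apply: comp_null_l.
- by move=> X Y Z g f hg hf; apply: comp_null_r.
- by move=> W X Y Z h g f hh hg hf; apply/(heq_sym kC)/comp_assoc.
- by move=> X Y f hf; apply: comp_idm_r.
- by move=> X Y f hf; apply: comp_idm_l.
Qed.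

Definition opF (C D : kcat k) (kD : is_kcat D) (F : functor C D) : functor (op C) (op D).
Proof.
refine (@Functor _ (op C) (op D) (fob F) (fun X Y f => @fmor _ _ _ F Y X f) _ _ _ _ _) => /=.
- by move=> X Y f; apply: fmor_hom.
- by move=> X Y f; apply: fmor_null.
- by move=> X Y a f g; apply: fmor_linear.
- by move=> X; apply: fmor_idm.
- by move=> X Y Z g f hg hf; apply: (fmor_comp F).
Defined.

(** P_{S^1}, F_c and the completed orbit category are not quotients: there [heq] is equality and one
    can rewrite. Only D_r, its orbit category and the stable categories have a nontrivial [null]. *)
Definition strict (C : kcat k) : Prop :=
  forall (X Y : C) (f : arr C X Y), null C X Y f -> f = 0.

Lemma strict_op (C : kcat k) : strict C -> strict (op C).
Proof. by move=> sC X Y f; apply: sC. Qed.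

Lemma opF_ff (C D : kcat k) kD (F : functor C D) : fully_faithful F -> fully_faithful (opF kD F).
Proof.
case=> fF faF; split=> [X Y g hg|X Y f hf nf] /=.
- by have [f hf Ef] := fF _ _ _ hg; exists f.
- exact: faF.
Qed.

Lemma opF_es (C D : kcat k) kD (F : functor C D) :
  essentially_surjective F -> essentially_surjective (opF kD F).
Proof.
move=> eF Y; have [X [f [hf [g hg [gf fg]]]]] := eF Y.
by exists X, g; split=> //; exists f.
Qed.

Lemma projective_op (C : kcat k) (ex : seq_class C) P :
  @projective _ C ex P <-> @injective_ob _ _ (opex ex) P.
Proof. by split=> H Y Z g h ag hh; apply: (H Z Y g h). Qed.

Lemma injective_op (C : kcat k) (ex : seq_class C) P :
  @injective_ob _ C ex P <-> @projective _ _ (opex ex) P.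
Proof. by split=> H Y Z g h ag hh; apply: (H Z Y g h). Qed.

End Opposite.

(** * Calculus of composites, biproducts and projectives in strict categories *)

Section StrictCategory.
Context {k : fieldType} {C : kcat k}.
Hypotheses (kC : is_kcat C) (sC : strict C).
Implicit Types X Y Z W : C.
Local Notation "g ** f" := (comp C g f) (at level 40, left associativity).

Lemma heqP X Y (f g : arr C X Y) : heq f g <-> f = g.
Proof.
split=> [/sC/eqP|->]; first by rewrite subr_eq0 => /eqP.
exact: heq_refl.
Qed.

Lemma compA W X Y Z (h : arr C Y Z) (g : arr C X Y) (f : arr C W X) :
  hom C Y Z h -> hom C X Y g -> hom C W X f -> h ** (g ** f) = h ** g ** f.
Proof. by move=> hh hg hf; apply/heqP/comp_assoc. Qed.

Lemma comp1l X Y (f : arr C X Y) : hom C X Y f -> idm C Y ** f = f.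
Proof. by move=> hf; apply/heqP/comp_idm_l. Qed.

Lemma comp1r X Y (f : arr C X Y) : hom C X Y f -> f ** idm C X = f.
Proof. by move=> hf; apply/heqP/comp_idm_r. Qed.

Lemma comp0r X Y Z (g : arr C Y Z) : hom C Y Z g -> g ** (0 : arr C X Y) = 0.
Proof. by move=> hg; apply/sC/comp_null_r/subspace0/null_subspace. Qed.

Lemma comp0l X Y Z (f : arr C X Y) : hom C X Y f -> (0 : arr C Y Z) ** f = 0.
Proof. by move=> hf; apply: sC; apply: (comp_null_l kC) => //; apply/subspace0/null_subspace. Qed.

Lemma compZDr X Y Z a (g : arr C Y Z) (f f' : arr C X Y) :
  hom C Y Z g -> hom C X Y f -> hom C X Y f' ->
  g ** (a *: f + f') = a *: (g ** f) + g ** f'.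
Proof. by move=> hg hf hf'; apply/heqP/comp_linear_r. Qed.

Lemma compZDl X Y Z a (g g' : arr C Y Z) (f : arr C X Y) :
  hom C Y Z g -> hom C Y Z g' -> hom C X Y f ->
  (a *: g + g') ** f = a *: (g ** f) + g' ** f.
Proof. by move=> hg hg' hf; apply/heqP/comp_linear_l. Qed.

Lemma compDr X Y Z (g : arr C Y Z) (f f' : arr C X Y) :
  hom C Y Z g -> hom C X Y f -> hom C X Y f' ->
  g ** (f + f') = g ** f + g ** f'.
Proof. by move=> hg hf hf'; rewrite -[f]scale1r compZDr // !scale1r. Qed.

Lemma compDl X Y Z (g g' : arr C Y Z) (f : arr C X Y) :
  hom C Y Z g -> hom C Y Z g' -> hom C X Y f ->
  (g + g') ** f = g ** f + g' ** f.
Proof. by move=> hg hg' hf; rewrite -[g]scale1r compZDl // !scale1r. Qed.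

Lemma compZr X Y Z a (g : arr C Y Z) (f : arr C X Y) :
  hom C Y Z g -> hom C X Y f -> g ** (a *: f) = a *: (g ** f).
Proof.
by move=> hg hf; rewrite -[a *: f]addr0 compZDr ?comp0r ?addr0 //; apply: hom0.
Qed.

Lemma compZl X Y Z a (g : arr C Y Z) (f : arr C X Y) :
  hom C Y Z g -> hom C X Y f -> (a *: g) ** f = a *: (g ** f).
Proof.
by move=> hg hf; rewrite -[a *: g]addr0 compZDl ?comp0l ?addr0 //; apply: hom0.
Qed.

Lemma compNr X Y Z (g : arr C Y Z) (f : arr C X Y) :
  hom C Y Z g -> hom C X Y f -> g ** (- f) = - (g ** f).
Proof. by move=> hg hf; rewrite -scaleN1r compZr // scaleN1r. Qed.

Lemma compNl X Y Z (g : arr C Y Z) (f : arr C X Y) :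
  hom C Y Z g -> hom C X Y f -> (- g) ** f = - (g ** f).
Proof. by move=> hg hf; rewrite -scaleN1r compZl // scaleN1r. Qed.

Lemma hom_sum X Y (I : Type) (s : seq I) (P : pred I) (F : I -> arr C X Y) :
  (forall i, hom C X Y (F i)) -> hom C X Y (\sum_(i <- s | P i) F i).
Proof. by move=> hF; apply: (subspace_sum (hom_subspace kC X Y)). Qed.

Lemma comp_suml X Y Z (I : Type) (s : seq I) (P : pred I) (G : I -> arr C Y Z) (f : arr C X Y) :
  (forall i, hom C Y Z (G i)) -> hom C X Y f ->
  (\sum_(i <- s | P i) G i) ** f = \sum_(i <- s | P i) (G i ** f).
Proof.
move=> hG hf; elim: s => [|i s IH]; first by rewrite !big_nil comp0l.
rewrite !big_cons; case: ifP => // _.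
by rewrite compDl ?IH //; apply: hom_sum.
Qed.

Lemma comp_sumr X Y Z (I : Type) (s : seq I) (P : pred I) (g : arr C Y Z) (F : I -> arr C X Y) :
  (forall i, hom C X Y (F i)) -> hom C Y Z g ->
  g ** (\sum_(i <- s | P i) F i) = \sum_(i <- s | P i) (g ** F i).
Proof.
move=> hF hg; elim: s => [|i s IH]; first by rewrite !big_nil comp0r.
rewrite !big_cons; case: ifP => // _.
by rewrite compDr ?IH //; apply: hom_sum.
Qed.

Record biproduct X Y Z (i1 : arr C X Z) (i2 : arr C Y Z) (p1 : arr C Z X) (p2 : arr C Z Y) : Prop :=
  Biproduct {
  bip_hom : [/\ hom C X Z i1, hom C Y Z i2, hom C Z X p1 & hom C Z Y p2];
  bip11 : p1 ** i1 = idm C X;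
  bip22 : p2 ** i2 = idm C Y;
  bip12 : p1 ** i2 = 0;
  bip21 : p2 ** i1 = 0;
  bip_sum : i1 ** p1 + i2 ** p2 = idm C Z }.

Lemma additive_biproduct : additive C -> forall X Y, exists Z i1 i2 p1 p2,
  @biproduct X Y Z i1 i2 p1 p2.
Proof.
move=> aC X Y; have [Z [inj [prj [hip e1 e0 es]]]] := aC bool (fun b => if b then X else Y).
exists Z, (inj true), (inj false), (prj true), (prj false).
have [h1 h3] := hip true; have [h2 h4] := hip false.
split; [by []|by apply/heqP/(e1 true)|by apply/heqP/(e1 false)| | |].
- by apply/heqP; apply: (e0 false true).
- by apply/heqP; apply: (e0 true false).
- by move/heqP: es; rewrite big_bool.
Qed.

Lemma additive_zero : additive C -> exists Z, idm C Z = 0.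
Proof.
move=> aC; have [Z [inj [prj [_ _ _ es]]]] := aC void (fun v => match v with end).
by exists Z; move/heqP: es; rewrite big1 // => -[].
Qed.

Lemma zero_hom_r X Z (f : arr C Z X) : idm C Z = 0 -> hom C Z X f -> f = 0.
Proof. by move=> Z0 hf; rewrite -(comp1r hf) Z0 comp0r. Qed.

Variable ex : seq_class C.
Hypothesis ex_hom : forall X Y Z f g, @ex X Y Z f g -> hom C X Y f /\ hom C Y Z g.

Lemma projective_zero Z : idm C Z = 0 -> projective ex Z.
Proof.
move=> Z0 Y W g h [X [f /ex_hom[_ hg]]] hh; exists 0; first exact: hom0.
by apply/heqP; rewrite (zero_hom_r Z0 hh) comp0r.
Qed.

Lemma projective_retract P Q (i : arr C P Q) (p : arr C Q P) :
  hom C P Q i -> hom C Q P p -> p ** i = idm C P -> projective ex Q -> projective ex P.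
Proof.
move=> hi hp pi pQ Y Z g h ag hh; have [X [f /ex_hom[_ hg]]] := ag.
have [l hl /heqP E] := pQ _ _ _ _ ag (comp_hom kC hh hp).
exists (l ** i); first exact: comp_hom.
by apply/heqP; rewrite compA // E -compA // pi comp1r.
Qed.

Lemma projective_biproduct P Q Z i1 i2 p1 p2 : @biproduct P Q Z i1 i2 p1 p2 ->
  projective ex P -> projective ex Q -> projective ex Z.
Proof.
move=> [[h1 h2 h3 h4] e11 e22 e12 e21 e] pP pQ Y W g h ag hh.
have [X [f /ex_hom[_ hg]]] := ag.
have [l hl /heqP El] := pP _ _ _ _ ag (comp_hom kC hh h1).
have [m hm /heqP Em] := pQ _ _ _ _ ag (comp_hom kC hh h2).
exists (l ** p1 + m ** p2); first by apply: homD => //; apply: comp_hom.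
have c1 := comp_hom kC hl h3; have c2 := comp_hom kC hm h4.
have c3 := comp_hom kC h1 h3; have c4 := comp_hom kC h2 h4.
apply/heqP; rewrite compDr // !compA // El Em -!compA // -compDr // e.
by rewrite comp1r.
Qed.

End StrictCategory.

Lemma biproduct_op (k : fieldType) (C : kcat k) (X Y Z : C) i1 i2 p1 p2 :
  @biproduct k C X Y Z i1 i2 p1 p2 -> @biproduct k (op C) X Y Z p1 p2 i1 i2.
Proof. by case=> -[]. Qed.

Lemma injective_biproduct (k : fieldType) (C : kcat k) (kC : is_kcat C) (sC : strict C)
  (ex : seq_class C) (ex_hom : forall X Y Z f g, @ex X Y Z f g -> hom C X Y f /\ hom C Y Z g)
  (P Q Z : C) i1 i2 p1 p2 : @biproduct k C P Q Z i1 i2 p1 p2 ->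
  injective_ob ex P -> injective_ob ex Q -> injective_ob ex Z.
Proof.
move=> /biproduct_op bp /injective_op iP /injective_op iQ; apply/injective_op.
apply: (projective_biproduct (is_kcat_op kC) (strict_op sC) _ bp iP iQ).
by move=> X Y W f g /ex_hom[].
Qed.

Lemma injective_zero (k : fieldType) (C : kcat k) (kC : is_kcat C) (sC : strict C)
  (ex : seq_class C) (ex_hom : forall X Y Z f g, @ex X Y Z f g -> hom C X Y f /\ hom C Y Z g)
  (Z : C) : idm C Z = 0 -> injective_ob ex Z.
Proof.
move=> Z0; apply/injective_op.
apply: (projective_zero (is_kcat_op kC) (strict_op sC)) => //.
by move=> X Y W f g /ex_hom[].
Qed.

(** * A Frobenius category from two dual halves *)

Section Halves.
Context {k : fieldType}.

(* The part of the definition of a Frobenius category that concerns admissible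
   monomorphisms; the rest of it is this part for the opposite category. *)
Record half_frobenius (C : kcat k) (ex : seq_class C) : Prop := HalfFrobenius {
  half_kernel : forall X Y Z f g, @ex X Y Z f g -> is_kernel f g;
  half_idm : forall X, adm_mono ex (idm C X);
  half_comp : forall X Y Z (f : arr C X Y) (g : arr C Y Z),
    adm_mono ex f -> adm_mono ex g -> adm_mono ex (comp C g f);
  half_pushout : forall A B A' (i : arr C A B) (u : arr C A A'),
    adm_mono ex i -> hom C A A' u ->
    exists B' (i' : arr C A' B') (u' : arr C B B'),
      is_pushout i u i' u' /\ adm_mono ex i';
  half_cover : forall X, exists Q (f : arr C X Q),
    [/\ projective ex Q, injective_ob ex Q & adm_mono ex f] }.

Definition iso_closed (C : kcat k) (ex : seq_class C) : Prop :=
  forall (X Y Z X' Y' Z' : C) f g f' g' a b c,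
    @ex X Y Z f g -> hom C X' Y' f' -> hom C Y' Z' g' ->
    @is_iso k C X X' a -> @is_iso k C Y Y' b -> @is_iso k C Z Z' c ->
    heq (comp C b f) (comp C f' a) -> heq (comp C c g) (comp C g' b) ->
    @ex X' Y' Z' f' g'.

Lemma iso_closed_op (C : kcat k) (kC : is_kcat C) (sC : strict C) (ex : seq_class C) :
  (forall X Y Z f g, @ex X Y Z f g -> hom C X Y f /\ hom C Y Z g) ->
  iso_closed ex -> iso_closed (opex ex).
Proof.
move=> ex_hom ic X Y Z X' Y' Z' f g f' g' a b c /= E hf' hg'.
move=> [ha [a' ha' [aa' a'a]]] [hb [b' hb' [bb' b'b]]] [hc [c' hc' [cc' c'c]]].
move: E; rewrite /opex /= in ha ha' hb hb' hc hc' *.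
move=> E /(heqP kC sC) /= Ebf /(heqP kC sC) /= Ecg.
move/(heqP kC sC): aa' => /= aa'; move/(heqP kC sC): a'a => /= a'a.
move/(heqP kC sC): bb' => /= bb'; move/(heqP kC sC): b'b => /= b'b.
move/(heqP kC sC): cc' => /= cc'; move/(heqP kC sC): c'c => /= c'c.
have [hg hf] := ex_hom _ _ _ _ _ E; rewrite /= in hf' hg'.
(* Isomorphisms of [op C] point backwards in [C], so the closure is applied to their inverses, in
   reverse order. *)
apply: (ic _ _ _ _ _ _ _ _ _ _ c' b' a' E) => //.
- by split=> //; exists c => //; split; apply/(heqP kC sC).
- by split=> //; exists b => //; split; apply/(heqP kC sC).
- by split=> //; exists a => //; split; apply/(heqP kC sC).
- apply/(heqP kC sC); rewrite -[LHS](comp1r kC sC); last exact: comp_hom.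
  rewrite -cc' (compA kC sC) //; last exact: comp_hom.
  rewrite -(compA kC sC (h := b')) // Ecg (compA kC sC) // b'b.
  by rewrite (comp1l kC sC).
- apply/(heqP kC sC); rewrite -[LHS](comp1r kC sC); last exact: comp_hom.
  rewrite -bb' (compA kC sC) //; last exact: comp_hom.
  rewrite -(compA kC sC (h := a')) // Ebf (compA kC sC) // a'a.
  by rewrite (comp1l kC sC).
Qed.

Lemma half_ex_hom (C : kcat k) (ex : seq_class C) : half_frobenius ex ->
  forall X Y Z f g, @ex X Y Z f g -> hom C X Y f /\ hom C Y Z g.
Proof. by move=> H X Y Z f g /(half_kernel H)[]. Qed.

(** The embedding of an injective object into its cover splits, so the object is a retract of
    something projective. *)
Lemma half_injective_projective (C : kcat k) (kC : is_kcat C) (sC : strict C) (ex : seq_class C) :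
  half_frobenius ex -> forall X, injective_ob ex X -> projective ex X.
Proof.
move=> H X iX; have [Q [f [pQ _ af]]] := half_cover H X.
have [Y [g /(half_ex_hom H)[hf _]]] := af.
have [l hl /(heqP kC sC) lf] := iX _ _ _ _ af (idm_hom kC X).
exact: (projective_retract kC sC (half_ex_hom H) hf hl lf).
Qed.

Lemma half_frobenius_frobenius (C : kcat k) (ex : seq_class C) :
  is_kcat C -> strict C -> additive C -> iso_closed ex ->
  half_frobenius ex -> half_frobenius (opex ex) -> frobenius ex.
Proof.
move=> kC sC aC ic H H'; split=> //.
- split.
  + exact: half_kernel H.
  + by move=> X Y Z f g E; case: (half_kernel H' E).
  + exact: ic.
  + exact: half_idm H.
  + exact: (half_idm H').
  + exact: half_comp H.
  + by move=> X Y Z f g af ag; apply: (half_comp H' (f := g) (g := f)).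
  + exact: half_pushout H.
  + by move=> B A A' e u; apply: (half_pushout H' (A := A) (B := B)).
- move=> X; have [P [g [_ /projective_op pP ag]]] := half_cover H' X.
  by exists P, g.
- by move=> X; have [P [g [_ iP ag]]] := half_cover H X; exists P, g.
- move=> X; split=> [/projective_op|].
    move=> /(half_injective_projective (is_kcat_op kC) (strict_op sC) H').
    by move/injective_op.
  exact: half_injective_projective.
Qed.

End Halves.

(** * Transport of exact structures along an equivalence *)

Section Transport.
Context {k : fieldType} {C D : kcat k}.
Hypotheses (kC : is_kcat C) (kD : is_kcat D) (sC : strict C) (sD : strict D).
Variable F : functor C D.
Hypotheses (ffF : fully_faithful F) (esF : essentially_surjective F).
Variables (exC : seq_class C) (exD : seq_class D).
Hypothesis exCE : forall X Y Z f g, @exC X Y Z f g <->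
  [/\ hom C X Y f, hom C Y Z g & @exD (F X) (F Y) (F Z) (fmor F f) (fmor F g)].
Hypothesis exD_hom : forall X Y Z f g, @exD X Y Z f g -> hom D X Y f /\ hom D Y Z g.
Hypothesis icD : iso_closed exD.
Local Notation "g ** f" := (comp C g f) (at level 40, left associativity).
Local Notation "g *** f" := (comp D g f) (at level 40, left associativity).

Lemma fmorM X Y Z (g : arr C Y Z) (f : arr C X Y) : hom C Y Z g -> hom C X Y f ->
  fmor F (g ** f) = fmor F g *** fmor F f.
Proof. by move=> hg hf; apply/(heqP kD sD)/fmor_comp. Qed.

Lemma fmor1 X : fmor F (idm C X) = idm D (F X).
Proof. exact/(heqP kD sD)/fmor_idm. Qed.

Lemma fmor_zero X Y : fmor F (0 : arr C X Y) = 0.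
Proof. exact/sD/fmor0. Qed.

Lemma full X Y (g : arr D (F X) (F Y)) : hom D _ _ g ->
  exists2 f, hom C X Y f & fmor F f = g.
Proof. by move=> /(ff_full ffF)[f hf /(heqP kD sD)]; exists f. Qed.

Lemma faithful X Y (f g : arr C X Y) : hom C X Y f -> hom C X Y g ->
  fmor F f = fmor F g -> f = g.
Proof. by move=> hf hg E; apply/(heqP kC sC)/(ff_heq kC kD ffF) => //; apply/(heqP kD sD). Qed.

Definition iso_pair (X Y : D) (b : arr D X Y) (c : arr D Y X) : Prop :=
  [/\ hom D X Y b, hom D Y X c, c *** b = idm D X & b *** c = idm D Y].

Lemma iso_pairP X Y (b : arr D X Y) c : iso_pair b c -> is_iso b.
Proof. by case=> hb hc cb bc; split=> //; exists c => //; split; apply/(heqP kD sD). Qed.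

Lemma iso_pairC X Y (b : arr D X Y) c : iso_pair b c -> iso_pair c b.
Proof. by case. Qed.

Lemma iso_pair1 X : iso_pair (idm D X) (idm D X).
Proof. by have h := idm_hom kD X; split=> //; rewrite (comp1l kD sD). Qed.

Lemma es_pair Y : exists (X : C) (b : arr D (F X) Y) c, iso_pair b c.
Proof.
have [X [b [hb [c hc [/(heqP kD sD) cb /(heqP kD sD) bc]]]]] := esF Y.
by exists X, b, c.
Qed.

Lemma ex_iso X Y Z X' Y' Z' f g f' g' a a' b b' c c' :
  @exD X Y Z f g -> hom D X' Y' f' -> hom D Y' Z' g' ->
  @iso_pair X X' a a' -> @iso_pair Y Y' b b' -> @iso_pair Z Z' c c' ->
  b *** f = f' *** a -> c *** g = g' *** b -> @exD X' Y' Z' f' g'.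
Proof.
move=> E hf hg /iso_pairP ia /iso_pairP ib /iso_pairP ic E1 E2.
by apply: (icD E hf hg ia ib ic); apply/(heqP kD sD).
Qed.

(** The cokernel of [fmor F f] need not be a value of [F]. Essential surjectivity replaces it by an
    isomorphic object, and closure under isomorphisms keeps the sequence exact. *)
Lemma adm_monoE X Y (f : arr C X Y) :
  adm_mono exC f <-> hom C X Y f /\ adm_mono exD (fmor F f).
Proof.
split=> [[Z [g /exCE[hf hg E]]]|[hf [Z [g E]]]].
  by split=> //; exists (F Z), (fmor F g).
have [Z' [b [c bc]]] := es_pair Z; have [hb hc cb bcZ] := bc.
have [hFf hg] := exD_hom E.
have [g' hg' Eg] := full (comp_hom kD hc hg).
exists Z', g'; apply/exCE; split=> //.
apply: (ex_iso E hFf (fmor_hom F hg') (iso_pair1 _) (iso_pair1 _) (iso_pairC bc)).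
- by rewrite (comp1l kD sD) // (comp1r kD sD).
- by rewrite Eg (comp1r kD sD) //; apply: comp_hom.
Qed.

Lemma adm_mono_iso X Y Y' (f : arr D X Y) (b : arr D Y Y') c : iso_pair b c ->
  adm_mono exD f -> adm_mono exD (b *** f).
Proof.
move=> bc [Z [g E]]; have [hf hg] := exD_hom E; have [hb hc cb bcY] := bc.
exists Z, (g *** c).
apply: (ex_iso E _ _ (iso_pair1 _) bc (iso_pair1 _)); try exact: comp_hom.
- by rewrite (comp1r kD sD) //; apply: comp_hom.
- by rewrite (comp1l kD sD) // -(compA kD sD) // cb (comp1r kD sD).
Qed.

(** A lifting problem is sent to [D], solved on [Q'] and brought back by fullness and faithfulness.
    The object [Q'] is only isomorphic to [F Q] because covers constructed in [D] are not values of
    [F]. *)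
Lemma lift_projective (Q : C) Q' (b : arr D (F Q) Q') c : iso_pair b c ->
  projective exD Q' -> projective exC Q.
Proof.
move=> [hb hc cb bc] pQ Y Z g h [X [f /exCE[hf hg E]]] hh.
have ag : adm_epi exD (fmor F g) by exists (F X), (fmor F f).
have Hh := fmor_hom F hh; have Hg := fmor_hom F hg.
have [l hl /(heqP kD sD) El] := pQ _ _ _ _ ag (comp_hom kD Hh hc).
have [l' hl' El'] := full (comp_hom kD hl hb).
exists l' => //; apply/(heqP kC sC)/faithful => //; first exact: comp_hom.
by rewrite fmorM // El' (compA kD sD) // El -(compA kD sD) // cb (comp1r kD sD).
Qed.

Lemma lift_ex X Y Z f g : @exD X Y Z f g ->
  exists (X' Y' Z' : C) (f' : arr C X' Y') (g' : arr C Y' Z') a a' b b' c c',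
    [/\ @exC X' Y' Z' f' g', @iso_pair (F X') X a a', @iso_pair (F Y') Y b b',
        @iso_pair (F Z') Z c c' & c *** fmor F g' = g *** b].
Proof.
move=> E; have [hf hg] := exD_hom E.
have [X' [a [a' ia]]] := es_pair X; have [ha ha' aa' a'a] := ia.
have [Y' [b [b' ib]]] := es_pair Y; have [hb hb' bb' b'b] := ib.
have [Z' [c [c' ic]]] := es_pair Z; have [hc hc' cc' c'c] := ic.
have hfa := comp_hom kD hf ha; have hgb := comp_hom kD hg hb.
have [f' hf' Ef] := full (comp_hom kD hb' hfa).
have [g' hg' Eg] := full (comp_hom kD hc' hgb).
exists X', Y', Z', f', g', a, a', b, b', c, c'; split=> //; last first.
  by rewrite Eg (compA kD sD) // c'c (comp1l kD sD).
apply/exCE; split=> //.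
apply: (ex_iso E _ _ (iso_pairC ia) (iso_pairC ib) (iso_pairC ic)).
- exact: fmor_hom.
- exact: fmor_hom.
- rewrite Ef -!(compA kD sD) //.
  by rewrite a'a (comp1r kD sD).
- rewrite Eg -!(compA kD sD) //.
  by rewrite b'b (comp1r kD sD).
Qed.

Lemma projectiveE (P : C) : projective exC P <-> projective exD (F P).
Proof.
split=> [pP Y Z g h [X [f E]] hh|]; last exact: (lift_projective (iso_pair1 (F P))).
have [X' [Y' [Z' [f' [g' [a [a' [b [b' [c [c' [E' ia ib ic Eg]]]]]]]]]]]] := lift_ex E.
have [hf hg] := exD_hom E.
have [hb hb' bb' b'b] := ib; have [hc hc' cc' c'c] := ic.
have [h' hh' Eh] := full (comp_hom kD hc' hh).
have ag : adm_epi exC g' by exists X', f'.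
have [hf' hg' _] := (exCE f' g').1 E'.
have [l hl /(heqP kC sC) El] := pP _ _ _ _ ag hh'.
have Hl := fmor_hom F hl; have Hg := fmor_hom F hg'.
exists (b *** fmor F l); first exact: comp_hom.
apply/(heqP kD sD).
rewrite (compA kD sD) // -Eg -(compA kD sD) // -fmorM // El Eh.
by rewrite (compA kD sD) // c'c (comp1l kD sD).
Qed.

End Transport.

Lemma additive_transport (k : fieldType) (C D : kcat k) (F : functor C D) :
  is_kcat C -> is_kcat D -> strict C -> strict D ->
  fully_faithful F -> essentially_surjective F -> additive D -> additive C.
Proof.
move=> kC kD sC sD ffF esF aD I Xs.
have [Y' [inj [prj [hip e1 e0 es]]]] := aD I (fun i => F (Xs i)).
have [Y [b [c [hb hc cb bc]]]] := es_pair kD sD esF Y'.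
have hi i := (hip i).1; have hp i := (hip i).2.
pose inj' i := cid2 (full kD sD ffF (comp_hom kD hc (hi i))).
pose prj' i := cid2 (full kD sD ffF (comp_hom kD (hp i) hb)).
have Hi i : hom C (Xs i) Y (s2val (inj' i)) by case: (inj' i).
have Hp i : hom C Y (Xs i) (s2val (prj' i)) by case: (prj' i).
have Ei i : fmor F (s2val (inj' i)) = comp D c (inj i) by case: (inj' i).
have Ep i : fmor F (s2val (prj' i)) = comp D (prj i) b by case: (prj' i).
have FE X Z (f g : arr C X Z) : hom C X Z f -> hom C X Z g -> fmor F f = fmor F g -> heq f g.
  by move=> hf hg E; apply/(heqP kC sC)/(faithful kC kD sC sD ffF).
have pi i j : comp D (comp D (prj j) b) (comp D c (inj i)) = comp D (prj j) (inj i).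
  rewrite -(compA kD sD) ?(compA kD sD (h := b)) //; last exact: comp_hom.
  by rewrite bc (comp1l kD sD).
exists Y, (fun i => s2val (inj' i)), (fun i => s2val (prj' i)); split=> //.
- move=> i; apply: FE; [exact: comp_hom|exact: idm_hom|].
  by rewrite fmorM // (fmor1 kD sD) Ei Ep pi; apply/(heqP kD sD).
- move=> i j ij; apply: FE; [exact: comp_hom|exact: hom0|].
  by rewrite fmorM // (fmor_zero kC sD) Ei Ep pi; apply/(heqP kD sD)/e0.
- have hip' i := comp_hom kC (Hi i) (Hp i).
  apply: FE; [exact: hom_sum|exact: idm_hom|].
  have FS (s : seq I) (G : I -> arr C Y Y) : (forall i, hom C Y Y (G i)) ->
      fmor F (\sum_(i <- s) G i) = \sum_(i <- s) fmor F (G i).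
    move=> hG; elim: s => [|i s IH]; first by rewrite !big_nil (fmor_zero kC sD).
    rewrite !big_cons -IH -[G i]scale1r; apply/(heqP kD sD).
    have := fmor_linear F 1 (hG i) (hom_sum kC s predT hG).
    by rewrite !scale1r.
  rewrite FS // (fmor1 kD sD) -cb.
  have hinj i : hom D Y' Y' (comp D (inj i) (prj i)) by apply: comp_hom.
  transitivity (comp D (comp D c (\sum_i comp D (inj i) (prj i))) b); last first.
    by move/(heqP kD sD): es => ->; rewrite (comp1r kD sD).
  rewrite (comp_sumr kD sD) // (comp_suml kD sD) //; last by move=> i; apply: comp_hom.
  apply: eq_bigr => i _; rewrite fmorM // Ei Ep !(compA kD sD) //.
  exact: comp_hom.
Qed.

Section TransportHalf.
Context {k : fieldType} {C D : kcat k}.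
Hypotheses (kC : is_kcat C) (kD : is_kcat D) (sC : strict C) (sD : strict D).
Variable F : functor C D.
Hypotheses (ffF : fully_faithful F) (esF : essentially_surjective F).
Variables (exC : seq_class C) (exD : seq_class D).
Hypothesis exCE : forall X Y Z f g, @exC X Y Z f g <->
  [/\ hom C X Y f, hom C Y Z g & @exD (F X) (F Y) (F Z) (fmor F f) (fmor F g)].
Hypothesis exD_hom : forall X Y Z f g, @exD X Y Z f g -> hom D X Y f /\ hom D Y Z g.
Hypothesis icD : iso_closed exD.

Let kO := is_kcat_op kC.
Let kO' := is_kcat_op kD.
Let sO := strict_op sC.
Let sO' := strict_op sD.
Let ffO := opF_ff kD ffF.
Let esO := opF_es kD esF.

Let exOE X Y Z f g : @opex _ _ exC X Y Z f g <->
  [/\ hom (op C) X Y f, hom (op C) Y Z g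
    & @opex _ _ exD (F X) (F Y) (F Z) (fmor (opF kD F) f) (fmor (opF kD F) g)].
Proof. by split=> [/exCE[]|[hf hg E]] //; apply/exCE. Qed.

Let exO_hom X Y Z f g : @opex _ _ exD X Y Z f g -> hom (op D) X Y f /\ hom (op D) Y Z g.
Proof. by move=> /exD_hom[]. Qed.

Let icO := iso_closed_op kD sD exD_hom icD.

Lemma injectiveE (P : C) : injective_ob exC P <-> injective_ob exD (F P).
Proof.
split=> [/injective_op iP|/injective_op iP]; apply/injective_op.
  exact/(projectiveE kO kO' sO sO' ffO esO exOE exO_hom icO).
exact/(projectiveE kO kO' sO sO' ffO esO exOE exO_hom icO).
Qed.

Lemma lift_injective (Q : C) (Q' : D) (b : arr D (F Q) Q') c : iso_pair b c ->
  injective_ob exD Q' -> injective_ob exC Q.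
Proof.
move=> [hb hc cb bc] /injective_op iQ; apply/injective_op.
exact: (@lift_projective _ _ _ kO kO' sO sO' (opF kD F) ffO _ _ exOE Q Q' c b).
Qed.

Lemma lift_iso_closed : iso_closed exC.
Proof.
move=> X Y Z X' Y' Z' f g f' g' a b c /exCE[hf hg E] hf' hg'.
move=> [ha [a' ha' [aa' a'a]]] [hb [b' hb' [bb' b'b]]] [hc [c' hc' [cc' c'c]]].
move=> /(heqP kC sC) Ef /(heqP kC sC) Eg; apply/exCE; split=> //.
have FE X1 Y1 (u : arr C X1 Y1) v : hom C _ _ u -> hom C _ _ v ->
    heq (comp C v u) (idm C X1) -> heq (comp C u v) (idm C Y1) -> is_iso (fmor F u).
  move=> hu hv /(heqP kC sC) vu /(heqP kC sC) uv; split; first exact: fmor_hom.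
  exists (fmor F v); first exact: fmor_hom.
  by rewrite -!(fmorM kD sD F) // vu uv !(fmor1 kD sD); split; apply/(heqP kD sD).
apply: (icD E (fmor_hom F hf') (fmor_hom F hg') (FE _ _ _ _ ha ha' aa' a'a)
  (FE _ _ _ _ hb hb' bb' b'b) (FE _ _ _ _ hc hc' cc' c'c)).
- by apply/(heqP kD sD); rewrite -!(fmorM kD sD F) // Ef.
- by apply/(heqP kD sD); rewrite -!(fmorM kD sD F) // Eg.
Qed.

Local Notation "g ** f" := (comp C g f) (at level 40, left associativity).
Local Notation "g *** f" := (comp D g f) (at level 40, left associativity).
Let full' := full kD sD ffF.
Let faithful' := faithful kC kD sC sD ffF.
Let FM := fmorM kD sD F.

Lemma lift_half_frobenius : half_frobenius exD -> half_frobenius exC.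
Proof.
move=> H; have aE := adm_monoE kD sD ffF esF exCE exD_hom icD.
have ai := adm_mono_iso kD sD exD_hom icD.
split.
- move=> X Y Z f g /exCE[hf hg E]; have [Hf Hg /(heqP kD sD) Egf U] := half_kernel H E.
  split=> //.
    apply/(heqP kC sC)/faithful'; [exact: comp_hom|exact: hom0|].
    by rewrite FM // Egf (fmor_zero kC sD).
  move=> W u hu /(heqP kC sC) gu; have Hu := fmor_hom F hu.
  have gu0 : heq (fmor F g *** fmor F u) 0.
    by rewrite -FM // gu (fmor_zero kC sD); apply: heq_refl.
  have [[v hv /(heqP kD sD) Ev] uniq_v] := U _ _ Hu gu0; split.
    have [v' hv' Ev'] := full' hv; exists v' => //.
    apply/(heqP kC sC)/faithful' => //; first exact: comp_hom.
    by rewrite FM // Ev'.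
  move=> v1 v2 h1 h2 /(heqP kC sC) E1 /(heqP kC sC) E2.
  apply/(heqP kC sC)/faithful' => //; apply/(heqP kD sD)/uniq_v.
  + exact: fmor_hom.
  + exact: fmor_hom.
  + by apply/(heqP kD sD); rewrite -FM // E1.
  + by apply/(heqP kD sD); rewrite -FM // E2.
- move=> X; apply/aE; split; first exact: idm_hom.
  by rewrite (fmor1 kD sD); apply: half_idm.
- move=> X Y Z f g /aE[hf af] /aE[hg ag]; apply/aE; split; first exact: comp_hom.
  by rewrite FM //; apply: half_comp.
- move=> A B A' i u /aE[hi ai'] hu; have Hi := fmor_hom F hi; have Hu := fmor_hom F hu.
  have [B' [i' [u' [[hi' hu' /(heqP kD sD) Eiu U] ai'']]]] := half_pushout H ai' Hu.
  (* The pushout object of [D] is exchanged for an isomorphic [F Q]; the isomorphism is then carried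
     through existence and uniqueness. *)
  have [Q [b [c bc]]] := es_pair kD sD esF B'; have [hb hc cb bcB] := bc.
  have [i2 hi2 Ei2] := full' (comp_hom kD hc hi').
  have [u2 hu2 Eu2] := full' (comp_hom kD hc hu').
  exists Q, i2, u2; split; last first.
    by apply/aE; split=> //; rewrite Ei2; apply: (ai _ _ _ _ _ b).
  split=> //.
    apply/(heqP kC sC)/faithful'; try exact: comp_hom.
    by rewrite !FM // Ei2 Eu2 -!(compA kD sD) // Eiu.
  move=> W p q hp hq /(heqP kC sC) Epq.
  have Hp := fmor_hom F hp; have Hq := fmor_hom F hq.
  have E : heq (fmor F p *** fmor F u) (fmor F q *** fmor F i).
    by apply/(heqP kD sD); rewrite -!FM // Epq.
  have [[v hv [/(heqP kD sD) Ev1 /(heqP kD sD) Ev2]] uniq_v] := U _ _ _ Hp Hq E; split.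
    have [v' hv' Ev'] := full' (comp_hom kD hv hb); exists v' => //.
    by split; apply/(heqP kC sC)/faithful'; (try exact: comp_hom) => //;
      rewrite FM // Ev' ?Ei2 ?Eu2 -(compA kD sD) // ?(compA kD sD (h := b)) // ?bcB
        ?(comp1l kD sD) //; apply: comp_hom.
  move=> v1 v2 h1 h2 /(heqP kC sC) E1 /(heqP kC sC) E2 /(heqP kC sC) E3 /(heqP kC sC) E4.
  have H1 := fmor_hom F h1; have H2 := fmor_hom F h2.
  apply/(heqP kC sC)/faithful' => //.
  suff Evc : fmor F v1 *** c = fmor F v2 *** c.
    by rewrite -[LHS](comp1r kD sD) // -[RHS](comp1r kD sD) // -cb !(compA kD sD) // Evc.
  apply/(heqP kD sD)/uniq_v; try exact: comp_hom.
  + by apply/(heqP kD sD); rewrite -(compA kD sD) // -Ei2 -FM // E1.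
  + by apply/(heqP kD sD); rewrite -(compA kD sD) // -Eu2 -FM // E2.
  + by apply/(heqP kD sD); rewrite -(compA kD sD) // -Ei2 -FM // E3.
  + by apply/(heqP kD sD); rewrite -(compA kD sD) // -Eu2 -FM // E4.
- move=> X; have [Q' [f [pQ iQ af]]] := half_cover H (F X).
  have [Q [b [c bc]]] := es_pair kD sD esF Q'; have [hb hc cb bcB] := bc.
  have [Y [g /exD_hom[hf _]]] := af.
  have [f' hf' Ef] := full' (comp_hom kD hc hf).
  exists Q, f'; split.
  + exact: (lift_projective kC kD sC sD ffF exCE bc pQ).
  + exact: (lift_injective bc iQ).
  + by apply/aE; split=> //; rewrite Ef; apply: (ai _ _ _ _ _ b).
Qed.

End TransportHalf.

Lemma lift_half_frobenius_op (k : fieldType) (C D : kcat k) (kC : is_kcat C) (kD : is_kcat D)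
    (sC : strict C) (sD : strict D) (F : functor C D) (ffF : fully_faithful F)
    (esF : essentially_surjective F) (exC : seq_class C) (exD : seq_class D) :
  (forall X Y Z f g, @exC X Y Z f g <->
    [/\ hom C X Y f, hom C Y Z g & @exD (F X) (F Y) (F Z) (fmor F f) (fmor F g)]) ->
  (forall X Y Z f g, @exD X Y Z f g -> hom D X Y f /\ hom D Y Z g) -> iso_closed exD ->
  half_frobenius (opex exD) -> half_frobenius (opex exC).
Proof.
move=> exCE exD_hom icD.
apply: (@lift_half_frobenius k (op C) (op D) (is_kcat_op kC) (is_kcat_op kD)
  (strict_op sC) (strict_op sD) (opF kD F) (opF_ff _ ffF) (opF_es _ esF) _ (opex exD)).
- by move=> X Y Z f g; split=> [/exCE[]|[hf hg E]] //; apply/exCE.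
- by move=> X Y Z f g /exD_hom[].
- exact: (iso_closed_op kD sD exD_hom icD).
Qed.

Lemma adm_epiE (k : fieldType) (C D : kcat k) (kC : is_kcat C) (kD : is_kcat D)
    (sC : strict C) (sD : strict D) (F : functor C D) (ffF : fully_faithful F)
    (esF : essentially_surjective F) (exC : seq_class C) (exD : seq_class D) :
  (forall X Y Z f g, @exC X Y Z f g <->
    [/\ hom C X Y f, hom C Y Z g & @exD (F X) (F Y) (F Z) (fmor F f) (fmor F g)]) ->
  (forall X Y Z f g, @exD X Y Z f g -> hom D X Y f /\ hom D Y Z g) -> iso_closed exD ->
  forall Y Z (g : arr C Y Z), adm_epi exC g <-> hom C Y Z g /\ adm_epi exD (fmor F g).
Proof.
move=> exCE exD_hom icD Y Z g.
apply: (@adm_monoE k (op C) (op D) (is_kcat_op kD) (strict_op sD) (opF kD F)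
  (opF_ff _ ffF) (opF_es _ esF) (opex exC) (opex exD)).
- by move=> X1 Y1 Z1 f1 g1; split=> [/exCE[]|[hf hg E]] //; apply/exCE.
- by move=> X1 Y1 Z1 f1 g1 /exD_hom[].
- exact: (iso_closed_op kD sD exD_hom icD).
Qed.

(** * Stable categories *)

Section Stable.
Context {k : fieldType}.

(** Additivity makes the null morphisms a subspace: two factorizations combine through a biproduct
    of the intermediate objects, and 0 factors through a zero object. *)
Lemma stable_is_kcat (C : kcat k) (kC : is_kcat C) (sC : strict C) (ex : seq_class C) :
  (forall X Y Z f g, @ex X Y Z f g -> hom C X Y f /\ hom C Y Z g) -> additive C ->
  is_kcat (stable ex).
Proof.
move=> ex_hom aC.
have stable_heq X Y (f g : arr C X Y) : f = g -> @heq k (stable ex) X Y f g.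
  move=> ->; rewrite /heq subrr; split; first exact: hom0.
  have [Z Z0] := additive_zero kC sC aC.
  exists Z, 0, 0; split; [exact: projective_zero|exact: injective_zero|exact: hom0|exact: hom0|].
  by apply/(heqP kC sC); rewrite (comp0r kC sC) //; apply: hom0.
split=> /=.
- exact: hom_subspace.
- move=> X Y; split.
    by have := stable_heq X Y 0 0 erefl; rewrite /heq subrr.
  move=> a u v [hu [P [g [h [pP iP hg hh /(heqP kC sC) Eu]]]]].
  move=> [hv [Q [g' [h' [pQ iQ hg' hh' /(heqP kC sC) Ev]]]]].
  split; first by apply: homD => //; apply: homZ.
  have [Z [i1 [i2 [p1 [p2 bp]]]]] := additive_biproduct kC sC aC P Q.
  have [[h1 h2 h3 h4] e11 e22 e12 e21 _] := bp.
  exists Z, (a *: comp C i1 g + comp C i2 g'), (comp C h p1 + comp C h' p2).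
  have c1 := comp_hom kC h1 hg; have c2 := comp_hom kC h2 hg'.
  have c3 := comp_hom kC hh h3; have c4 := comp_hom kC hh' h4.
  have z1 := homZ kC a c1.
  split.
  + exact: (projective_biproduct kC sC ex_hom bp).
  + exact: (injective_biproduct kC sC ex_hom bp).
  + exact: homD.
  + exact: homD.
  + apply/(heqP kC sC); rewrite (compDl kC sC) ?(compDr kC sC) ?(compZr kC sC) //; last exact: homD.
    rewrite -!(compA kC sC) ?(compA kC sC (h := p1)) ?(compA kC sC (h := p2)) // e11 e12 e21 e22.
    rewrite !(comp1l kC sC) ?(comp0l kC sC) // ?(comp0r kC sC) //.
    by rewrite scaler0 addr0 add0r Eu Ev.
- by move=> X Y f [].
- exact: idm_hom.
- by move=> X Y Z g f; apply: comp_hom.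
- by move=> X Y Z a g f f' hg hf hf'; apply/stable_heq/(compZDr kC sC).
- by move=> X Y Z a g f f' hg hf hf'; apply/stable_heq/(compZDl kC sC).
- move=> X Y Z g f hg [hf [P [u [v [pP iP hu hv /(heqP kC sC) Ef]]]]].
  split; first exact: comp_hom.
  exists P, u, (comp C g v); split=> //; first exact: comp_hom.
  by apply/(heqP kC sC); rewrite Ef (compA kC sC).
- move=> X Y Z g f [hg [P [u [v [pP iP hu hv /(heqP kC sC) Eg]]]]] hf.
  split; first exact: comp_hom.
  exists P, (comp C u f), v; split=> //; first exact: comp_hom.
  by apply/(heqP kC sC); rewrite Eg (compA kC sC).
- by move=> W X Y Z h g f hh hg hf; apply/stable_heq/(compA kC sC).
- by move=> X Y f hf; apply/stable_heq/(comp1l kC sC).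
- by move=> X Y f hf; apply/stable_heq/(comp1r kC sC).
Qed.

Lemma equivalent_refl (C : kcat k) : is_kcat C -> equivalent C C.
Proof.
move=> kC; pose I := @Functor k C C id (fun _ _ => id) (fun _ _ _ => id) (fun _ _ _ => id)
  (fun _ _ _ _ _ _ _ => heq_refl kC _) (fun _ => heq_refl kC _)
  (fun _ _ _ _ _ _ _ => heq_refl kC _).
apply: (@ff_es_equivalent _ _ _ kC kC I).
- by split=> // X Y g hg; exists g => //; apply: heq_refl.
- move=> Y; exists Y, (idm C Y); split; first exact: idm_hom.
  by exists (idm C Y); [exact: idm_hom|split; apply/comp_idm_l/idm_hom].
Qed.

Variables C D : kcat k.
Hypotheses (kC : is_kcat C) (kD : is_kcat D) (sC : strict C) (sD : strict D).
Variable F : functor C D.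
Hypotheses (ffF : fully_faithful F) (esF : essentially_surjective F).
Variables (exC : seq_class C) (exD : seq_class D).
Hypothesis exCE : forall X Y Z f g, @exC X Y Z f g <->
  [/\ hom C X Y f, hom C Y Z g & @exD (F X) (F Y) (F Z) (fmor F f) (fmor F g)].
Hypothesis exD_hom : forall X Y Z f g, @exD X Y Z f g -> hom D X Y f /\ hom D Y Z g.
Hypothesis icD : iso_closed exD.
Hypothesis aD : additive D.

(** For faithfulness, the object through which [fmor F f] factors is isomorphic to some [F Q], where
    [Q] is again projective and injective; full faithfulness of [F] then lifts the factorization. *)
Lemma stable_equivalent : equivalent (stable exC) (stable exD).
Proof.
have aC := additive_transport kC kD sC sD ffF esF aD.
have exC_hom X Y Z f g : @exC X Y Z f g -> hom C X Y f /\ hom C Y Z g by move=> /exCE[].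
have kS := stable_is_kcat kC sC exC_hom aC.
have kS' := stable_is_kcat kD sD exD_hom aD.
have sheq X Y (f g : arr D X Y) : f = g -> @heq k (stable exD) X Y f g.
  by move=> ->; apply: (heq_refl kS').
have pE := projectiveE kC kD sC sD ffF esF exCE exD_hom icD.
have iE := injectiveE kC kD sC sD ffF esF exCE exD_hom icD.
have Fnull X Y f : null (stable exC) X Y f -> null (stable exD) (F X) (F Y) (fmor F f).
  move=> [hf [P [g [h [pP iP hg hh /(heqP kC sC) Ef]]]]].
  split; first exact: fmor_hom.
  exists (F P), (fmor F g), (fmor F h); split; [exact/pE|exact/iE|exact:fmor_hom|exact: fmor_hom|].
  by apply/(heqP kD sD); rewrite -(fmorM kD sD) // -Ef.
pose SF := @Functor k (stable exC) (stable exD) (fob F) (fun X Y f => fmor F f)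
  (fun X Y f hf => fmor_hom F hf) Fnull
  (fun X Y a f g hf hg => sheq _ _ _ _ ((heqP kD sD _ _).1 (fmor_linear F a hf hg)))
  (fun X => sheq _ _ _ _ (fmor1 kD sD F X))
  (fun X Y Z g f hg hf => sheq _ _ _ _ (fmorM kD sD F hg hf)).
apply: (@ff_es_equivalent _ _ _ kS kS' SF).
  split=> [X Y g hg|X Y f hf].
    by have [f hf Ef] := full kD sD ffF hg; exists f => //; apply/sheq.
  move=> [_ [Q' [g [h [pQ iQ hg hh /(heqP kD sD) Ef]]]]]; split=> //.
  have [Q [b [c bc]]] := es_pair kD sD esF Q'; have [hb hc cb bcQ] := bc.
  have [g' hg' Eg] := full kD sD ffF (comp_hom kD hc hg).
  have [h' hh' Eh] := full kD sD ffF (comp_hom kD hh hb).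
  exists Q, g', h'; split=> //.
  + exact: (lift_projective kC kD sC sD ffF exCE bc).
  + exact: (lift_injective kC kD sC sD ffF exCE bc).
  + apply/(heqP kC sC)/(faithful kC kD sC sD ffF) => //; first exact: comp_hom.
    rewrite (fmorM kD sD) // Eg Eh -(compA kD sD) ?(compA kD sD (h := b)) ?bcQ ?(comp1l kD sD) //.
    exact: comp_hom.
move=> Y; have [X [b [c [hb hc cb bc]]]] := es_pair kD sD esF Y.
by exists X, b; split=> //; exists c => //; split; apply/sheq.
Qed.

End Stable.

(** * Square roots of a central endomorphism *)

(* [e : V -> V'] plays the part of the shift [e^theta : V -> V[theta]], through
   which every morphism of degree at least [theta] from [V], resp. to [V'],
   factors; [e'] is then the complementary [e^(2 pi - theta)]. *)
Definition shift_pair (k : fieldType) (A : kcat k) (t : forall V : A, arr A V V)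
    (D : forall V W : A, set (arr A V W)) (V V' : A) (e : arr A V V') (e' : arr A V' V) : Prop :=
  [/\ comp A e' e = t V /\ comp A e e' = t V', D _ _ e, D _ _ e',
      (forall W (m : arr A V W), D _ _ m -> exists m', m = comp A m' e)
    & (forall W (m : arr A W V'), D _ _ m -> exists m', m = comp A e m')].

(** [D] is an ideal, to be read as the morphisms divisible by theta. Every condition is self-dual
    or, given naturality of [t], has its mirror image in the record, so the data pass to [op A]. *)
Record shift_data (k : fieldType) (A : kcat k) (t : forall V : A, arr A V V)
    (D : forall V W : A, set (arr A V W)) : Prop := ShiftData {
  sd_kcat : is_kcat A;
  sd_strict : strict A;
  sd_hom : forall X Y (f : arr A X Y), hom A X Y f;
  sd_additive : additive A;
  sd_nat : forall X Y (f : arr A X Y), comp A f (t X) = comp A (t Y) f;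
  sd_reg : forall X Y (f : arr A X Y), comp A (t Y) f = 0 -> f = 0;
  sd_D0 : forall X Y, D X Y 0;
  sd_DD : forall X Y f g, D X Y f -> D X Y g -> D X Y (f + g);
  sd_Dl : forall X Y Z (g : arr A Y Z) (f : arr A X Y), D _ _ f -> D _ _ (comp A g f);
  sd_Dr : forall X Y Z (g : arr A Y Z) (f : arr A X Y), D _ _ g -> D _ _ (comp A g f);
  sd_left : forall V, exists V' e e', @shift_pair k A t D V V' e e';
  sd_right : forall V', exists V e e', @shift_pair k A t D V V' e e' }.

Lemma shift_pair_op (k : fieldType) (A : kcat k) (t : forall V : A, arr A V V)
    (D : forall V W : A, set (arr A V W)) V V' e e' :
  @shift_pair k A t D V V' e e' ->
  @shift_pair k (op A) t (fun V W => D W V) V' V e e'.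
Proof. by case=> -[h1 h2] De De' L R; split. Qed.

Lemma additive_op (k : fieldType) (C : kcat k) : additive C -> additive (op C).
Proof.
move=> aC I Xs; have [Y [inj [prj [hip e1 e0 es]]]] := aC I Xs.
exists Y, prj, inj; split=> //.
- by move=> i; have [h1 h2] := hip i.
- by move=> i j ij; apply: e0; rewrite eq_sym.
Qed.

Lemma shift_data_op (k : fieldType) (A : kcat k) (t : forall V : A, arr A V V)
    (D : forall V W : A, set (arr A V W)) :
  shift_data t D -> @shift_data k (op A) t (fun V W => D W V).
Proof.
move=> sd; split=> /=.
- exact/is_kcat_op/(sd_kcat sd).
- exact/strict_op/(sd_strict sd).
- by move=> X Y f; apply: (sd_hom sd).
- exact/additive_op/(sd_additive sd).
- by move=> X Y f; rewrite (sd_nat sd).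
- by move=> X Y f; rewrite (sd_nat sd); apply: (sd_reg sd).
- by move=> X Y; apply: (sd_D0 sd).
- by move=> X Y; apply: (sd_DD sd).
- by move=> X Y Z g f; apply: (sd_Dr sd).
- by move=> X Y Z g f; apply: (sd_Dl sd).
- move=> V; have [W [e [e' p]]] := sd_right sd V.
  by exists W, e, e'; apply: shift_pair_op.
- move=> V; have [W [e [e' p]]] := sd_left sd V.
  by exists W, e, e'; apply: shift_pair_op.
Qed.

Section SquareRoots.
Context {k : fieldType} {A : kcat k} {t : forall V : A, arr A V V}.
Context {D : forall V W : A, set (arr A V W)}.
Arguments D : clear implicits.
Hypothesis sd : shift_data t D.
Local Notation "g ** f" := (comp A g f) (at level 40, left associativity).
Local Notation "'1' X" := (idm A X) (at level 9, format "'1' X").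
Implicit Types U V W : A.

Let kA := sd_kcat sd.
Let sA := sd_strict sd.
Let hA := sd_hom sd.

Lemma cA U V W V' (h : arr A W V') (g : arr A V W) (f : arr A U V) :
  h ** (g ** f) = h ** g ** f.
Proof. exact: compA. Qed.

Lemma c1l U V (f : arr A U V) : idm A V ** f = f. Proof. exact: comp1l. Qed.
Lemma c1r U V (f : arr A U V) : f ** idm A U = f. Proof. exact: comp1r. Qed.
Lemma c0l U V W (f : arr A U V) : (0 : arr A V W) ** f = 0. Proof. exact: comp0l. Qed.
Lemma c0r U V W (f : arr A V W) : f ** (0 : arr A U V) = 0. Proof. exact: comp0r. Qed.
Lemma cDl U V W (g g' : arr A V W) (f : arr A U V) : (g + g') ** f = g ** f + g' ** f.
Proof. exact: compDl. Qed.
Lemma cDr U V W (g : arr A V W) (f f' : arr A U V) : g ** (f + f') = g ** f + g ** f'.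
Proof. exact: compDr. Qed.
Lemma cNl U V W (g : arr A V W) (f : arr A U V) : (- g) ** f = - (g ** f).
Proof. exact: compNl. Qed.
Lemma cNr U V W (g : arr A V W) (f : arr A U V) : g ** (- f) = - (g ** f).
Proof. exact: compNr. Qed.

Definition cE := (cDl, cDr, cNl, cNr, c0l, c0r, c1l, c1r).

(* Rewrites with [g ** f = x] inside a left-associated composite. *)
Lemma cAe V W V' (g : arr A W V') (f : arr A V W) x : g ** f = x ->
  forall Y (h : arr A V' Y), h ** g ** f = h ** x.
Proof. by move=> <- Y h; rewrite cA. Qed.

Definition splits U V W (f : arr A U V) (g : arr A V W) (r : arr A V U) (s : arr A W V) : Prop :=
  [/\ g ** f = 0, r ** f = idm A U, g ** s = idm A W & f ** r + s ** g = idm A V].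

Lemma splits_rs U V W (f : arr A U V) (g : arr A V W) r s : splits f g r s -> r ** s = 0.
Proof.
case=> gf rf gs e.
have E : r ** s ** g = 0.
  have : r ** (f ** r + s ** g) = r by rewrite e c1r.
  by rewrite cDr !cA rf c1l => /(congr1 (+%R^~ (- r))); rewrite addrAC subrr add0r.
by rewrite -[LHS]c1r -gs !cA E c0l.
Qed.

Lemma splits_mono U V W (f : arr A U V) (g : arr A V W) r s : splits f g r s ->
  forall U' (u v : arr A U' U), f ** u = f ** v -> u = v.
Proof. by case=> _ rf _ _ U' u v E; rewrite -[u]c1l -[v]c1l -rf -!cA E. Qed.

Lemma splits_epi U V W (f : arr A U V) (g : arr A V W) r s : splits f g r s ->
  forall U' (u v : arr A W U'), u ** g = v ** g -> u = v.
Proof. by case=> _ _ gs _ U' u v E; rewrite -[u]c1r -[v]c1r -gs !cA E. Qed.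

Definition square_root (X : {V : A & arr A V V}) : Prop :=
  D _ _ (tagged X) /\ tagged X ** tagged X = t (tag X).

(** Since [g ** d] vanishes on [f], it factors through the cokernel [g]; the induced endomorphism of
    [W] inherits both the square and membership in the ideal. *)
Lemma quotient_root U V W (f : arr A U V) (g : arr A V W) r s (d : arr A V V) (d' : arr A U U) :
  splits f g r s -> square_root (Tagged (fun V => arr A V V) d) -> d ** f = f ** d' ->
  square_root (Tagged (fun V => arr A V V) (g ** d ** s)) /\ g ** d ** s ** g = g ** d.
Proof.
move=> S [/= Dd dd] df; have [gf rf gs e] := S.
have E : g ** d ** s ** g = g ** d.
  rewrite -[RHS]c1r -e cDr !cA -[g ** d ** f]cA df !cA gf !cE.
  by rewrite add0r.
split=> //; split=> /=; first exact/(sd_Dr sd)/(sd_Dl sd).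
by rewrite !cA E -[g ** d ** d]cA dd (sd_nat sd) /= -cA gs c1r.
Qed.

(** The composite [e' ** e] is [t], which is regular. *)
Lemma shift_mono V V' e e' : shift_pair t D (V := V) (V' := V') e e' ->
  forall U (u v : arr A U V), e ** u = e ** v -> u = v.
Proof.
move=> [[e1 e2] _ _ _ _] U u v E; apply/eqP; rewrite -subr_eq0; apply/eqP.
by apply: (sd_reg sd); rewrite -e1 cDr cNr -!cA E subrr.
Qed.

Lemma shift_epi V V' e e' : shift_pair t D (V := V) (V' := V') e e' ->
  forall U (u v : arr A V' U), u ** e = v ** e -> u = v.
Proof.
move=> [[e1 e2] _ _ _ _] U u v E; apply/eqP; rewrite -subr_eq0; apply/eqP.
by apply: (sd_reg sd); rewrite -(sd_nat sd) -e2 cDl cNl !cA E subrr.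
Qed.

(* The defining equation of [hm] is symmetric under passing to [op A] only up
   to the orientation of the equality, whence this abstraction. *)
Variable hm : forall X Y : {V : A & arr A V V}, set (arr A (tag X) (tag Y)).
Hypothesis hmE : forall X Y f, @hm X Y f <-> f ** tagged X = tagged Y ** f.

Definition root_cat : kcat k :=
  @KCat k {X | square_root X} (fun X Y => arr A (tag (sval X)) (tag (sval Y)))
    (fun X Y => @hm (sval X) (sval Y)) (fun X Y => null A (tag (sval X)) (tag (sval Y)))
    (fun X => idm A (tag (sval X))) (fun X Y Z g f => comp A g f).

Variable ex : seq_class root_cat.
Hypothesis exE : forall X Y Z f g,
  @ex X Y Z f g <-> [/\ hom root_cat X Y f, hom root_cat Y Z g & exists r s, splits f g r s].

Local Notation d X := (tagged (sval X)).

Lemma hmP (X Y : root_cat) f : hom root_cat X Y f <-> f ** d X = d Y ** f.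
Proof. exact: hmE. Qed.

Lemma root_strict : strict root_cat.
Proof. by move=> X Y f; apply: sA. Qed.

Lemma root_heq (X Y : root_cat) (f g : arr root_cat X Y) : heq f g <-> f = g.
Proof. exact: (@heqP _ A). Qed.

Lemma root_is_kcat : is_kcat root_cat.
Proof.
split.
- move=> X Y; split; first by apply/hmP; rewrite c0l c0r.
  move=> a u v /hmP hu /hmP hv; apply/hmP.
  by rewrite (compZDl kA sA) // (compZDr kA sA) // hu hv.
- by move=> X Y; apply: (null_subspace kA).
- by move=> X Y f /sA ->; apply/hmP; rewrite c0l c0r.
- by move=> X; apply/hmP; rewrite /= c1l c1r.
- by move=> X Y Z g f /hmP hg /hmP hf; apply/hmP; rewrite /= -cA hf !cA hg.
- by move=> X Y Z a g f f' _ _ _; apply/root_heq/(compZDr kA sA).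
- by move=> X Y Z a g f f' _ _ _; apply/root_heq/(compZDl kA sA).
- by move=> X Y Z g f _ nf; apply: (comp_null_r kA).
- by move=> X Y Z g f nf _; apply: (comp_null_l kA).
- by move=> X Y Z W h g f _ _ _; apply/root_heq/cA.
- by move=> X Y f _; apply/root_heq/c1l.
- by move=> X Y f _; apply/root_heq/c1r.
Qed.

Lemma root_additive : additive root_cat.
Proof.
move=> I Xs; have [Y [inj [prj [_ e1 e0 es]]]] := sd_additive sd (fun i => tag (sval (Xs i))).
have {}e1 i : prj i ** inj i = idm A _ by apply/(heqP kA sA)/e1.
have {}e0 i j : i != j -> prj j ** inj i = 0 by move=> ij; apply/(heqP kA sA)/e0.
move/(heqP kA sA): es => es.
pose dY : arr A Y Y := \sum_i inj i ** d (Xs i) ** prj i.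
have dinj i : dY ** inj i = inj i ** d (Xs i).
  rewrite (comp_suml kA sA) // (bigD1 i) //= -cA e1 c1r big1 ?addr0 // => j ji.
  by rewrite -cA e0 ?c0r // eq_sym.
have prjd i : prj i ** dY = d (Xs i) ** prj i.
  rewrite (comp_sumr kA sA) // (bigD1 i) //= !cA e1 c1l big1 ?addr0 // => j ji.
  by rewrite !cA e0 // !c0l.
have gY : square_root (Tagged (fun V => arr A V V) dY).
  split=> /=.
    rewrite /dY; elim/big_ind: _ => //; [exact: (sd_D0 sd)|exact: (sd_DD sd)|].
    by move=> i _; apply/(sd_Dr sd)/(sd_Dl sd); case: (svalP (Xs i)).
  rewrite {2}/dY (comp_sumr kA sA) // -[RHS]c1r -es (comp_sumr kA sA) //.
  apply: eq_bigr => i _; rewrite !cA dinj -(cA (inj i)).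
  by have [_ ->] := svalP (Xs i); rewrite (sd_nat sd).
exists (exist _ _ gY), inj, prj; split.
- by move=> i; split; apply/hmP => /=; rewrite ?dinj ?prjd.
- by move=> i; apply/root_heq/e1.
- by move=> i j ij; apply/root_heq/e0.
- exact/root_heq.
Qed.

Lemma root_iso_closed : iso_closed ex.
Proof.
move=> X Y Z X' Y' Z' f g f' g' a b c /exE[hf hg [r [s [gf rf gs e]]]] hf' hg'.
move=> [ha [a' ha' [/root_heq/= aa' /root_heq/= a'a]]].
move=> [hb [b' hb' [/root_heq/= bb' /root_heq/= b'b]]].
move=> [hc [c' hc' [/root_heq/= cc' /root_heq/= c'c]]] /root_heq/= Ef /root_heq/= Eg.
apply/exE; split=> //; rewrite /= in gf rf gs e.
have Ef' : f' = b ** f ** a' by rewrite Ef -cA a'a c1r.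
have Eg' : g' = c ** g ** b' by rewrite Eg -cA b'b c1r.
exists (a ** r ** b'), (b ** s ** c'); split.
- by rewrite Ef' Eg' !cA (cAe bb') c1r (cAe gf) !cE.
- by rewrite Ef' !cA (cAe bb') c1r (cAe rf) c1r.
- by rewrite Eg' !cA (cAe bb') c1r (cAe gs) c1r.
- rewrite Ef' Eg' !cA (cAe aa') (cAe cc') !c1r -cDl -!(cA b) -cDr e.
  by rewrite c1r.
Qed.

(** With V = P_[x] and V' = P_[x + theta] this is E(x, x + theta), an indecomposable
    projective-injective of F_c. *)
Definition shift_type (X : {V : A & arr A V V}) : Prop :=
  exists V V' e e' i1 i2 p1 p2,
    [/\ shift_pair t D (V := V) (V' := V') e e',
        @biproduct k A V V' (tag X) i1 i2 p1 p2,
        tagged X ** i1 = i2 ** e & tagged X ** i2 = i1 ** e'].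

(** A morphism from [X] commuting with the roots is determined by its restriction to [V]. There any
    lift in [A] will do, namely [s ** (h ** i1)]; on [V'] the value [m] is then forced by [m ** e],
    and it exists because [d Y] lies in the ideal. *)
Lemma shift_type_projective (X : root_cat) : shift_type (sval X) -> projective ex X.
Proof.
move=> [V [V' [e [e' [i1 [i2 [p1 [p2 [pr bp d1 d2]]]]]]]]] Y Z g h [K [f /exE[_ /hmP hg [r [s S]]]]] /hmP hh.
have [gf rf gs _] := S; have [[ee' e'e] _ _ L _] := pr.
have [m Em] := L _ (d Y ** (s ** (h ** i1))) (sd_Dr sd _ (svalP Y).1).
have [_ b11 b22 b12 b21 bs] := bp.
rewrite /= in hg hh gf rf gs Em.
have gm : g ** m = h ** i2.
  apply: (shift_epi pr); rewrite -cA -Em !cA hg (cAe gs) c1r -hh.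
  by rewrite -[h ** d X ** i1]cA d1 !cA.
exists (s ** h ** i1 ** p1 + m ** p2).
  apply/hmP => /=.
  have E1 : (s ** h ** i1 ** p1 + m ** p2) ** i1 = s ** h ** i1.
    by rewrite cDl (cAe b11) (cAe b21) c1r c0r addr0.
  have E2 : (s ** h ** i1 ** p1 + m ** p2) ** i2 = m.
    by rewrite cDl (cAe b12) (cAe b22) c1r c0r add0r.
  move: (_ + _) E1 E2 => l E1 E2.
  have F1 : l ** d X ** i1 = d Y ** l ** i1.
    by rewrite -cA d1 cA E2 -!cA E1 -[LHS]Em !cA.
  (* Precomposed with [e], both sides become [t] times the restriction of [l] to [V]. *)
  have F2 : l ** d X ** i2 = d Y ** l ** i2.
    apply: (shift_epi pr).
    rewrite -[l ** d X ** i2]cA d2 cA E1 -(cA (d Y)) E2.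
    by rewrite -[RHS]cA -Em !cA (svalP Y).2 -!cA ee' -(sd_nat sd) !cA.
  by rewrite -[LHS]c1r -[RHS]c1r -bs !cDr !cA F1 F2.
apply/root_heq => /=.
by rewrite cDr !cA gs c1l gm -!(cA h) -cDr bs c1r.
Qed.

(** The splitting need not be compatible with the roots: only [f] is, and the cokernel receives its
    root from [quotient_root]. *)
Lemma quotient_ex (X Z : root_cat) (f : arr root_cat X Z) W g r s :
  hom root_cat X Z f -> splits (W := W) f g r s ->
  exists (dW : arr A W W) (gW : square_root (Tagged (fun V => arr A V V) dW)),
    dW ** g = g ** d Z /\ @ex X Z (exist _ _ gW) f g.
Proof.
move=> /[dup] hf /hmP/esym E S.
have gZ : square_root (Tagged (fun V => arr A V V) (d Z)) by exact: (svalP Z).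
have [gW EW] := quotient_root S gZ E.
exists (g ** d Z ** s), gW; split=> //; apply/exE; split=> //.
  exact/hmP/esym.
by exists r, s.
Qed.

Lemma root_kernel X Y Z f g : @ex X Y Z f g -> is_kernel f g.
Proof.
move=> /exE[hf hg [r [s S]]]; have [gf rf gs e] := S.
split=> //; first exact/root_heq.
move=> W u hu /root_heq gu; move/hmP: (hf) => Ef; move/hmP: (hu) => Eu.
rewrite /= in S gf rf gs e gu Ef Eu.
have fr : f ** (r ** u) = u.
  by rewrite -[RHS]c1l -e cDl -!cA gu c0r addr0.
split=> [|v v' _ _ /root_heq/= E /root_heq/= E']; last first.
  by apply/root_heq/(splits_mono S); rewrite E E'.
exists (r ** u); last exact/root_heq.
apply/hmP/(splits_mono S); rewrite cA fr Eu cA Ef -cA fr.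
by [].
Qed.

Lemma root_idm X : adm_mono ex (idm root_cat X).
Proof.
have [Z Z0] := additive_zero kA sA (sd_additive sd).
have gZ : square_root (Tagged (fun V => arr A V V) (0 : arr A Z Z)).
  split=> /=; first exact: (sd_D0 sd).
  by rewrite c0l -[RHS]c1r Z0 c0r.
exists (exist _ _ gZ), 0; apply/exE; split.
- exact/idm_hom/root_is_kcat.
- by apply/hmP => /=; rewrite !cE.
- by exists (idm A _), 0; split; rewrite !cE //= addr0.
Qed.

Lemma root_comp X Y Z (f : arr root_cat X Y) (g : arr root_cat Y Z) :
  adm_mono ex f -> adm_mono ex g -> adm_mono ex (comp root_cat g f).
Proof.
move=> [P [a /exE[hf ha [rf [sa S]]]]] [Q [b /exE[hg hb [rg [sb T]]]]].
have [af rff asa e] := S; have [bg rgg bsb e'] := T.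
have hgf := comp_hom root_is_kcat hg hf.
rewrite /= in S T af rff asa e bg rgg bsb e'.
(* The cokernel of [g ** f] has as underlying object the direct sum of the cokernels of [f] and
   [g]. *)
have [W [i1 [i2 [p1 [p2 bp]]]]] := additive_biproduct kA sA (sd_additive sd) (tag (sval P)) (tag (sval Q)).
have [_ b11 b22 b12 b21 bs] := bp.
have SW : splits (g ** f) (i1 ** a ** rg + i2 ** b) (rf ** rg) (g ** sa ** p1 + sb ** p2).
  split.
  - by rewrite cDl !cA (cAe rgg) (cAe bg) !cE (cAe af) !cE addr0.
  - by rewrite !cA (cAe rgg) c1r rff.
  - rewrite !(cDl, cDr) !cA (cAe rgg) (cAe (splits_rs T)) (cAe bg) (cAe bsb).
    by rewrite !cE (cAe asa) !cE addr0 add0r bs.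
  - rewrite !(cDl, cDr) !cA (cAe b11) (cAe b12) (cAe b21) (cAe b22) !cE addr0 add0r.
    by rewrite addrA -cDl -!(cA g) -cDr e c1r.
have [dW [gW [_ E]]] := quotient_ex (X := X) (Z := Z) hgf SW.
by exists (exist _ _ gW), (i1 ** a ** rg + i2 ** b).
Qed.

(** The pushout is the cokernel of (i, -u) from X to the biproduct of Y and X'. As [i] splits with
    cokernel Z, the underlying object of the pushout is the biproduct of Z and X'. *)
Lemma root_pushout X Y X' (i : arr root_cat X Y) (u : arr root_cat X X') :
  adm_mono ex i -> hom root_cat X X' u ->
  exists Y' (i' : arr root_cat X' Y') (u' : arr root_cat Y Y'),
    is_pushout i u i' u' /\ adm_mono ex i'.
Proof.
move=> [Z [p /exE[/hmP hi /hmP hp [r [s S]]]]] /hmP hu; have [pi ri ps e] := S.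
have rs := splits_rs S.
rewrite /= in hi hp S hu pi ri ps e rs.
have [P [i1 [i2 [p1 [p2 bp]]]]] := additive_biproduct kA sA (sd_additive sd) (tag (sval Y)) (tag (sval X')).
have [_ b11 b22 b12 b21 bs] := bp.
pose dP : arr A P P := i1 ** d Y ** p1 + i2 ** d X' ** p2.
have dP1 : dP ** i1 = i1 ** d Y by rewrite cDl (cAe b11) (cAe b21) !cE addr0.
have dP2 : dP ** i2 = i2 ** d X' by rewrite cDl (cAe b12) (cAe b22) !cE add0r.
have gP : square_root (Tagged (fun V => arr A V V) dP).
  split=> /=.
    apply: (sd_DD sd); apply/(sd_Dr sd)/(sd_Dl sd).
      exact: (svalP Y).1.
    exact: (svalP X').1.
  rewrite {2}/dP cDr !cA dP1 dP2 (cAe (svalP Y).2) (cAe (svalP X').2).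
  by rewrite !(sd_nat sd) -!cA -cDr bs c1r.
have [W [j1 [j2 [q1 [q2 bq]]]]] := additive_biproduct kA sA (sd_additive sd) (tag (sval Z)) (tag (sval X')).
have [_ c11 c22 c12 c21 cs] := bq.
pose f : arr A _ P := i1 ** i - i2 ** u.
(* The correction term [u ** r ** p1] is what makes [g] vanish on [f]. *)
pose g : arr A P W := j1 ** p ** p1 + j2 ** (p2 + u ** r ** p1).
pose sg : arr A W P := i1 ** s ** q1 + i2 ** q2.
have g1 : g ** i1 = j1 ** p + j2 ** u ** r.
  by rewrite /g !(cDl, cDr) !cA (cAe b11) (cAe b21) (cAe b11) !cE add0r.
have g2 : g ** i2 = j2.
  by rewrite /g !(cDl, cDr) !cA (cAe b12) (cAe b22) (cAe b12) !cE add0r addr0.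
have SP : splits f g (r ** p1) sg.
  split.
  - by rewrite /f cDr cNr !cA g1 g2 cDl (cAe pi) (cAe ri) !cE add0r subrr.
  - by rewrite /f cDr cNr !cA (cAe b11) (cAe b12) !cE subr0 ri.
  - rewrite /sg cDr !cA g1 g2 !cDl (cAe ps) (cAe rs) !cE.
    by rewrite addr0 cs.
  - rewrite /f /sg /g !(cDl, cDr, cNl) !cA (cAe c11) (cAe c12) (cAe c21) (cAe c22) !cE.
    rewrite !addr0 add0r [i2 ** p2 + _]addrC (addrCA (i1 ** s ** p ** p1)) (addrA (_ - _)) subrK.
    by rewrite addrA -cDl -!(cA i1) -cDr e c1r bs.
have hf : hom root_cat X (exist _ _ gP) f.
  by apply/hmP; rewrite /= /f cDr cNr !cA dP1 dP2 cDl cNl -!cA hi hu.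
have [dW [gW [EW E]]] := quotient_ex (Z := exist _ _ gP) hf SP.
rewrite /= in EW.
have [gf _ gsg eP] := SP.
have hj2 : hom root_cat X' (exist _ _ gW) j2.
  by apply/hmP; rewrite /= -g2 cA EW -!cA dP2.
have hg1 : hom root_cat Y (exist _ _ gW) (g ** i1).
  by apply/hmP; rewrite /= cA EW -!cA dP1.
exists (exist _ _ gW), j2, (g ** i1); split; last first.
  exists Z, q1; apply/exE; split=> //; last by exists q2, j1; split=> //; rewrite addrC.
  apply/hmP => /=; apply: (splits_epi SP).
  have q1g : q1 ** g = p ** p1 by rewrite /g !(cDr, cA) c11 c12 !cE !addr0.
  rewrite -[q1 ** dW ** g]cA EW cA q1g -[RHS]cA q1g.
  by rewrite /dP !(cDr, cA) (cAe b11) (cAe b12) !cE addr0 hp.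
split=> //.
  apply/root_heq => /=; move/eqP: gf; rewrite /f cDr cNr subr_eq0 => /eqP.
  by rewrite !cA g2.
move=> T a b /hmP ha /hmP hb /root_heq E0; rewrite /= in ha hb E0.
pose v := (b ** p1 + a ** p2) ** sg.
have vg : v ** g = b ** p1 + a ** p2.
  rewrite /v -[RHS]c1r -eP cDr !cA.
  suff -> : (b ** p1 + a ** p2) ** f = 0 by rewrite !c0l add0r.
  by rewrite /f cDr cNr !cDl !cA !(cAe b11, cAe b12, cAe b21, cAe b22) !cE E0 addr0 add0r subrr.
split.
  exists v; last first.
    split; apply/root_heq => /=.
      by rewrite -g2 cA vg cDl (cAe b12) (cAe b22) !cE add0r.
    by rewrite cA vg cDl (cAe b11) (cAe b21) !cE addr0.
  apply/hmP => /=; apply: (splits_epi SP).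
  rewrite -[v ** dW ** g]cA EW cA vg -[RHS]cA vg /dP !(cDl, cDr, cA).
  by rewrite !(cAe b11, cAe b12, cAe b21, cAe b22) !cE addr0 add0r ha hb.
move=> v1 v2 _ _ /root_heq E1 /root_heq E2 /root_heq E3 /root_heq E4.
rewrite /= in E1 E2 E3 E4.
apply/root_heq => /=; apply: (splits_epi SP).
have F1 : v1 ** g ** i1 = v2 ** g ** i1 by rewrite -!cA E2 E4.
have F2 : v1 ** g ** i2 = v2 ** g ** i2 by rewrite -!cA g2 E1 E3.
by rewrite -[LHS]c1r -[RHS]c1r -bs [LHS]cDr [RHS]cDr !cA F1 F2.
Qed.

(** Divisibility writes the root of [X] as [e ** de] with [e] from [V] to [X], and (de, 1) embeds
    [X] into the object of shift type on the biproduct of [V] and [X]. Its compatibility with the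
    roots also needs [de ** d X = e'], which follows by cancelling [e]. *)
Lemma cover_shift_type (X : root_cat) :
  exists (Q : root_cat) f, shift_type (sval Q) /\ @adm_mono k root_cat ex X Q f.
Proof.
have [V [e [e' pr]]] := sd_right sd (tag (sval X)).
have [[ee' e'e] De De' L R] := pr.
have [de Ede] := R _ _ (svalP X).1.
have dd := (svalP X).2.
have ded : de ** d X = e' by apply: (shift_mono pr); rewrite cA -Ede dd e'e.
have [Q [i1 [i2 [p1 [p2 bp]]]]] := additive_biproduct kA sA (sd_additive sd) V (tag (sval X)).
have [_ b11 b22 b12 b21 bs] := bp.
pose dQ : arr A Q Q := i2 ** e ** p1 + i1 ** e' ** p2.
have dQ1 : dQ ** i1 = i2 ** e by rewrite cDl (cAe b11) (cAe b21) !cE addr0.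
have dQ2 : dQ ** i2 = i1 ** e' by rewrite cDl (cAe b12) (cAe b22) !cE add0r.
have gQ : square_root (Tagged (fun V => arr A V V) dQ).
  split=> /=.
    by apply: (sd_DD sd); apply/(sd_Dr sd)/(sd_Dl sd).
  rewrite {2}/dQ cDr !cA dQ1 dQ2 (cAe ee') (cAe e'e).
  by rewrite !(sd_nat sd) -!cA -cDr bs c1r.
pose f : arr A (tag (sval X)) Q := i1 ** de + i2.
have SQ : splits f (p1 - de ** p2) p2 i1.
  split.
  - by rewrite /f !(cDl, cDr, cNl) !cA b11 b12 (cAe b21) (cAe b22) !cE oppr0 add0r addr0 subrr.
  - by rewrite /f cDr !cA b21 b22 !cE add0r.
  - by rewrite cDl cNl b11 (cAe b21) !cE subr0.
  - by rewrite /f !(cDl, cDr, cNr) !cA addrC addrA subrK bs.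
have hf : hom root_cat X (exist _ _ gQ) f.
  apply/hmP => /=; rewrite /f cDl cDr !cA dQ1 dQ2 -(cA i1) ded addrC.
  by rewrite -(cA i2 e) -Ede.
have [dW [gW [_ E]]] := quotient_ex (Z := exist _ _ gQ) hf SQ.
exists (exist _ _ gQ), f; split; last by exists (exist _ _ gW), (p1 - de ** p2).
by exists V, (tag (sval X)), e, e', i1, i2, p1, p2.
Qed.

End SquareRoots.

Section RootFrobenius.
Context {k : fieldType}.

(** Projections become injections, so the relations of the root with [i1] and [i2] must be rewritten
    as relations with [p2] and [p1]; thereby [V] and [V'] exchange roles. *)
Lemma shift_type_op (A : kcat k) (t : forall V : A, arr A V V)
    (D : forall V W : A, set (arr A V W)) (sd : shift_data t D) X :
  shift_type (t := t) (D := D) X <->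
  @shift_type k (op A) t (fun V W => D W V) X.
Proof.
have sdO := shift_data_op sd.
split=> -[V [V' [e [e' [i1 [i2 [p1 [p2 [pr bp d1 d2]]]]]]]]];
  have [[h1 h2 h3 h4] b11 b22 b12 b21 bs] := bp;
  exists V', V, e, e', p2, p1, i2, i1.
- split.
  + exact: shift_pair_op.
  + by split=> //=; rewrite addrC.
  + rewrite /= -[LHS](c1r sd) -bs (cDr sd) !(cA sd) (cAe sd d1) (cAe sd d2) !(cA sd).
    by rewrite b22 b21 (c1l sd) !(c0l sd) addr0.
  + rewrite /= -[LHS](c1r sd) -bs (cDr sd) !(cA sd) (cAe sd d1) (cAe sd d2) !(cA sd).
    by rewrite b11 b12 (c1l sd) !(c0l sd) add0r.
- split.
  + by case: pr => -[? ?] *; split.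
  + by split=> //; rewrite addrC.
  + change (comp (op A) p2 (tagged X) = comp (op A) e p1).
    rewrite -[LHS](c1r sdO) -bs (cDr sdO) !(cA sdO) (cAe sdO d1) (cAe sdO d2) !(cA sdO).
    by rewrite b22 b21 (c1l sdO) !(c0l sdO) addr0.
  + change (comp (op A) p1 (tagged X) = comp (op A) e' p2).
    rewrite -[LHS](c1r sdO) -bs (cDr sdO) !(cA sdO) (cAe sdO d1) (cAe sdO d2) !(cA sdO).
    by rewrite b11 b12 (c1l sdO) !(c0l sdO) add0r.
Qed.

Context {A : kcat k} {t : forall V : A, arr A V V} {D : forall V W : A, set (arr A V W)}.
Arguments D : clear implicits.
Hypothesis sd : shift_data t D.
Variable hm : forall X Y : {V : A & arr A V V}, set (arr A (tag X) (tag Y)).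
Hypothesis hmE : forall X Y f, @hm X Y f <-> comp A f (tagged X) = comp A (tagged Y) f.
Local Notation C := (root_cat (t := t) (D := D) hm).
Variable ex : seq_class C.
Hypothesis exE : forall X Y Z f g,
  @ex X Y Z f g <-> [/\ hom C X Y f, hom C Y Z g & exists r s, splits (A := A) f g r s].

Let hmO (X Y : {V : op A & arr (op A) V V}) : set (arr (op A) (tag X) (tag Y)) := @hm Y X.

Let hmOE X Y f : @hmO X Y f <-> comp (op A) f (tagged X) = comp (op A) (tagged Y) f.
Proof. by split=> [/hmE/= ->|/= E] //; apply/hmE. Qed.

Let exOE (X Y Z : @root_cat _ (op A) t (fun V W => D W V) hmO) f g :
  @opex _ _ ex X Y Z f g <->
  [/\ hom (@root_cat _ (op A) t (fun V W => D W V) hmO) X Y f,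
      hom (@root_cat _ (op A) t (fun V W => D W V) hmO) Y Z g
    & exists r s, splits (A := op A) f g r s].
Proof.
split=> [/exE[hg hf [r [s [gf rf gs e]]]]|[hf hg [r [s [gf rf gs e]]]]].
  by split=> //; exists s, r; split=> //=; rewrite addrC.
by apply/exE; split=> //; exists s, r; split=> //; rewrite addrC.
Qed.

Lemma shift_type_injective (X : C) :
  shift_type (t := t) (D := D) (sval X) -> injective_ob ex X.
Proof.
move=> /(shift_type_op sd) sX; apply/injective_op.
exact: (shift_type_projective (shift_data_op sd) hmOE exOE).
Qed.

(** Stated for arbitrary data because it is applied to [A] and to [op A]. Injectivity enters as a
    premise: in each case it is projectivity on the other side. *)
Let half (A' : kcat k) (t' : forall V : A', arr A' V V) (D' : forall V W : A', set (arr A' V W))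
  (sd' : shift_data t' D') (hm' : forall X Y : {V : A' & arr A' V V}, set (arr A' (tag X) (tag Y)))
  (hmE' : forall X Y f, @hm' X Y f <-> comp A' f (tagged X) = comp A' (tagged Y) f)
  (ex' : seq_class (root_cat (t := t') (D := D') hm')) :
  (forall X Y Z f g, @ex' X Y Z f g <-> [/\ hom (root_cat hm') X Y f, hom (root_cat hm') Y Z g
    & exists r s, splits (A := A') f g r s]) ->
  (forall X : root_cat hm', shift_type (t := t') (D := D') (sval X) -> injective_ob ex' X) ->
  half_frobenius ex'.
Proof.
move=> exE' inj; split.
- exact: root_kernel.
- exact: root_idm.
- exact: root_comp.
- exact: root_pushout.
- move=> X; have [Q [f [sQ af]]] := cover_shift_type sd' hmE' exE' X.
  exists Q, f; split=> //; last exact: inj.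
  exact: (shift_type_projective sd' hmE' exE').
Qed.

Lemma root_half_frobenius : half_frobenius ex.
Proof. by apply: (half sd hmE exE) => X; apply: shift_type_injective. Qed.

Lemma root_half_frobenius_op : half_frobenius (opex ex).
Proof.
apply: (half (shift_data_op sd) hmOE exOE) => X /(shift_type_op sd) sX.
by apply/injective_op; apply: (shift_type_projective sd hmE exE sX).
Qed.

End RootFrobenius.

(** * Power series, arcs and the category of projectives over the circle *)

Section PowerSeries.
Context {k : fieldType}.
Local Notation S := (pseries k).
Implicit Types f g h : S.

Let trunc (N : nat) f : {poly k} := \poly_(i < N) f i.

(** A coefficient of a product sees only truncations of the factors, so the ring laws are those of
    polynomials. *)
Let psmul_trunc N f g n : (n < N)%N -> psmul f g n = (trunc N f * trunc N g)`_n.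
Proof.
move=> nN; rewrite coefM /psmul; apply: eq_bigr => i _; rewrite !coef_poly.
have iN : (i < N)%N by rewrite (leq_trans _ nN) // ltn_ord.
by rewrite iN (leq_ltn_trans (leq_subr _ _) nN).
Qed.

Lemma psmulC f g : psmul f g = psmul g f.
Proof. by apply/funext => n; rewrite !(@psmul_trunc n.+1) // mulrC. Qed.

Lemma psmulA f g h : psmul f (psmul g h) = psmul (psmul f g) h.
Proof.
apply/funext => n.
transitivity ((trunc n.+1 f * (trunc n.+1 g * trunc n.+1 h))`_n).
  rewrite coefM; apply: eq_bigr => i _; rewrite coef_poly ltn_ord.
  by rewrite (@psmul_trunc n.+1) // ltnS leq_subr.
rewrite mulrA coefM; apply: eq_bigr => i _; rewrite (@psmul_trunc n.+1) //.
by rewrite coef_poly ltnS leq_subr.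
Qed.

Lemma psmulZDl a f f' g : psmul (a *: f + f') g = a *: psmul f g + psmul f' g.
Proof.
apply/funext => n; rewrite [RHS]/= /psmul -[RHS]/(a * _ + _) mulr_sumr -big_split /=.
by apply: eq_bigr => i _; rewrite -[(_ + _) _]/(a * _ + _) mulrDl mulrA.
Qed.

Lemma psmulZDr a f f' g : psmul g (a *: f + f') = a *: psmul g f + psmul g f'.
Proof. by rewrite psmulC psmulZDl ![psmul _ g]psmulC. Qed.

Lemma psmul_tpowE f m n : psmul f (tpow k m) n = if (n < m)%N then 0 else f (n - m)%N.
Proof.
have [nm|mn] := ltnP n m.
  rewrite /psmul big1 // => i _; rewrite /tpow ltn_eqF ?mulr0 //.
  exact: leq_ltn_trans (leq_subr _ _) nm.
rewrite psmulC /psmul (bigD1 (inord m)) //= big1 ?addr0.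
  by rewrite inordK ?ltnS // /tpow eqxx mul1r.
move=> i; rewrite -val_eqE /= inordK ?ltnS // => im.
by rewrite /tpow (negPf im) mul0r.
Qed.

Lemma psmul_tpow_inj m f g : psmul f (tpow k m) = psmul g (tpow k m) -> f = g.
Proof.
move=> E; apply/funext => n; have := congr1 (fun u : S => u (n + m)%N) E.
by rewrite !psmul_tpowE ltnNge leq_addl /= addnK.
Qed.

Lemma tpow_neq0 m : tpow k m != 0.
Proof.
by apply/negP => /eqP/(congr1 (fun u : S => u m))/eqP; rewrite /tpow eqxx oner_eq0.
Qed.

(** Each coefficient of the inverse depends on all earlier ones, so the recursion carries the list
    of those already found. *)
Fixpoint psinv_seq (f : S) (n : nat) : seq k :=
  if n is m.+1 then
    let s := psinv_seq f m in
    rcons s ((f 0%N)^-1 * ((m == 0)%:R - \sum_(i < m) s`_i * f (m - i)%N))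
  else [::].

Definition psinv (f : S) : S := fun n => (psinv_seq f n.+1)`_n.

Let size_psinv_seq f n : size (psinv_seq f n) = n.
Proof. by elim: n => //= n IH; rewrite size_rcons IH. Qed.

Let nth_psinv_seq f n i : (i < n)%N -> (psinv_seq f n)`_i = psinv f i.
Proof.
elim: n => // n IH; rewrite ltnS leq_eqVlt => /orP[/eqP -> //|ilt].
by rewrite /= nth_rcons size_psinv_seq ilt IH.
Qed.

Lemma psmulV f : f 0%N != 0 -> psmul f (psinv f) = tpow k 0.
Proof.
move=> f0; rewrite psmulC; apply/funext => n; rewrite /psmul big_ord_recr /= subnn.
rewrite /psinv /= nth_rcons size_psinv_seq ltnn eqxx mulrC mulrA mulfV // mul1r.
rewrite /tpow addrC -[RHS]addr0 -addrA; congr (_ + _).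
apply/eqP; rewrite addrC subr_eq0; apply/eqP; apply: eq_bigr => i _.
by rewrite nth_psinv_seq.
Qed.

End PowerSeries.

(** * Arcs and winding numbers *)

Section CirclePoints.
Context {R : realType}.
Local Notation pi := (@pi R).
Implicit Types a b c d : S1 R.

(** The exponent of t in the composite of the generators of Hom(P_a, P_b) and Hom(P_b, P_c), as a
    multiple of the generator of Hom(P_a, P_c). *)
Definition wind a b c : nat := Num.truncn ((arc a b + arc b c) / (2 * pi)).

Lemma pi2_neq0 : 2 * pi != 0. Proof. by rewrite gt_eqF ?pi2_gt0. Qed.

Lemma arc_ge0 a b : 0 <= arc a b. Proof. by have /andP[] := arc_bounds a b. Qed.
Lemma arc_lt a b : arc a b < 2 * pi. Proof. by have /andP[] := arc_bounds a b. Qed.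

Lemma floor_truncn (x : R) : 0 <= x -> (Num.floor x)%:~R = (Num.truncn x)%:R :> R.
Proof. by move=> x0; rewrite truncn_floor x0 natr_absz ger0_norm // floor_ge0. Qed.

Lemma int_range_eq (x y : R) (z z' : int) : 0 <= x < 2 * pi -> 0 <= y < 2 * pi ->
  x + 2 * pi * z%:~R = y + 2 * pi * z'%:~R -> x = y /\ z = z'.
Proof.
move=> /andP[x0 x1] /andP[y0 y1] E; suff zz : z = z'.
  by split=> //; move: E; rewrite zz => /addIr.
have p0 := pi2_gt0 R.
have H : 2 * pi * (z - z')%:~R = y - x by rewrite intrB mulrBr; lra.
have l1 : `|(z - z')%:~R : R| < 1.
  by rewrite -(ltr_pM2l p0) mulr1 -{1}(gtr0_norm p0) -normrM H ltr_norml; lra.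
apply/eqP; rewrite -subr_eq0 -absz_eq0; move: l1.
by rewrite -intr_norm -[1]/(1%:~R) ltr_int -abszE; case: `|_|%N.
Qed.

Lemma arcD a b c : arc a b + arc b c = arc a c + 2 * pi * (wind a b c)%:R.
Proof.
have p0 := pi2_gt0 R; have s0 : 0 <= (arc a b + arc b c) / (2 * pi).
  by apply: divr_ge0; [apply: addr_ge0; apply: arc_ge0|apply: ltW].
have [z1 Ez1] : exists z : int, arc a b = rep b - rep a + 2 * pi * z%:~R.
  by rewrite /arc; eexists (- _); rewrite intrN mulrN.
have [z2 Ez2] : exists z : int, arc b c = rep c - rep b + 2 * pi * z%:~R.
  by rewrite /arc; eexists (- _); rewrite intrN mulrN.
have [z3 Ez3] : exists z : int, arc a c = rep c - rep a + 2 * pi * z%:~R.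
  by rewrite /arc; eexists (- _); rewrite intrN mulrN.
rewrite /wind -floor_truncn //; set S := arc a b + arc b c.
have B : 0 <= S - 2 * pi * (Num.floor (S / (2 * pi)))%:~R < 2 * pi.
  have := floor_itv (S / (2 * pi)); rewrite intrD ler_pdivlMr // ltr_pdivrMr //.
  by rewrite (mulrDl _ _ (2 * pi)) mul1r [_%:~R * _]mulrC subr_ge0 ltrBlDl => /andP[-> ->].
(* Both [arc a c] and the reduction of [S] lie in [0, 2 pi), and they differ by an integral number
   of turns; this makes them equal. *)
have E : arc a c + 2 * pi * (Num.floor (S / (2 * pi)))%:~R =
  (S - 2 * pi * (Num.floor (S / (2 * pi)))%:~R)
  + 2 * pi * (z3 - z1 - z2 + Num.floor (S / (2 * pi)) + Num.floor (S / (2 * pi)))%:~R.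
  rewrite Ez3 /S Ez1 Ez2; set F := Num.floor _; rewrite !(intrD, intrN); ring.
have [-> _] := int_range_eq (arc_bounds a c) B E.
by rewrite subrK.
Qed.

Lemma arc_pt (x alpha : R) : 0 <= alpha ->
  alpha = arc (pt x) (pt (x + alpha)) + 2 * pi * (Num.truncn (alpha / (2 * pi)))%:R.
Proof.
move=> a0; rewrite arcE [x + alpha - x]addrAC subrr add0r floor_truncn ?subrK //.
by rewrite divr_ge0 // ltW // pi2_gt0.
Qed.

Lemma pt_rep a : pt (rep a) = a. Proof. exact: reprK. Qed.

Lemma pt_arc a b : pt (rep a + arc a b) = b.
Proof.
rewrite -[RHS]pt_rep /arc; set z := Num.floor _.
apply/eqquotP; rewrite /= /circle_rel.
have -> : rep b - (rep a + (rep b - rep a - 2 * pi * z%:~R)) = z%:~R * (2 * pi) by ring.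
by rewrite mulfK ?pi2_neq0.
Qed.

Lemma pt_intr (x : R) (z : int) : pt (x + 2 * pi * z%:~R) = pt x.
Proof.
apply/eqquotP; rewrite /= /circle_rel.
have -> : x - (x + 2 * pi * z%:~R) = - z%:~R * (2 * pi) by ring.
by rewrite mulfK ?pi2_neq0 // rpredN intr_int.
Qed.

Lemma arc_intr (x y : R) : exists z : int, arc (pt x) (pt y) = y - x + 2 * pi * z%:~R.
Proof. by rewrite arcE; eexists (- _); rewrite intrN mulrN. Qed.

End CirclePoints.

(** * Degrees and divisibility in P_{S^1} *)

Section CircleCategory.
Context {R : realType} {k : fieldType}.
Local Notation pi := (@pi R).
Local Notation PS := (PS1 R k).
Implicit Types a b c d : S1 R.
Implicit Types f g h : pseries k.

(** The arc from a to d through b and c is computed with both bracketings; this cocycle identity is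
    what makes composition associative. *)
Lemma wind_assoc a b c d : (wind a b c + wind a c d = wind b c d + wind a b d)%N.
Proof.
have p0 := @pi2_neq0 R; apply/eqP; rewrite -(eqr_nat R); apply/eqP; apply: (mulfI p0).
have := arcD a b c; have := arcD a c d; have := arcD b c d; have := arcD a b d.
by move: (2 * pi) => q; rewrite !natrD !mulrDr; lra.
Qed.

Lemma P_compA a b c d h g f :
  P_comp a c d h (P_comp a b c g f) = P_comp a b d (P_comp b c d h g) f.
Proof.
rewrite /P_comp /epow -!/(wind _ _ _).
transitivity (psmul (psmul (psmul h g) f) (tpow k (wind b c d + wind a b d))).
  by rewrite -wind_assoc -psmul_tpow !psmulA.
by rewrite -psmul_tpow !psmulA -(psmulA _ f) [psmul f _]psmulC !psmulA.
Qed.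

Lemma P_compZDl a b c (x : k) g g' f :
  P_comp a b c (x *: g + g') f = x *: P_comp a b c g f + P_comp a b c g' f.
Proof. by rewrite /P_comp !psmulZDl. Qed.

Lemma P_compZDr a b c (x : k) g f f' :
  P_comp a b c g (x *: f + f') = x *: P_comp a b c g f + P_comp a b c g f'.
Proof. by rewrite /P_comp psmulZDr psmulZDl. Qed.

Lemma P_compDl a b c g g' f : P_comp a b c (g + g') f = P_comp a b c g f + P_comp a b c g' f.
Proof. by have := P_compZDl a b c 1 g g' f; rewrite !scale1r. Qed.

Lemma P_compDr a b c g f f' : P_comp a b c g (f + f') = P_comp a b c g f + P_comp a b c g f'.
Proof. by have := P_compZDr a b c 1 g f f'; rewrite !scale1r. Qed.

Lemma P_comp_suml a b c (I : Type) (s : seq I) (P : pred I) G f :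
  P_comp a b c (\sum_(i <- s | P i) G i) f = \sum_(i <- s | P i) P_comp a b c (G i) f.
Proof. by apply: (big_morph (fun g => P_comp a b c g f)) => [u v|]; rewrite ?P_compDl ?P_comp0l. Qed.

Lemma P_comp_sumr a b c (I : Type) (s : seq I) (P : pred I) g F :
  P_comp a b c g (\sum_(i <- s | P i) F i) = \sum_(i <- s | P i) P_comp a b c g (F i).
Proof. by apply: (big_morph (P_comp a b c g)) => [u v|]; rewrite ?P_compDr ?P_comp0. Qed.

Lemma P_comp_aab a b g f : P_comp a a b g f = psmul g f.
Proof. by rewrite /P_comp arcxx add0r epow_small ?arc_bounds // psmul1. Qed.

Lemma P_comp_abb a b g f : P_comp a b b g f = psmul g f.
Proof. by rewrite /P_comp arcxx addr0 epow_small ?arc_bounds // psmul1. Qed.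

Lemma P_comp_tpow a b c g n m :
  P_comp a b c g (tpow k n) m = if (m < n + wind a b c)%N then 0 else g (m - (n + wind a b c))%N.
Proof.
by rewrite /P_comp /epow -/(wind _ _ _) -psmulA psmul_tpow psmul_tpowE.
Qed.

Lemma P_compC_tpow a b c f n m :
  P_comp a b c (tpow k n) f m = if (m < n + wind a b c)%N then 0 else f (m - (n + wind a b c))%N.
Proof. by rewrite -P_comp_tpow /P_comp (psmulC (tpow k n)). Qed.

(** The exponent alpha for which t^n times the generator of Hom(P_a, P_b) is e^alpha. *)
Definition degree a b (n : nat) : R := arc a b + 2 * pi * n%:R.

Definition P_D (theta : R) a b : set (pseries k) :=
  [set f | forall n, degree a b n < theta -> f n = 0].

(** Degrees add under composition by [arcD], so in a term of degree below alpha + beta one factor is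
    below its own bound. *)
Lemma P_DM alpha beta a b c g f : P_D alpha a b f -> P_D beta b c g ->
  P_D (alpha + beta) a c (P_comp a b c g f).
Proof.
move=> Df Dg n; rewrite /degree => dn.
rewrite /P_comp /epow -/(wind a b c) psmul_tpowE; case: ltnP => // wn.
rewrite /psmul big1 // => i _; have ile : (i <= n - wind a b c)%N by rewrite -ltnS.
have [lf|lf] := ltP (degree a b (n - wind a b c - i)) alpha.
  by rewrite Df ?mulr0.
rewrite Dg ?mul0r //; rewrite /degree in lf *.
have nE : n%:R = (n - wind a b c - i)%:R + i%:R + (wind a b c)%:R :> R.
  by rewrite -!natrD subnK // subnK.
have := arcD a b c; move: dn lf; rewrite {}nE; move: (2 * pi) => q.
by move: (_%:R) (i%:R) (_%:R) => u v w; rewrite !mulrDr; lra.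
Qed.

Lemma P_D0 a b f : P_D 0 a b f.
Proof.
move=> n; rewrite /degree ltNge addr_ge0 ?arc_ge0 // mulr_ge0 // ?ler0n //.
exact/ltW/pi2_gt0.
Qed.

Lemma P_D_add theta a b f g : P_D theta a b f -> P_D theta a b g -> P_D theta a b (f + g).
Proof. by move=> Df Dg n dn; rewrite -[LHS]/(f n + g n) Df // Dg // addr0. Qed.

Lemma P_D_sum theta a b (I : Type) (s : seq I) (P : pred I) (F : I -> pseries k) :
  (forall i, P i -> P_D theta a b (F i)) -> P_D theta a b (\sum_(i <- s | P i) F i).
Proof.
by move=> DF; elim/big_ind: _ => //; apply: P_D_add.
Qed.

Lemma P_D_epow (x alpha : R) : 0 <= alpha -> P_D alpha (pt x) (pt (x + alpha)) (epow k alpha).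
Proof.
move=> a0 n; rewrite /degree => lt; rewrite /epow /tpow ltn_eqF //.
rewrite -(ltr_nat R) -(ltr_pM2l (pi2_gt0 R)) -(ltrD2l (arc (pt x) (pt (x + alpha)))).
by rewrite -arc_pt.
Qed.

(** Division by e^alpha is division by a power t^N. The coefficients below N vanish because their
    degree is less than alpha, the arc from [c] to [b] being shorter than a full turn. *)
Lemma P_D_divr (x alpha : R) b f : 0 <= alpha -> P_D alpha (pt x) b f ->
  exists f', f = P_comp (pt x) (pt (x + alpha)) b f' (epow k alpha).
Proof.
move=> a0 Df; set c := pt (x + alpha).
pose N := (Num.truncn (alpha / (2 * pi)) + wind (pt x) c b)%N.
exists (fun n => f (n + N)%N); apply/funext => n; rewrite P_comp_tpow -/N.
case: ltnP => [nN|Nn]; last by rewrite subnK.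
apply: Df; have := arcD (pt x) c b; have := arc_pt x a0; have := arc_lt c b.
rewrite -/c /degree => h1 h2 h3.
have : (n%:R : R) + 1 <= N%:R by rewrite natr1 ler_nat.
rewrite -(ler_pM2l (pi2_gt0 R)) /N; move: (2 * pi) (Num.truncn _) h1 h2 h3 => q m.
by rewrite !natrD !mulrDr mulr1; lra.
Qed.

Lemma P_D_divl (x alpha : R) b f : 0 <= alpha -> P_D alpha b (pt (x + alpha)) f ->
  exists f', f = P_comp b (pt x) (pt (x + alpha)) (epow k alpha) f'.
Proof.
move=> a0 Df; set c := pt (x + alpha).
pose N := (Num.truncn (alpha / (2 * pi)) + wind b (pt x) c)%N.
exists (fun n => f (n + N)%N); apply/funext => n; rewrite P_compC_tpow -/N.
case: ltnP => [nN|Nn]; last by rewrite subnK.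
apply: Df; have := arcD b (pt x) c; have := arc_pt x a0; have := arc_lt b (pt x).
rewrite -/c /degree => h1 h2 h3.
have : (n%:R : R) + 1 <= N%:R by rewrite natr1 ler_nat.
rewrite -(ler_pM2l (pi2_gt0 R)) /N; move: (2 * pi) (Num.truncn _) h1 h2 h3 => q m.
by rewrite !natrD !mulrDr mulr1; lra.
Qed.

Lemma PS1_compE (X Y Z : PS) (g : arr PS Y Z) (f : arr PS X Y) i j :
  comp PS g f i j = \sum_(l : idx Y) P_comp (X i) (Y l) (Z j) (g l j) (f i l).
Proof. by []. Qed.

Lemma PS1_strict : strict PS. Proof. by []. Qed.

Lemma PS1_heq (X Y : PS) (f g : arr PS X Y) : heq f g <-> f = g.
Proof. by rewrite /heq /=; split=> [/eqP|->]; rewrite ?subr_eq0 ?subrr // => /eqP. Qed.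

Lemma PS1_ext (X Y : PS) (f g : arr PS X Y) : (forall i j, f i j = g i j) -> f = g.
Proof. by move=> E; apply/funext => i; apply/funext => j. Qed.

Lemma PS1_id_r (X Y : PS) (f : arr PS X Y) : comp PS f (idm PS X) = f.
Proof.
apply: PS1_ext => i j; rewrite PS1_compE (bigD1 i) //= big1 ?addr0.
  by rewrite eqxx P_comp1.
by move=> l; rewrite eq_sym => /negPf ->; rewrite P_comp0.
Qed.

Lemma PS1_id_l (X Y : PS) (f : arr PS X Y) : comp PS (idm PS Y) f = f.
Proof.
apply: PS1_ext => i j; rewrite PS1_compE (bigD1 j) //= big1 ?addr0.
  by rewrite eqxx P_comp1l.
by move=> l /negPf ->; rewrite P_comp0l.
Qed.

Lemma PS1_compA (W X Y Z : PS) (h : arr PS Y Z) (g : arr PS X Y) (f : arr PS W X) :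
  comp PS h (comp PS g f) = comp PS (comp PS h g) f.
Proof.
apply: PS1_ext => i j; rewrite !PS1_compE.
under eq_bigr => l _ do rewrite P_comp_sumr.
under [RHS]eq_bigr => l _ do rewrite P_comp_suml.
rewrite exchange_big; apply: eq_bigr => l _; apply: eq_bigr => m _.
by rewrite P_compA.
Qed.

Lemma PS1_compZDl (X Y Z : PS) x (g g' : arr PS Y Z) (f : arr PS X Y) :
  comp PS (x *: g + g') f = x *: comp PS g f + comp PS g' f.
Proof.
apply: PS1_ext => i j; rewrite -[RHS]/(x *: comp PS g f i j + comp PS g' f i j).
rewrite !PS1_compE scaler_sumr -big_split; apply: eq_bigr => l _.
exact: P_compZDl.
Qed.

Lemma PS1_compZDr (X Y Z : PS) x (g : arr PS Y Z) (f f' : arr PS X Y) :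
  comp PS g (x *: f + f') = x *: comp PS g f + comp PS g f'.
Proof.
apply: PS1_ext => i j; rewrite -[RHS]/(x *: comp PS g f i j + comp PS g f' i j).
rewrite !PS1_compE scaler_sumr -big_split; apply: eq_bigr => l _.
exact: P_compZDr.
Qed.

Lemma PS1_is_kcat : is_kcat PS.
Proof.
split=> //.
- move=> X Y; split=> //= a u v -> ->; by rewrite scaler0 addr0.
- by move=> *; apply/PS1_heq/PS1_compZDr.
- by move=> *; apply/PS1_heq/PS1_compZDl.
- move=> X Y Z g f _ /PS1_strict ->; apply: (@PS1_ext _ _ _ 0) => i j; rewrite PS1_compE big1 // => l _.
  exact: P_comp0.
- move=> X Y Z g f /PS1_strict -> _; apply: (@PS1_ext _ _ _ 0) => i j; rewrite PS1_compE big1 // => l _.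
  exact: P_comp0l.
- by move=> *; apply/PS1_heq/PS1_compA.
- by move=> *; apply/PS1_heq/PS1_id_l.
- by move=> *; apply/PS1_heq/PS1_id_r.
Qed.

Lemma PS1_additive : additive PS.
Proof.
move=> I Xs; pose Y : PS := @Fam (S1 R) {i : I & idx (Xs i)} (fun p => Xs (tag p) (tagged p)).
pose T i (u : idx (Xs i)) : idx Y := Tagged (fun i => idx (Xs i)) u.
pose inj i : arr PS (Xs i) Y := fun u p => if p == T i u then tpow k 0 else 0.
pose prj i : arr PS Y (Xs i) := fun p u => if p == T i u then tpow k 0 else 0.
have inj_r i Z (g : arr PS Y Z) u j : comp PS g (inj i) u j = g (T i u) j.
  rewrite PS1_compE (bigD1 (T i u)) //= big1 ?addr0; first by rewrite /inj eqxx P_comp1.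
  by move=> l /negPf ne; rewrite /inj ne P_comp0.
have prj_l i Z (f : arr PS Z Y) u j : comp PS (prj i) f j u = f j (T i u).
  rewrite PS1_compE (bigD1 (T i u)) //= big1 ?addr0; first by rewrite /prj eqxx P_comp1l.
  by move=> l /negPf ne; rewrite /prj ne P_comp0l.
exists Y, inj, prj; split=> //.
- move=> i; apply/PS1_heq/PS1_ext => a b; rewrite prj_l /inj /=.
  by rewrite eq_Tagged /= eq_sym.
- move=> i j ij; apply/PS1_heq/PS1_ext => a b; rewrite prj_l /inj.
  case: eqP => // /(congr1 tag) /= E; by rewrite E eqxx in ij.
- apply/PS1_heq/PS1_ext => p q.
  have sumE (F : I -> arr PS Y Y) : (\sum_i F i) p q = \sum_i F i p q by rewrite !fct_sumE.
  rewrite sumE {sumE}; case: p => i u; rewrite (bigD1 i) // big1 ?addr0.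
    rewrite PS1_compE (bigD1 u) //= big1 ?addr0 => [|v vu].
      rewrite /prj eqxx P_comp1 /inj eq_sym.
      by [].
    by rewrite /prj eq_Tagged /= eq_sym (negPf vu) P_comp0.
  move=> j ji; rewrite PS1_compE big1 // => v _; rewrite /prj.
  case: eqP => [/(congr1 tag)/= E|]; last by rewrite P_comp0.
  by rewrite E eqxx in ji.
Qed.

Definition dg (I : finType) (a b : I -> S1 R) (u : I -> pseries k) :
  arr PS (@Fam (S1 R) I a) (@Fam (S1 R) I b) := fun i j => if i == j then u i else 0.
Arguments dg [I] a b u _ _.

Lemma comp_dg_r (I : finType) (a b : I -> S1 R) u (Z : PS) (g : arr PS (@Fam (S1 R) I b) Z) i j :
  comp PS g (dg a b u) i j = P_comp (a i) (b i) (Z j) (g i j) (u i).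
Proof.
rewrite PS1_compE (bigD1 i) //= big1 ?addr0; first by rewrite /dg eqxx.
by move=> l; rewrite /dg eq_sym => /negPf ->; rewrite P_comp0.
Qed.

Lemma comp_dg_l (I : finType) (a b : I -> S1 R) u (X : PS) (f : arr PS X (@Fam (S1 R) I a)) i j :
  comp PS (dg a b u) f i j = P_comp (X i) (a j) (b j) (u j) (f i j).
Proof.
rewrite PS1_compE (bigD1 j) //= big1 ?addr0; first by rewrite /dg eqxx.
by move=> l; rewrite /dg => /negPf ->; rewrite P_comp0l.
Qed.

Definition PS1_D (theta : R) (V W : PS) : set (arr PS V W) :=
  [set f | forall i j, P_D theta (V i) (W j) (f i j)].

Lemma PS1_DM alpha beta (U V W : PS) (f : arr PS U V) (g : arr PS V W) :
  PS1_D alpha f -> PS1_D beta g -> PS1_D (alpha + beta) (comp PS g f).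
Proof. by move=> Df Dg i j; apply: P_D_sum => l _; apply: P_DM. Qed.

Lemma PS1_t_r (V W : PS) (f : arr PS V W) i j :
  comp PS f (@t_endo R k V) i j = psmul (f i j) (tpow k 1).
Proof.
rewrite PS1_compE (bigD1 i) //= big1 ?addr0; first by rewrite /t_endo eqxx P_comp_aab.
by move=> l; rewrite /t_endo eq_sym => /negPf ->; rewrite P_comp0.
Qed.

Lemma PS1_t_l (V W : PS) (f : arr PS V W) i j :
  comp PS (@t_endo R k W) f i j = psmul (f i j) (tpow k 1).
Proof.
rewrite PS1_compE (bigD1 j) //= big1 ?addr0.
  by rewrite /t_endo eqxx P_comp_abb psmulC.
by move=> l; rewrite /t_endo => /negPf ->; rewrite P_comp0l.
Qed.

(** From theta <= pi one gets theta <= 2 pi - theta, so that the complementary morphism is divisible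
    by theta as well. *)
Lemma PS1_shift_pair (theta : R) (I : finType) (x : I -> R) : 0 <= theta -> theta <= pi ->
  @shift_pair k PS (@t_endo R k) (@PS1_D theta)
    (@Fam (S1 R) I (fun i => pt (x i))) (@Fam (S1 R) I (fun i => pt (x i + theta)))
    (dg _ _ (fun=> epow k theta)) (dg _ _ (fun=> epow k (2 * pi - theta))).
Proof.
move=> th0 thpi; have p0 := pi2_gt0 R.
have c0 : 0 <= 2 * pi - theta by lra.
have ptE (y : R) : pt y = pt (y + theta + (2 * pi - theta)).
  by rewrite -[LHS]pt_2pi; congr pt; ring.
have Dmon (a b : S1 R) f al be : be <= al -> P_D al a b f -> P_D be a b f.
  by move=> ab Df n dn; apply: Df; apply: lt_le_trans dn ab.
split.
- split; apply: PS1_ext => i j; rewrite comp_dg_l /t_endo /dg; case: eqP => [->|_];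
    rewrite ?P_comp0 //.
    rewrite (@P_comp_epow _ _ (x j) (x j + theta)) //.
      by rewrite -(epow_2pi R); congr epow; ring.
  rewrite (@P_comp_epow _ _ (x j + theta) (x j)) //.
    by rewrite -(epow_2pi R); congr epow; ring.
  by rewrite -[LHS]pt_2pi; congr pt; ring.
- move=> i j; rewrite /dg; case: eqP => [->|_] //; exact: P_D_epow.
- move=> i j; rewrite /dg; case: eqP => [->|_] //=.
  by apply: (@Dmon _ _ _ (2 * pi - theta)); [lra|rewrite (ptE (x j)); apply: P_D_epow].
- move=> W m Dm; have F i j := P_D_divr th0 (Dm i j).
  exists (fun i j => sval (cid (F i j))); apply: PS1_ext => i j.
  by rewrite comp_dg_r; apply: (svalP (cid (F i j))).
- move=> W m Dm; have F i j := P_D_divl th0 (Dm i j).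
  exists (fun i j => sval (cid (F i j))); apply: PS1_ext => i j.
  by rewrite comp_dg_l; apply: (svalP (cid (F i j))).
Qed.

Lemma PS1_shift_data (theta : R) : 0 <= theta -> theta <= pi ->
  @shift_data k PS (@t_endo R k) (@PS1_D theta).
Proof.
move=> th0 thpi; split=> //.
- exact: PS1_is_kcat.
- exact: PS1_additive.
- by move=> X Y f; apply: PS1_ext => i j; rewrite PS1_t_r PS1_t_l.
- move=> X Y f E; apply: PS1_ext => i j; apply: (@psmul_tpow_inj _ 1).
  by rewrite -PS1_t_l E psmul0l.
- by move=> X Y f g Df Dg i j; apply: P_D_add.
- move=> X Y Z g f Df; rewrite -[theta]addr0; apply: PS1_DM => // i j.
  exact: P_D0.
- move=> X Y Z g f Dg; rewrite -[theta]add0r; apply: PS1_DM => // i j.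
  exact: P_D0.
- move=> [I a]; have := PS1_shift_pair (fun i => rep (a i)) th0 thpi.
  rewrite (_ : (fun i => pt (rep (a i))) = a) => [P|].
    by eexists; eexists; eexists; exact: P.
  by apply/funext => i; exact: pt_rep.
- move=> [I a]; have := PS1_shift_pair (fun i => rep (a i) - theta) th0 thpi.
  rewrite (_ : (fun i => pt (_ - theta + theta)) = a) => [P|].
    by eexists; eexists; eexists; exact: P.
  by apply/funext => i; rewrite subrK; exact: pt_rep.
Qed.

End CircleCategory.
Arguments dg {R k I} a b u _ _.

(** * Decomposition of matrix factorizations *)

Section Decomposition.
Context {R : realType} {k : fieldType}.
Local Notation pi := (@pi R).
Local Notation PS := (PS1 R k).
Local Notation "g ** f" := (comp PS g f) (at level 40, left associativity).

Lemma P_D_le (alpha beta : R) a b (f : pseries k) :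
  beta <= alpha -> P_D alpha a b f -> P_D beta a b f.
Proof. by move=> ab Df n dn; apply: Df; apply: lt_le_trans dn ab. Qed.

Definition scalar (sg : pseries k) (V : PS) : arr PS V V :=
  fun i j => if i == j then sg else 0.
Arguments scalar sg V : clear implicits.

Lemma scalar_r sg (V W : PS) (f : arr PS V W) i j : (f ** scalar sg V) i j = psmul (f i j) sg.
Proof.
rewrite PS1_compE (bigD1 i) //= big1 ?addr0; first by rewrite /scalar eqxx P_comp_aab.
by move=> l; rewrite /scalar eq_sym => /negPf ->; rewrite P_comp0.
Qed.

Lemma scalar_l sg (V W : PS) (f : arr PS V W) i j : (scalar sg W ** f) i j = psmul (f i j) sg.
Proof.
rewrite PS1_compE (bigD1 j) //= big1 ?addr0.
  by rewrite /scalar eqxx P_comp_abb psmulC.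
by move=> l; rewrite /scalar => /negPf ->; rewrite P_comp0l.
Qed.

Lemma scalar_nat sg (V W : PS) (f : arr PS V W) : f ** scalar sg V = scalar sg W ** f.
Proof. by apply: PS1_ext => i j; rewrite scalar_r scalar_l. Qed.

Lemma scalarV (sg : pseries k) (V : PS) : sg 0%N != 0 ->
  scalar (psinv sg) V ** scalar sg V = idm PS V.
Proof.
move=> s0; apply: PS1_ext => i j; rewrite scalar_l /scalar /=.
by case: eqP => // _; [rewrite psmulV|rewrite psmul0l].
Qed.

Section SumsOfE.
Variables (I : finType) (x y : I -> R) (s : I -> bool).

Definition slot (i : I) (b : bool) : R := if b then y i else x i.

(** The choice [s] marks one summand in each E(x i, y i): [c = false] includes the sum of the marked
    summands, [c = true] the sum of the others. With respect to this decomposition d is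
    off-diagonal. *)
Definition slot_in (c : bool) : arr PS (@Fam (S1 R) I (fun i => pt (slot i (c (+) s i)))) (EV k x y) :=
  fun i p => if (i == p.1) && (p.2 == c (+) s i) then tpow k 0 else 0.

Definition slot_out (c : bool) : arr PS (EV k x y) (@Fam (S1 R) I (fun i => pt (slot i (c (+) s i)))) :=
  fun p i => if (i == p.1) && (p.2 == c (+) s i) then tpow k 0 else 0.

Arguments slot_in : clear implicits.
Arguments slot_out : clear implicits.

Lemma slot_in_r c (W : PS) (g : arr PS (EV k x y) W) i j :
  (g ** slot_in c) i j = g (i, c (+) s i) j.
Proof.
rewrite PS1_compE (bigD1 (i, c (+) s i)) //= big1 ?addr0.
  by rewrite /slot_in /= !eqxx P_comp1.
move=> [l b]; rewrite xpair_eqE /slot_in /= [i == l]eq_sym; case: eqP => [->|_] /=.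
  by move=> /negPf ->; rewrite P_comp0.
by rewrite P_comp0.
Qed.

Lemma slot_out_l c (V : PS) (f : arr PS V (EV k x y)) i j :
  (slot_out c ** f) i j = f i (j, c (+) s j).
Proof.
rewrite PS1_compE (bigD1 (j, c (+) s j)) //= big1 ?addr0.
  by rewrite /slot_out /= !eqxx P_comp1l.
move=> [l b]; rewrite xpair_eqE /slot_out /= [j == l]eq_sym; case: eqP => [->|_] /=.
  by move=> /negPf ->; rewrite P_comp0l.
by rewrite P_comp0l.
Qed.

Lemma slot_biproduct :
  biproduct (C := PS) (slot_in false) (slot_in true) (slot_out false) (slot_out true).
Proof.
split=> //; try by (apply: PS1_ext => i j; rewrite slot_out_l /slot_in /=;
  case: eqP => // ->; rewrite ?eqxx; case: (s j)).
apply: PS1_ext => -[i b0] [j c0].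
rewrite -[LHS]/((slot_in false ** slot_out false) (i, b0) (j, c0) +
                (slot_in true ** slot_out true) (i, b0) (j, c0)).
have E e : (slot_in e ** slot_out e) (i, b0) (j, c0) =
    if (i == j) && (b0 == e (+) s i) && (c0 == e (+) s i) then tpow k 0 else 0.
  rewrite PS1_compE (bigD1 i) //= big1 ?addr0.
    rewrite /slot_out /= eqxx /=; case: eqP => [->|_]; last by rewrite P_comp0 andbF.
    by rewrite P_comp1 /slot_in /= andbT.
  by move=> l; rewrite /slot_out /= => /negPf ->; rewrite P_comp0.
rewrite !E /= xpair_eqE; case: eqP => [_|] /=; last by rewrite addr0.
by move: b0 c0 (s i) {E} => [] [] []; rewrite /= ?addr0 ?add0r.
Qed.

Lemma Ed_slot c : @Ed R k _ x y ** slot_in c =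
  slot_in (~~ c) ** dg _ _ (fun i => epow k (slot i (~~ (c (+) s i))
    + (if c (+) s i then 2 * pi else 0) - slot i (c (+) s i))).
Proof.
apply: PS1_ext => i [j b]; rewrite slot_in_r comp_dg_r /Ed /slot_in /=.
case: eqP => [<-|_] /=; last by rewrite P_comp0l.
have -> : ~~ c (+) s i = ~~ (c (+) s i) by rewrite addNb.
rewrite /slot; case: (c (+) s i) b => [] [] /=; rewrite ?P_comp0l ?addr0 //.
  by rewrite P_comp1l.
by rewrite P_comp1l.
Qed.

End SumsOfE.

Lemma Ed_D theta (I : finType) (x y : I -> R) : 0 <= theta ->
  (forall i, x i + theta <= y i <= x i + 2 * pi - theta) -> PS1_D theta (@Ed R k _ x y).
Proof.
move=> th0 H [i b] [j c]; rewrite /Ed /=; case: eqP => // <-.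
have /andP[h1 h2] := H i; case: b c => [] [] //=.
  apply: (@P_D_le (x i + 2 * pi - y i)); first lra.
  rewrite -[pt (x i)]pt_2pi.
  rewrite [X in P_D _ _ (pt X)](_ : _ = y i + (x i + 2 * pi - y i)); last by ring.
  by apply: P_D_epow; lra.
apply: (@P_D_le (y i - x i)); first lra.
rewrite [X in P_D _ _ (pt X)](_ : _ = x i + (y i - x i)); last by ring.
by apply: P_D_epow; lra.
Qed.

Lemma P_D_tpow1 theta a : P_D theta a a (tpow k 1) -> theta <= 2 * pi.
Proof.
move=> D1; rewrite leNgt; apply/negP => lt.
have := D1 1%N; rewrite /degree arcxx add0r mulr1 => /(_ lt)/eqP.
by rewrite /tpow /= oner_eq0.
Qed.

Lemma pseries_order (f : pseries k) : f != 0 ->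
  exists n, f n != 0 /\ forall m, (m < n)%N -> f m = 0.
Proof.
move=> f0; have ex : exists n, f n != 0.
  apply: contrapT => H; case/eqP: f0; apply/funext => n.
  by apply/eqP; apply: contrapT => /negP fn; apply: H; exists n.
exists (ex_minn ex); case: ex_minnP => n fn mn; split=> // m mlt.
by apply/eqP; apply: contraTT mlt => /mn; rewrite -leqNgt.
Qed.

(** In degree alpha + beta a coefficient of [f] of degree above alpha meets one of [g] of degree
    below beta, so only the coefficients of degree exactly alpha could contribute. *)
Lemma P_comp_coef0 (alpha beta : R) a b c (g f : pseries k) N :
  P_D alpha a b f -> P_D beta b c g -> degree a c N = alpha + beta ->
  (forall m, degree a b m = alpha -> f m = 0) -> P_comp a b c g f N = 0.
Proof.
move=> Df Dg dN f0; rewrite /P_comp /epow -/(wind a b c) psmul_tpowE; case: ltnP => // wN.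
rewrite /psmul big1 // => i _; have ile : (i <= N - wind a b c)%N by rewrite -ltnS.
have [lf|lf|Ef] := ltgtP (degree a b (N - wind a b c - i)) alpha.
- by rewrite Df ?mulr0.
- rewrite Dg ?mul0r //; rewrite /degree in lf dN *.
  have nE : N%:R = (N - wind a b c - i)%:R + i%:R + (wind a b c)%:R :> R.
    by rewrite -!natrD subnK // subnK.
  have := arcD a b c; move: dN lf; rewrite {}nE; move: (2 * pi) => q.
  by move: (_%:R) (i%:R) (_%:R) => u v w; rewrite !mulrDr; lra.
- by rewrite f0 ?mulr0.
Qed.

Lemma psmul_sqr_lowest (f : pseries k) n : (forall m, (m < n)%N -> f m = 0) ->
  psmul f f (n + n)%N = f n * f n.
Proof.
move=> f0; have nn : (n < (n + n).+1)%N by rewrite ltnS leq_addr.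
rewrite /psmul (bigD1 (Ordinal nn)) //= addnK big1 ?addr0 // => i.
rewrite -val_eqE /= neq_ltn => /orP[/f0 ->|ni]; first by rewrite mul0r.
by rewrite [f (_ - _)%N]f0 ?mulr0 //; have := ltn_ord i; lia.
Qed.

Lemma minimal_entry (V : PS) (d : arr PS V V) (i0 : idx V) :
  d ** d = @t_endo R k V ->
  exists alpha, [/\ alpha <= pi, PS1_D alpha d
    & exists i j n, [/\ i != j, degree (V i) (V j) n = alpha & d i j n != 0]].
Proof.
move=> dd.
have /choice[o Ho] : forall p : idx V * idx V, exists n, d p.1 p.2 != 0 ->
    d p.1 p.2 n != 0 /\ forall m, (m < n)%N -> d p.1 p.2 m = 0.
  move=> p; case: (boolP (d p.1 p.2 != 0)) => [/pseries_order[n Hn]|_]; first by exists n.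
  by exists 0%N.
have [p0 Hp0] : exists p : idx V * idx V, d p.1 p.2 != 0.
  apply: contrapT => H.
  have d0 : d = 0.
    apply: PS1_ext => i j; apply/eqP; apply: contrapT => /negP ne.
    by apply: H; exists (i, j).
  have := congr1 (fun f : arr PS V V => f i0 i0) dd.
  rewrite d0 PS1_compE big1 => [|l _]; last exact: P_comp0.
  by rewrite /t_endo eqxx => /esym/eqP; rewrite (negPf (tpow_neq0 _)).
pose M (p : idx V * idx V) : R := degree (V p.1) (V p.2) (o p).
case: (Order.TotalTheory.arg_minP (P := fun p => d p.1 p.2 != 0) M Hp0) => -[i j] /= dij Mmin.
set alpha := M (i, j) in Mmin.
have Da : PS1_D alpha d.
  move=> l m n dn; have [-> //|/eqP ne] := pselect (d l m = 0).
  have [_] := Ho (l, m) ne; apply.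
  have := lt_le_trans dn (Mmin (l, m) ne).
  by rewrite /M /degree ltrD2l (ltr_pM2l (pi2_gt0 R)) ltr_nat.
exists alpha; split=> //.
  (* The square of [d] is divisible by 2 alpha, whereas t has degree 2 pi on the diagonal. *)
  have := PS1_DM Da Da; rewrite dd => /(_ i0 i0); rewrite /t_endo eqxx => /P_D_tpow1.
  lra.
apply: contrapT => H.
have offdiag l m n : l != m -> degree (V l) (V m) n = alpha -> d l m n = 0.
  move=> lm dn; apply/eqP; apply: contrapT => /negP ne; apply: H.
  by exists l, m, n.
have [dn0 dlt] := Ho (i, j) dij; rewrite /= in dn0 dlt; set n := o (i, j) in dn0 dlt.
have [ij|ij] := eqVneq i j; last by rewrite offdiag ?eqxx in dn0.
subst j; have an : alpha = 2 * pi * n%:R by rewrite /alpha /M /degree arcxx add0r.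
have dii : degree (V i) (V i) (n + n) = alpha + alpha.
  by rewrite /degree arcxx add0r an natrD mulrDr.
(* At the even exponent 2 n the series t vanishes. On the other side, paths through [l] different
   from [i] contribute nothing, and the path through [i] gives the square of a nonzero
   coefficient. *)
have := congr1 (fun f : arr PS V V => f i i (n + n)%N) dd.
rewrite /t_endo eqxx /tpow PS1_compE.
have -> : (n + n == 1)%N = false by lia.
rewrite (bigD1 i) // P_comp_aab -[LHS]/(psmul (d i i) (d i i) (n + n)%N + _ (n + n)%N).
rewrite psmul_sqr_lowest // fct_sumE big1 ?addr0 => [/eqP|l li].
  by rewrite mulf_eq0 orbb (negPf dn0).
by apply: (P_comp_coef0 (Da i l) (Da l i) dii) => m; apply: offdiag; rewrite eq_sym.
Qed.

End Decomposition.
Arguments scalar {R k} sg V _ _.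
Arguments slot_in {R k I} x y s c _ _.
Arguments slot_out {R k I} x y s c _ _.

(** * Direct sums and their uniqueness *)

Section DirectSums.
Context {k : fieldType} {C : kcat k}.
Hypotheses (kC : is_kcat C) (sC : strict C).

Lemma is_dsum_unit (X : C) : is_dsum (fun _ : unit => X) X.
Proof.
have h := idm_hom kC X; exists (fun=> idm C X), (fun=> idm C X); split.
- by [].
- by move=> _; apply/(heqP kC sC); rewrite (comp1l kC sC).
- by move=> [] [].
- by apply/(heqP kC sC); rewrite (bigD1 tt) //= big1 => [|[]]; rewrite ?(comp1l kC sC) ?addr0.
Qed.

Lemma is_dsum_biproduct (I1 I2 : finType) (Xs : I1 + I2 -> C) (X1 X2 Y : C) i1 i2 p1 p2 :
  @biproduct k C X1 X2 Y i1 i2 p1 p2 ->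
  is_dsum (fun i => Xs (inl i)) X1 -> is_dsum (fun i => Xs (inr i)) X2 -> is_dsum Xs Y.
Proof.
move=> [[h1 h2 h3 h4] b11 b22 b12 b21 bs] [j1 [q1 [hj1 e1 z1 s1]]] [j2 [q2 [hj2 e2 z2 s2]]].
have hj1' i := (hj1 i).1; have hq1 i := (hj1 i).2.
have hj2' i := (hj2 i).1; have hq2 i := (hj2 i).2.
pose inj (i : I1 + I2) : arr C (Xs i) Y :=
  match i with inl i => comp C i1 (j1 i) | inr i => comp C i2 (j2 i) end.
pose prj (i : I1 + I2) : arr C Y (Xs i) :=
  match i with inl i => comp C (q1 i) p1 | inr i => comp C (q2 i) p2 end.
have cc (U V W W' W1 : C) (a : arr C V W) (b : arr C W' V) (c : arr C W1 W') (e : arr C U W1) :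
    hom C _ _ a -> hom C _ _ b -> hom C _ _ c -> hom C _ _ e ->
    comp C (comp C a b) (comp C c e) = comp C a (comp C (comp C b c) e).
  by move=> ha hb hc he; rewrite -!(compA kC sC) //; apply: comp_hom.
exists inj, prj; split.
- by case=> i; split; apply: comp_hom.
- case=> i; apply/(heqP kC sC); rewrite /= cc // ?b11 ?b22 (comp1l kC sC) //.
    exact/(heqP kC sC).
  exact/(heqP kC sC).
- case=> i [] j ij; apply/(heqP kC sC); rewrite /= cc // ?b11 ?b22 ?b12 ?b21
    ?(comp1l kC sC) ?(comp0l kC sC) ?(comp0r kC sC) //; apply/(heqP kC sC).
  + by apply: z1; apply: contraNneq ij => ->.
  + by apply: z2; apply: contraNneq ij => ->.
- move/(heqP kC sC): s1 => s1; move/(heqP kC sC): s2 => s2.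
  have E1 i : comp C (inj (inl i)) (prj (inl i)) = comp C (comp C i1 (comp C (j1 i) (q1 i))) p1.
    by rewrite /= -!(compA kC sC) // ?(compA kC sC (h := j1 i)) //; apply: comp_hom.
  have E2 i : comp C (inj (inr i)) (prj (inr i)) = comp C (comp C i2 (comp C (j2 i) (q2 i))) p2.
    by rewrite /= -!(compA kC sC) // ?(compA kC sC (h := j2 i)) //; apply: comp_hom.
  have hjq1 i := comp_hom kC (hj1' i) (hq1 i); have hjq2 i := comp_hom kC (hj2' i) (hq2 i).
  apply/(heqP kC sC); rewrite big_sumType /=.
  under eq_bigr => i _ do rewrite (E1 i).
  under [X in _ + X]eq_bigr => i _ do rewrite (E2 i).
  rewrite -!(comp_suml kC sC) //; try by move=> i; apply: comp_hom.
  by rewrite -!(comp_sumr kC sC) // s1 s2 !(comp1r kC sC).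
Qed.

Lemma is_dsum_iso (I : finType) (Xs : I -> C) (Y Y' : C) :
  is_dsum Xs Y -> is_dsum Xs Y' -> exists f : arr C Y Y', is_iso f.
Proof.
suff H Z Z' : is_dsum Xs Z -> is_dsum Xs Z' -> exists2 f : arr C Z Z', hom C Z Z' f &
    exists2 g, hom C Z' Z g & heq (comp C g f) (idm C Z) /\ heq (comp C f g) (idm C Z').
  by move=> ds ds'; have [f hf Hf] := H _ _ ds ds'; exists f.
move=> [j [q [hj e z s1]]] [j' [q' [hj' e' z' s1']]].
have hj1 i := (hj i).1; have hq1 i := (hj i).2.
have hj2 i := (hj' i).1; have hq2 i := (hj' i).2.
(* Stated for two arbitrary decompositions, so that it computes both composites. *)
have key (U U' : C) (a : forall i, arr C (Xs i) U) (b : forall i, arr C U (Xs i))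
    (a' : forall i, arr C (Xs i) U') (b' : forall i, arr C U' (Xs i)) :
    (forall i, hom C _ _ (a i)) -> (forall i, hom C _ _ (b i)) ->
    (forall i, hom C _ _ (a' i)) -> (forall i, hom C _ _ (b' i)) ->
    (forall i, heq (comp C (b' i) (a' i)) (idm C (Xs i))) ->
    (forall i l, i != l -> heq (comp C (b' l) (a' i)) 0) ->
    heq (\sum_i comp C (a i) (b i)) (idm C U) ->
    heq (comp C (\sum_i comp C (a i) (b' i)) (\sum_i comp C (a' i) (b i))) (idm C U).
  move=> ha hb ha' hb' e1 z1 s0; apply: (heq_trans kC _ s0); apply: (eq_heq kC).
  have hab i := comp_hom kC (ha i) (hb' i); have hab' i := comp_hom kC (ha' i) (hb i).
  rewrite (comp_suml kC sC) //; last by apply: (hom_sum kC).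
  apply: eq_bigr => i _; rewrite (comp_sumr kC sC) // (bigD1 i) //= big1 => [|l li].
    rewrite addr0 (compA kC sC) // -(compA kC sC (h := a i)) //.
    by move/(heqP kC sC): (e1 i) => ->; rewrite (comp1r kC sC).
  rewrite (compA kC sC) // -(compA kC sC (h := a i)) //.
  by move/(heqP kC sC): (z1 _ _ li) => ->; rewrite (comp0r kC sC) // (comp0l kC sC).
exists (\sum_i comp C (j' i) (q i)).
  by apply: (hom_sum kC) => i; apply: comp_hom.
exists (\sum_i comp C (j i) (q' i)).
  by apply: (hom_sum kC) => i; apply: comp_hom.
by split; apply: key.
Qed.

End DirectSums.

(** * Splitting off one summand E(x, y) *)

Section SplitOff.
Context {R : realType} {k : fieldType}.
Local Notation pi := (@pi R).
Local Notation PS := (PS1 R k).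
Local Notation "g ** f" := (comp PS g f) (at level 40, left associativity).
Local Notation t := (@t_endo R k).

Let pi0 : 0 <= pi. Proof. exact: pi_ge0. Qed.

(** For theta = 0 every morphism is divisible; this instance supplies the calculus of composites. *)
Let sd0 : @shift_data k PS t (@PS1_D R k 0).
Proof. exact: PS1_shift_data. Qed.

Local Notation cA := (cA sd0).
Local Notation cE := (cE sd0).
Local Notation cAe := (cAe sd0).

(** Let A and B be the summands of V between which [d] has an off-diagonal entry of least degree
    alpha. By minimality [d ** ei = w ** e] and [r2 ** d = e ** r1]. Then (ei, w) maps E(x, x +
    alpha) to V and (r1, r2) maps V back, compatibly with [d], and the composite on E(x, x + alpha)
    is multiplication by a series [u0] with nonzero constant term, hence invertible. *)
Lemma split_off_E (V : PS) (d : arr PS V V) (i0 : idx V) : d ** d = @t_endo R k V ->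
  exists (x alpha : R) (W : PS), let E := EV k (fun _ : unit => x) (fun _ => x + alpha) in
  exists (f : arr PS E V) (io : arr PS W V) (r : arr PS V E) (p : arr PS V W),
    [/\ PS1_D alpha d, 0 <= alpha <= pi, (#|idx W| < #|idx V|)%N,
        biproduct (C := PS) f io r p & d ** f = f ** @Ed R k unit (fun _ => x) (fun _ => x + alpha)]
    /\ d ** (io ** p) = io ** p ** d /\ (forall theta, PS1_D theta d -> theta <= alpha).
Proof.
move=> dd; have [alpha [api Da [i [j [n [ij dn dij]]]]]] := minimal_entry i0 dd.
have a0 : 0 <= alpha by rewrite -dn /degree addr_ge0 ?arc_ge0 // mulr_ge0 // ltW // pi2_gt0.
pose x := rep (V i); have ptx : pt x = V i by apply: pt_rep.
have pty : pt (x + alpha) = V j.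
  rewrite -dn /degree addrA -[n%:R]/((Posz n)%:~R) pt_intr.
  exact: pt_arc.
have pr := @PS1_shift_pair R k alpha unit (fun _ : unit => x) a0 api.
have sd := @PS1_shift_data R k alpha a0 api.
move: pr; set A := Fam _; set B := Fam (fun _ : unit => pt (x + alpha)).
set e := dg _ _ _; set e' := dg _ _ _ => pr.
have [[ee' e'e] _ _ L Rr] := pr.
pose ei : arr PS A V := fun _ l => if l == i then tpow k 0 else 0.
pose ei' : arr PS V A := fun l _ => if l == i then tpow k 0 else 0.
pose ej : arr PS B V := fun _ l => if l == j then tpow k 0 else 0.
pose r2 : arr PS V B := fun l _ => if l == j then tpow k 0 else 0.
have [w Ew] := L _ (d ** ei) (sd_Dr sd _ Da).
have [r1 Er] := Rr _ (r2 ** d) (sd_Dl sd _ Da).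
have dw : d ** w = ei ** e'.
  by apply: (shift_epi sd pr); rewrite -cA -Ew cA dd -cA ee' (sd_nat sd).
have r1d : r1 ** d = e' ** r2.
  by apply: (shift_mono sd pr); rewrite cA -Er -cA dd cA e'e (sd_nat sd).
have AE (Z : PS) (g : arr PS V Z) a b : (g ** ei) a b = P_comp (pt x) (V i) (Z b) (g i b) (tpow k 0).
  rewrite PS1_compE (bigD1 i) //= big1 ?addr0; first by rewrite /ei eqxx.
  by move=> l /negPf ne; rewrite /ei ne P_comp0.
have BE (Z : PS) (g : arr PS Z V) a b : (r2 ** g) a b = P_comp (Z a) (V j) (pt (x + alpha)) (tpow k 0) (g a j).
  rewrite PS1_compE (bigD1 j) //= big1 ?addr0; first by rewrite /r2 eqxx.
  by move=> l /negPf ne; rewrite /r2 ne P_comp0l.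
have r2ei : r2 ** ei = 0.
  by apply: PS1_ext => a b; rewrite AE /r2 (negPf ij) P_comp0l.
have r1w : r1 ** w = 0.
  by apply: (shift_mono sd pr); rewrite cA -Er -cA dw cA r2ei !cE.
pose u := r2 ** w; pose u0 := u tt tt.
have uE : u = scalar u0 B by apply: PS1_ext => -[] [].
have ue : u ** e = r2 ** d ** ei by rewrite /u -cA -Ew cA.
(* The entry of [d] from [i] to [j] is [u0] times e^alpha, and e^alpha is t^n times the generator;
   the constant term of [u0] is thus the coefficient [d i j n]. *)
have u00 : u0 0%N != 0.
  have := congr1 (fun h : arr PS A B => h tt tt n) ue.
  rewrite comp_dg_r AE BE -[B tt]/(pt (x + alpha)) -/u0 pty ptx P_comp1l P_comp1 P_comp_tpow.
  have -> : (Num.truncn (alpha / (2 * pi)) + wind (V i) (V j) (V j))%N = n.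
    apply/eqP; rewrite -(eqr_nat R); apply/eqP; apply: (mulfI (@pi2_neq0 R)).
    have := arc_pt x a0; have := arcD (V i) (V j) (V j); rewrite ptx pty arcxx.
    move: dn; rewrite /degree; move: (2 * pi) (Num.truncn _) => q m.
    by rewrite natrD mulrDr; lra.
  by rewrite ltnn subnn => ->.
have r1ei : r1 ** ei = scalar u0 A.
  by apply: (shift_mono sd pr); rewrite cA -Er -ue uE scalar_nat.
pose v := psinv u0; have vV Z := scalarV Z u00; rewrite -/v in vV.
pose s1 := scalar v A ** r1; pose s2 := scalar v B ** r2.
have s1ei : s1 ** ei = idm PS A by rewrite /s1 -cA r1ei vV.
have s1w : s1 ** w = 0 by rewrite /s1 -cA r1w !cE.
have s2ei : s2 ** ei = 0 by rewrite /s2 -cA r2ei !cE.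
have s2w : s2 ** w = idm PS B by rewrite /s2 -cA -/u uE vV.
have s1d : s1 ** d = e' ** s2 by rewrite /s1 -cA r1d !cA scalar_nat.
have s2d : s2 ** d = e ** s1 by rewrite /s2 -cA Er !cA scalar_nat.
have s2r : s2 = scalar v B ** r2 by [].
have r2s : r2 = scalar u0 B ** s2.
  by rewrite /s2 cA -scalar_nat vV (c1l sd0).
clearbody s1 s2 u u0 v.
(* The idempotent complementary to the copy of E(x, x + alpha). It commutes with [d] because that
   copy and its retraction do. *)
pose q := idm PS V - ei ** s1 - w ** s2.
have qE U (h : arr PS V U) : h ** q = h - h ** ei ** s1 - h ** w ** s2.
  by rewrite /q !(cDr sd0) !(cNr sd0) (c1r sd0) !cA.
have Eq U (h : arr PS U V) : q ** h = h - ei ** (s1 ** h) - w ** (s2 ** h).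
  by rewrite /q !(cDl sd0) !(cNl sd0) (c1l sd0) !cA.
have qei : q ** ei = 0 by rewrite Eq s1ei s2ei !cE subrr subr0.
have qw : q ** w = 0 by rewrite Eq s1w s2w !cE subr0 subrr.
have s1q : s1 ** q = 0 by rewrite qE s1ei s1w !cE subrr subr0.
have s2q : s2 ** q = 0 by rewrite qE s2ei s2w !cE subr0 subrr.
have qq : q ** q = q by rewrite qE qei qw !cE !subr0.
have dq : d ** q = q ** d by rewrite qE Eq Ew dw s1d s2d !cA addrAC.
have r2q : r2 ** q = 0 by rewrite r2s -cA s2q !cE.
have q1 : ei ** s1 + w ** s2 + q = idm PS V by rewrite /q addrC -[X in X + _]addrA -opprD subrK.
clearbody q.
(* The image of [q] is carried by the summands other than [i] and [j]: since [q ** ei = 0] and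
   [r2 ** q = 0], the identity and [io ** p0] agree between two copies of [q]. *)
pose P := [pred l | (l != i) && (l != j)].
pose W : PS := @Fam (S1 R) {l : idx V | P l} (fun m => V (val m)).
pose io : arr PS W V := fun m l => if l == val m then tpow k 0 else 0.
pose p0 : arr PS V W := fun l m => if l == val m then tpow k 0 else 0.
have ioE Z (g : arr PS V Z) m b : (g ** io) m b = g (val m) b.
  rewrite PS1_compE (bigD1 (val m)) //= big1 ?addr0; first by rewrite /io eqxx P_comp1.
  by move=> l /negPf ne; rewrite /io ne P_comp0.
have p0E Z (g : arr PS Z V) a m : (p0 ** g) a m = g a (val m).
  rewrite PS1_compE (bigD1 (val m)) //= big1 ?addr0; first by rewrite /p0 eqxx P_comp1l.
  by move=> l /negPf ne; rewrite /p0 ne P_comp0l.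
have p0io : p0 ** io = idm PS W.
  by apply: PS1_ext => m m'; rewrite p0E /io /= (inj_eq val_inj) eq_sym.
have p0ei : p0 ** ei = 0.
  by apply: PS1_ext => a m; rewrite p0E /ei; have /andP[/negPf-> _] := valP m.
have r2io : r2 ** io = 0.
  by apply: PS1_ext => m b; rewrite ioE /r2; have /andP[_ /negPf->] := valP m.
have sum1 : io ** p0 + ei ** ei' + ej ** r2 = idm PS V.
  apply: PS1_ext => l l'.
  rewrite -[LHS]/((io ** p0) l l' + (ei ** ei') l l' + (ej ** r2) l l').
  have -> : (io ** p0) l l' = if P l && (l == l') then tpow k 0 else 0.
    rewrite PS1_compE; case: (boolP (P l)) => [Pl|nPl].
      rewrite (bigD1 (Sub l Pl)) //= big1 ?addr0 => [|m].
        by rewrite /p0 /= eqxx P_comp1 /io /= eq_sym.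
      by rewrite -val_eqE /= eq_sym => /negPf ne; rewrite /p0 ne P_comp0.
    rewrite big1 // => m _; rewrite /p0; case: (l =P val m) => [lm|_]; last exact: P_comp0.
    by have := valP m; rewrite -lm (negPf nPl).
  have -> : (ei ** ei') l l' = if (l == i) && (l' == i) then tpow k 0 else 0.
    rewrite PS1_compE (bigD1 tt) //= big1 ?addr0 => [|[]//].
    rewrite /ei /ei'; case: (l =P i) => [->|_]; last by rewrite P_comp0.
    case: (l' =P i) => [->|_]; last by rewrite P_comp0l.
    by rewrite ptx P_comp1.
  have -> : (ej ** r2) l l' = if (l == j) && (l' == j) then tpow k 0 else 0.
    rewrite PS1_compE (bigD1 tt) //= big1 ?addr0 => [|[]//].
    rewrite /ej /r2; case: (l =P j) => [->|_]; last by rewrite P_comp0.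
    case: (l' =P j) => [->|_]; last by rewrite P_comp0l.
    by rewrite pty P_comp1.
  rewrite /= [LHS]/=; have [->|li] := eqVneq l i.
    by rewrite (negPf ij) /= add0r addr0 eq_sym.
  have [->|lj] /= := eqVneq l j; last by rewrite !addr0.
  by rewrite !add0r eq_sym.
have cardW : (#|idx W| < #|idx V|)%N.
  rewrite card_sig; have V0 : (0 < #|idx V|)%N by apply/card_gt0P; exists i.
  rewrite -(prednK V0) ltnS -(cardC1 i); apply/subset_leq_card/fintype.subsetP => l.
  by rewrite !inE => /andP[].
have s2io : q ** io = io - ei ** (s1 ** io).
  rewrite Eq; suff -> : s2 ** io = 0 by rewrite !cE subr0.
  by rewrite s2r -cA r2io !cE.
have pio : p0 ** q ** (q ** io) = idm PS W.
  rewrite !cA -(cA p0 q) qq -cA s2io (cDr sd0) (cNr sd0) p0io cA p0ei !cE.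
  by rewrite subr0.
have iop : q ** io ** (p0 ** q) = q.
  have -> : q ** io ** (p0 ** q) = q ** (io ** p0) ** q by rewrite !cA.
  have -> : io ** p0 = idm PS V - ei ** ei' - ej ** r2.
    by rewrite -sum1 (addrAC _ _ (- (ei ** ei'))) !addrK.
  rewrite !(cDr sd0) !(cNr sd0) !(cDl sd0) !(cNl sd0) (c1r sd0) qq !cA qei !cE.
  by rewrite (cAe r2q) !cE !subr0.
pose xE (_ : unit) := x; pose yE (_ : unit) := x + alpha.
pose E := EV k xE yE; pose dE : arr PS E E := @Ed R k unit xE yE.
pose j1 : arr PS A E := slot_in xE yE (fun=> false) false.
pose j2 : arr PS B E := slot_in xE yE (fun=> false) true.
pose o1 : arr PS E A := slot_out xE yE (fun=> false) false.
pose o2 : arr PS E B := slot_out xE yE (fun=> false) true.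
have [_ b11 b22 b12 b21 bs] : biproduct (C := PS) j1 j2 o1 o2 := (@slot_biproduct R k unit xE yE (fun=> false)).
have Ed1 : dE ** j1 = j2 ** e.
  rewrite [LHS](Ed_slot (k := k) xE yE (fun=> false) false) /e.
  by rewrite (_ : (fun i => epow k _) = (fun=> epow k alpha)) //; apply/funext => -[];
    congr epow; rewrite /slot /xE /yE /=; ring.
have Ed2 : dE ** j2 = j1 ** e'.
  rewrite [LHS](Ed_slot (k := k) xE yE (fun=> false) true) /e'.
  by rewrite (_ : (fun i => epow k _) = (fun=> epow k (2 * pi - alpha))) //; apply/funext => -[];
    congr epow; rewrite /slot /xE /yE /=; ring.
have o1d : o1 ** dE = e' ** o2.
  by rewrite -[LHS](c1r sd0) -bs [LHS](cDr sd0) !cA (cAe Ed1) (cAe Ed2) !cA b12 b11 !cE add0r.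
have o2d : o2 ** dE = e ** o1.
  by rewrite -[LHS](c1r sd0) -bs [LHS](cDr sd0) !cA (cAe Ed1) (cAe Ed2) !cA b22 b21 !cE addr0.
exists x, alpha, W, (ei ** o1 + w ** o2), (q ** io), (j1 ** s1 + j2 ** s2), (p0 ** q).
split; last first.
  split; first by rewrite iop.
  move=> theta Dth; rewrite leNgt; apply/negP => lt.
  by case/negP: dij; apply/eqP/Dth; rewrite dn.
split=> //; first by rewrite a0.
  split=> //.
  - rewrite [LHS](cDl sd0) !(cDr sd0) !cA !(cAe s1ei) !(cAe s2ei) !(cAe s1w) !(cAe s2w) !cE.
    by rewrite addr0 add0r.
  - by rewrite [LHS](cDl sd0) !cA (cAe s1q) (cAe s2q) !cE addr0.
  - by rewrite [LHS](cDr sd0) !cA (cAe qei) (cAe qw) !cE addr0.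
  - rewrite iop -q1 [X in X + _](cDl sd0) !(cDr sd0) !cA (cAe b11) (cAe b12) (cAe b21) (cAe b22).
    by rewrite !cE addr0 add0r.
rewrite -/dE [LHS](cDr sd0) [RHS](cDl sd0) -![X in _ = X + _]cA -![X in _ = _ + X]cA o1d o2d.
by rewrite !cA Ew dw; exact: addrC.
Qed.

End SplitOff.

Lemma full_sub_is_kcat (k : fieldType) (C : kcat k) (P : C -> Prop) :
  is_kcat C -> is_kcat (full_sub P).
Proof.
move=> kC; split=> /=.
- by move=> X Y; apply: hom_subspace.
- by move=> X Y; apply: null_subspace.
- by move=> X Y; apply: null_hom.
- by move=> X; apply: idm_hom.
- by move=> X Y Z g f; apply: comp_hom.
- by move=> X Y Z a g f f'; apply: comp_linear_r.
- by move=> X Y Z a g f f'; apply: comp_linear_l.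
- by move=> X Y Z g f; apply: comp_null_r.
- by move=> X Y Z g f; apply: comp_null_l.
- by move=> X Y Z W h g f; apply: comp_assoc.
- by move=> X Y f; apply: comp_idm_l.
- by move=> X Y f; apply: comp_idm_r.
Qed.

(** * Categories of pairs (V, d) *)

Section EndoCat.
Context {k : fieldType} {A : kcat k} {t : forall V : A, arr A V V}.
Context {D : forall V W : A, set (arr A V W)}.
Arguments D : clear implicits.
Hypothesis sd : shift_data t D.
Local Notation "g ** f" := (comp A g f) (at level 40, left associativity).
Local Notation cA := (cA sd).
Local Notation cE := (cE sd).

Lemma endo_homP (X Y : {V : A & arr A V V}) f :
  hom (endo_cat A) X Y f <-> f ** tagged X = tagged Y ** f.
Proof.
have hp := heqP (sd_kcat sd) (sd_strict sd).
by split=> [[_ /hp]|E] //; split; [exact: (sd_hom sd)|exact/hp].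
Qed.

Lemma endo_cat_is_kcat : is_kcat (endo_cat A).
Proof.
have kP := sd_kcat sd; have sP := sd_strict sd; have hP := endo_homP; have hA := sd_hom sd.
split.
- move=> X Y; split; first by apply/hP; rewrite !cE.
  move=> a u v /hP hu /hP hv; apply/hP.
  by rewrite (compZDl kP sP) // (compZDr kP sP) // hu hv.
- by move=> X Y; apply: (null_subspace kP).
- by move=> X Y f /sP ->; apply/hP; rewrite !cE.
- by move=> X; apply/hP; rewrite !cE.
- by move=> X Y Z g f /hP hg /hP hf; apply/hP; rewrite /= -cA hf !cA hg.
- by move=> X Y Z a g f f' _ _ _; apply: (comp_linear_r kP).
- by move=> X Y Z a g f f' _ _ _; apply: (comp_linear_l kP).
- by move=> X Y Z g f _; apply: (comp_null_r kP).
- by move=> X Y Z g f nf _; apply: (comp_null_l kP).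
- by move=> X Y Z W h g f _ _ _; apply: (comp_assoc kP).
- by move=> X Y f _; apply: (comp_idm_l kP).
- by move=> X Y f _; apply: (comp_idm_r kP).
Qed.

Variable P : endo_cat A -> Prop.

(** Inserting the decomposition of the identity writes the endomorphism of [X] as a sum of
    composites through those of the [Xs i], and [D] is an ideal. *)
Lemma dsum_divisible (I : finType) (Xs : I -> full_sub P) (X : full_sub P) :
  is_dsum Xs X -> (forall i, D _ _ (tagged (sval (Xs i)))) -> D _ _ (tagged (sval X)).
Proof.
have kP := sd_kcat sd; have sP := sd_strict sd; have hA := sd_hom sd.
move=> [inj [prj [hip _ _ /(heqP kP sP) s1]]] DX; rewrite /= in inj prj hip s1.
have hinj i : inj i ** tagged (sval (Xs i)) = tagged (sval X) ** inj i.
  by apply/endo_homP; case: (hip i).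
rewrite -[tagged (sval X)](c1r sd) -s1 (comp_sumr kP sP) //.
elim/big_ind: _ => [|f g Df Dg|i _]; [exact: (sd_D0 sd)|exact: (sd_DD sd)|].
by rewrite cA -hinj; apply/(sd_Dr sd)/(sd_Dl sd).
Qed.

Lemma endo_full_biproduct (X Y Z : full_sub P) i1 i2 p1 p2 :
  @biproduct k A (tag (sval X)) (tag (sval Y)) (tag (sval Z)) i1 i2 p1 p2 ->
  tagged (sval Z) ** i1 = i1 ** tagged (sval X) ->
  tagged (sval Z) ** i2 = i2 ** tagged (sval Y) ->
  @biproduct k (full_sub P) X Y Z i1 i2 p1 p2.
Proof.
move=> [_ b11 b22 b12 b21 bs] d1 d2; split=> //; split; apply/endo_homP => //.
- rewrite -[LHS](c1r sd) -bs [LHS](cDr sd) !cA (cAe sd d1) (cAe sd d2) !cA b11 b12 !cE.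
  by rewrite addr0.
- rewrite -[LHS](c1r sd) -bs [LHS](cDr sd) !cA (cAe sd d1) (cAe sd d2) !cA b21 b22 !cE.
  by rewrite add0r.
Qed.

End EndoCat.

(** * F_c consists of the divisible square roots of t *)

Section FcatDivisible.
Context {R : realType} {k : fieldType}.
Local Notation pi := (@pi R).
Local Notation PS := (PS1 R k).
Local Notation FC := (Fcat R k).
Local Notation "g ** f" := (comp PS g f) (at level 40, left associativity).

Let sd0 : @shift_data k PS (@t_endo R k) (@PS1_D R k 0).
Proof. exact: (PS1_shift_data _ (pi_ge0 R)). Qed.

Local Notation cA := (cA sd0).
Local Notation cE := (cE sd0).

Lemma Fcat_is_kcat : is_kcat FC.
Proof. exact: (full_sub_is_kcat _ (endo_cat_is_kcat sd0)). Qed.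

Lemma Fcat_strict : strict FC. Proof. by move=> X Y; apply: PS1_strict. Qed.

Lemma Fcat_sqr (X : FC) :
  tagged (sval X) ** tagged (sval X) = @t_endo R k (tag (sval X)).
Proof. by apply/PS1_heq; case: (svalP X). Qed.

Variable c : R.
Hypotheses (c_ge0 : 0 <= c) (c_le_pi : c <= pi).
Let th := pi - c.
Let th0 : 0 <= th. Proof. by rewrite subr_ge0. Qed.
Let thpi : th <= pi. Proof. by rewrite gerBl. Qed.
Let sd : @shift_data k PS (@t_endo R k) (@PS1_D R k th).
Proof. exact: PS1_shift_data. Qed.

Lemma is_Fc_divisible (X : FC) : is_Fc c X -> PS1_D th (tagged (sval X)).
Proof.
move=> [I [x [y [H [Hc ds]]]]].
apply: (dsum_divisible sd ds) => i.
by apply: Ed_D th0 _ => _; exact: Hc.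
Qed.

(** Induction on the number of summands. The exponent alpha of the summand split off is the largest
    by which [d] is divisible, hence at least theta, and alpha <= pi gives the upper bound required
    in F_c. *)
Lemma divisible_is_Fc (X : FC) : PS1_D th (tagged (sval X)) -> is_Fc c X.
Proof.
move: {2}(#|idx (tag (sval X))|) (leqnn #|idx (tag (sval X))|) => n.
elim: n X => [|n IH] X Xn DX.
  have X0 (i : idx (tag (sval X))) : False.
    by move: Xn; rewrite leqn0 => /eqP/card0_eq/(_ i).
  have H0 (i : void) : (fun _ : void => 0 : R) i <= (fun _ : void => 0) i <= 0 + 2 * pi by case: i.
  exists void, (fun=> 0), (fun=> 0), H0; split; first by case.
  exists (fun i : void => match i with end), (fun i : void => match i with end).
  by split; try (by case); apply/(heqP Fcat_is_kcat Fcat_strict)/PS1_ext => i; case: (X0 i).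
have [[i0 _]|X0] := pselect (exists i : idx (tag (sval X)), True); last first.
  apply: IH DX; rewrite eq_card0 // => i; exfalso; apply: X0.
  by exists i.
have [x [alpha [W [f [io [r [p [[Da /andP[a0 api] cW bp df] [dq le_alpha]]]]]]]]] := split_off_E i0 (Fcat_sqr X).
have [_ b11 b22 b12 b21 bs] := bp.
set V := tag (sval X) in f io r p df dq bp b11 b22 b12 b21 bs cW *.
set d := tagged (sval X) in Da df dq.
have tha : th <= alpha by apply: le_alpha.
pose dW := p ** d ** io.
have dio : d ** io = io ** dW.
  by rewrite /dW !cA -dq -!cA b22 (c1r sd0).
have pd : p ** d = dW ** p.
  by rewrite /dW -!cA dq !cA b22 (c1l sd0).
have dWD : PS1_D th dW by apply/(sd_Dr sd)/(sd_Dl sd).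
have FW : is_F (Tagged (fun V => arr PS V V) dW).
  split=> //; apply/PS1_heq; rewrite -[LHS]/(dW ** dW) -[RHS]/(@t_endo R k W).
  by rewrite {2}/dW !cA -pd -(cA p d d) Fcat_sqr (sd_nat sd p) -[LHS](cA (@t_endo R k W) p io) b22 (c1r sd0).
have [I [x' [y' [H' [Hc' dsW]]]]] := IH (exist _ _ FW) (leq_trans cW Xn) dWD.
pose xx (i : unit + I) := match i with inl _ => x | inr i => x' i end.
pose yy (i : unit + I) := match i with inl _ => x + alpha | inr i => y' i end.
have hE : x <= x + alpha <= x + 2 * pi by lra.
pose HH (i : unit + I) : xx i <= yy i <= xx i + 2 * pi :=
  match i with inl _ => hE | inr i => H' i end.
exists _, xx, yy, HH; split.
  case=> [u|i]; last exact: Hc'.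
  by rewrite /xx /yy; move: tha api; rewrite /th => h1 h2; lra.
have bpF : biproduct (C := FC) (X := E k hE) (Y := exist _ _ FW) (Z := X) f io r p.
  exact (@endo_full_biproduct k PS _ _ sd0 (@is_F R k) (E k hE) (exist _ _ FW) X f io r p bp df dio).
apply: (is_dsum_biproduct Fcat_is_kcat Fcat_strict bpF) => //.
exact: (@is_dsum_unit k FC Fcat_is_kcat Fcat_strict (E k hE)).
Qed.

End FcatDivisible.

(** * The Frobenius structure of F_c *)

Section ShiftTypeCover.
Context {k : fieldType} {A : kcat k} {t : forall V : A, arr A V V}.
Context {D : forall V W : A, set (arr A V W)}.
Arguments D : clear implicits.
Hypothesis sd : shift_data t D.
Local Notation "g ** f" := (comp A g f) (at level 40, left associativity).
Variable hm : forall X Y : {V : A & arr A V V}, set (arr A (tag X) (tag Y)).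
Hypothesis hmE : forall X Y f, @hm X Y f <-> f ** tagged X = tagged Y ** f.
Local Notation C := (root_cat (t := t) (D := D) hm).
Variable ex : seq_class C.
Hypothesis exE : forall X Y Z f g,
  @ex X Y Z f g <-> [/\ hom C X Y f, hom C Y Z g & exists r s, splits (A := A) f g r s].
Local Notation d X := (tagged (sval X)).
Local Notation cA := (cA sd).
Local Notation cE := (cE sd).
Local Notation cAe := (cAe sd).

(** The object [Q] of shift type is prescribed here, so that it can later be a sum of boundary
    objects. On [V] the epimorphism is the isomorphism [q], on [V'] it is forced, and invertibility
    of [q] makes the kernel a copy of [V']. *)
Lemma shift_type_adm_epi (Q X : C) V V' e e' i1 i2 p1 p2
    (q : arr A V (tag (sval X))) (q' : arr A (tag (sval X)) V) :
  shift_pair t D (V := V) (V' := V') e e' ->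
  @biproduct k A V V' (tag (sval Q)) i1 i2 p1 p2 ->
  d Q ** i1 = i2 ** e -> d Q ** i2 = i1 ** e' ->
  q' ** q = idm A _ -> q ** q' = idm A _ ->
  exists g, @adm_epi k C ex Q X g.
Proof.
move=> pr [_ b11 b22 b12 b21 bs] d1 d2 q'q qq'; have [[ee' e'e] _ _ L _] := pr.
have [m Em] := L _ _ (sd_Dr sd q (svalP X).1).
pose g : arr C Q X := q ** p1 + m ** p2.
have g1 : g ** i1 = q by rewrite (cDl sd) (cAe b11) (cAe b21) !cE addr0.
have g2 : g ** i2 = m by rewrite (cDl sd) (cAe b12) (cAe b22) !cE add0r.
have gd : g ** d Q = d X ** g.
  rewrite -[LHS](c1r sd) -[RHS](c1r sd) -bs [LHS](cDr sd) [RHS](cDr sd) !cA.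
  have -> : g ** d Q ** i1 = d X ** g ** i1 by rewrite -cA d1 cA g2 -cA g1 -Em.
  suff -> : g ** d Q ** i2 = d X ** g ** i2 by [].
  rewrite -cA d2 cA g1 -cA g2; apply: (shift_epi sd pr).
  by rewrite -!cA ee' -Em cA (svalP X).2 (sd_nat sd).
pose f : arr A V' (tag (sval Q)) := i2 - i1 ** q' ** m.
have S : splits (A := A) f g p2 (i1 ** q').
  split.
  - by rewrite /f (cDr sd) (cNr sd) g2 !cA g1 qq' !cE subrr.
  - by rewrite /f (cDr sd) (cNr sd) b22 !cA b21 !cE subr0.
  - by rewrite cA g1.
  - rewrite /f /g [X in X + _](cDl sd) (cNl sd) (cDr sd) !cA (cAe q'q) !cE.
    by rewrite [i1 ** p1 + _]addrC (addrA (_ - _)) subrK addrC.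
have [gf rf gs e1] := S.
pose dK := p2 ** d Q ** f.
have fK : d Q ** f = f ** dK.
  rewrite -[LHS](c1l sd) -e1 (cDl sd) !cA (cAe gd) !cA (cAe gf) !cE.
  by rewrite /dK !cA addr0.
have rK : square_root (t := t) (D := D) (Tagged (fun V => arr A V V) dK).
  split=> /=; first exact/(sd_Dr sd)/(sd_Dl sd)/(svalP Q).1.
  apply: (splits_mono sd S); rewrite cA -fK -cA -fK cA (svalP Q).2.
  by rewrite (sd_nat sd).
exists g, (exist _ _ rK), f; apply/exE; split; last by exists p2, (i1 ** q').
  exact/hmE/esym.
exact/hmE.
Qed.

End ShiftTypeCover.

(** * Full subcategories of pairs as categories of square roots *)

Section EndoFull.
Context {k : fieldType} {A : kcat k} {t : forall V : A, arr A V V}.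
Context {D : forall V W : A, set (arr A V W)}.
Arguments D : clear implicits.
Hypothesis sd : shift_data t D.
Local Notation "g ** f" := (comp A g f) (at level 40, left associativity).
Variable P : endo_cat A -> Prop.
Variable Q : full_sub P -> Prop.
Local Notation root := (@square_root k A t D).
Hypothesis Q_root : forall X : full_sub Q, root (sval (sval X)).
Hypothesis root_Q : forall V, root V -> exists X : full_sub Q, sval (sval X) = V.

Local Notation GC := (full_sub Q).
Local Notation RC := (@root_cat k A t D (fun X Y => hom (endo_cat A) X Y)).

Definition full_exact : seq_class GC := fun X Y Z f g =>
  [/\ hom GC X Y f, hom GC Y Z g
    & @split_exact k A (tag (sval (sval X))) (tag (sval (sval Y))) (tag (sval (sval Z))) f g].

Let root_exact : seq_class RC := fun X Y Z f g =>
  [/\ hom RC X Y f, hom RC Y Z g & exists r s, splits (A := A) f g r s].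

Let split_exactP (U V W : A) (f : arr A U V) (g : arr A V W) :
  @split_exact k A U V W f g <-> exists r s, splits f g r s.
Proof.
have hP := heqP (sd_kcat sd) (sd_strict sd); have hA := sd_hom sd.
split=> [[_ _ /hP gf [r [s [_ _ /hP rf /hP gs /hP e]]]]|[r [s [gf rf gs e]]]].
  by exists r, s.
by split; rewrite ?hP //; exists r, s; split; rewrite ?hP.
Qed.

Let hmE (X Y : {V : A & arr A V V}) f :
  hom (endo_cat A) X Y f <-> f ** tagged X = tagged Y ** f := endo_homP sd f.

Let exE X Y Z f g : @root_exact X Y Z f g <->
  [/\ hom RC X Y f, hom RC Y Z g & exists r s, splits (A := A) f g r s].
Proof. exact: iff_refl. Qed.

Let root_exact_hom X Y Z f g : @root_exact X Y Z f g -> hom RC X Y f /\ hom RC Y Z g.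
Proof. by case. Qed.

Lemma full_is_kcat : is_kcat GC.
Proof. exact/full_sub_is_kcat/full_sub_is_kcat/(endo_cat_is_kcat sd). Qed.

Lemma full_strict : strict GC. Proof. by move=> X Y f; apply: (sd_strict sd). Qed.

Let RC_kcat : is_kcat RC := root_is_kcat sd hmE.
Let RC_strict : strict RC := root_strict sd (hm := fun X Y => hom (endo_cat A) X Y).

(** Both categories have the same pairs (V, d) as objects and differ only in the proofs attached to
    them. *)
Let incl_ob (X : GC) : RC := exist _ (sval (sval X)) (Q_root X).

Let incl : functor GC RC.
Proof.
refine (@Functor k GC RC incl_ob (fun X Y f => f) (fun X Y f h => h) (fun X Y f h => h) _ _ _).
- by move=> *; apply: (heq_refl RC_kcat).
- by move=> *; apply: (heq_refl RC_kcat).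
- by move=> *; apply: (heq_refl RC_kcat).
Defined.

Let incl_ff : fully_faithful incl.
Proof. by split=> // X Y g hg; exists g => //; apply: (heq_refl RC_kcat). Qed.

Let incl_es : essentially_surjective incl.
Proof.
case=> V rV; have [X E] := root_Q rV.
exists X; subst V.
have E : incl X = exist _ _ rV by congr exist; apply: Prop_irrelevance.
rewrite -E; exists (idm RC (incl X)); split; first exact: (idm_hom RC_kcat).
exists (idm RC (incl X)); first exact: (idm_hom RC_kcat).
by split; apply: (comp_idm_l RC_kcat); apply: (idm_hom RC_kcat).
Qed.

Let full_exactE X Y Z f g : @full_exact X Y Z f g <->
  [/\ hom GC X Y f, hom GC Y Z g
    & @root_exact (incl X) (incl Y) (incl Z) (fmor incl f) (fmor incl g)].
Proof.
split=> [[hf hg /split_exactP e]|[hf hg [_ _ /split_exactP e]]].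
  exact: And3 hf hg (And3 hf hg e).
exact: And3 hf hg e.
Qed.

Let icR : iso_closed root_exact := root_iso_closed sd exE.

Lemma full_half_frobenius : half_frobenius full_exact.
Proof.
apply: (lift_half_frobenius full_is_kcat RC_kcat full_strict RC_strict incl_ff incl_es
  full_exactE root_exact_hom icR).
exact: (root_half_frobenius sd hmE exE).
Qed.

Lemma full_half_frobenius_op : half_frobenius (opex full_exact).
Proof.
apply: (lift_half_frobenius_op full_is_kcat RC_kcat full_strict RC_strict incl_ff incl_es
  full_exactE root_exact_hom icR).
exact: (root_half_frobenius_op sd hmE exE).
Qed.

Lemma full_additive : additive GC.
Proof.
apply: (additive_transport full_is_kcat RC_kcat full_strict RC_strict incl_ff incl_es).
exact: (root_additive sd hmE).
Qed.

Lemma full_iso_closed : iso_closed full_exact.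
Proof.
exact: (lift_iso_closed full_is_kcat RC_kcat full_strict RC_strict full_exactE icR).
Qed.

Lemma full_exact_hom X Y Z f g : @full_exact X Y Z f g -> hom GC X Y f /\ hom GC Y Z g.
Proof. by case. Qed.

Lemma full_shift_type_projective (X : GC) :
  @shift_type k A t D (sval (sval X)) -> projective full_exact X.
Proof.
move=> sX; apply/(projectiveE full_is_kcat RC_kcat full_strict RC_strict incl_ff incl_es
  full_exactE root_exact_hom icR).
exact: (shift_type_projective sd hmE exE).
Qed.

Lemma full_shift_type_injective (X : GC) :
  @shift_type k A t D (sval (sval X)) -> injective_ob full_exact X.
Proof.
move=> sX; apply/(injectiveE full_is_kcat RC_kcat full_strict RC_strict incl_ff incl_es
  full_exactE root_exact_hom icR).
exact: (shift_type_injective sd hmE exE).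
Qed.

Lemma full_shift_type_adm_epi (T X : GC) V V' e e' i1 i2 p1 p2
    (q : arr A V (tag (sval (sval X)))) q' :
  shift_pair t D (V := V) (V' := V') e e' ->
  @biproduct k A V V' (tag (sval (sval T))) i1 i2 p1 p2 ->
  tagged (sval (sval T)) ** i1 = i2 ** e -> tagged (sval (sval T)) ** i2 = i1 ** e' ->
  q' ** q = idm A _ -> q ** q' = idm A _ ->
  exists g, @adm_epi k GC full_exact T X g.
Proof.
move=> pr bp d1 d2 q1 q2.
have [g [K [f [hf hg S]]]] := shift_type_adm_epi (Q := incl T) (X := incl X)
  sd hmE exE pr bp d1 d2 q1 q2.
case: K f hf hg S => V0 rV f hf hg S; have [K' EK] := root_Q rV; subst V0.
by exists g, K', f; apply/full_exactE; split=> //; split.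
Qed.

End EndoFull.

Section FcFrobenius.
Context {R : realType} {k : fieldType}.
Local Notation pi := (@pi R).
Local Notation PS := (PS1 R k).
Local Notation "g ** f" := (comp PS g f) (at level 40, left associativity).
Variable c : R.
Hypotheses (c_ge0 : 0 <= c) (c_le_pi : c <= pi).

Lemma Fc_shift_data : @shift_data k PS (@t_endo R k) (@PS1_D R k (pi - c)).
Proof. by apply: PS1_shift_data; [rewrite subr_ge0|rewrite gerBl]. Qed.
Let sd := Fc_shift_data.

Lemma Fc_root (X : Fc k c) : @square_root k PS (@t_endo R k) (@PS1_D R k (pi - c)) (sval (sval X)).
Proof.
split; last exact: Fcat_sqr.
exact: (is_Fc_divisible c_ge0 c_le_pi (svalP X)).
Qed.

Lemma root_Fc V : @square_root k PS (@t_endo R k) (@PS1_D R k (pi - c)) V ->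
  exists X : Fc k c, sval (sval X) = V.
Proof.
move=> [DV dd].
have FV : is_F V by split=> //; apply/PS1_heq.
have CV : is_Fc c (exist _ V FV) by apply: divisible_is_Fc.
by exists (exist _ _ CV).
Qed.

Lemma Fc_is_kcat : is_kcat (@Fc R k c).
Proof. exact: (full_is_kcat sd (is_Fc c)). Qed.

Lemma Fc_strict : strict (@Fc R k c).
Proof. exact: (full_strict sd). Qed.

Lemma Fc_half_frobenius : half_frobenius (@Fc_exact R k c).
Proof. exact: (full_half_frobenius sd Fc_root root_Fc). Qed.

Lemma Fc_half_frobenius_op : half_frobenius (opex (@Fc_exact R k c)).
Proof. exact: (full_half_frobenius_op sd Fc_root root_Fc). Qed.

Lemma Fc_additive : additive (Fc k c).
Proof. exact: (full_additive sd Fc_root root_Fc). Qed.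

Lemma Fc_iso_closed : iso_closed (@Fc_exact R k c).
Proof. exact: (full_iso_closed sd Fc_root). Qed.

Lemma Fc_exact_hom X Y Z f g : @Fc_exact R k c X Y Z f g -> hom (Fc k c) X Y f /\ hom (Fc k c) Y Z g.
Proof. by move=> E; apply: (@full_exact_hom k PS (@is_F R k) (@is_Fc R k c) X Y Z f g E). Qed.

Lemma Fc_shift_type_projective (X : Fc k c) :
  @shift_type k PS (@t_endo R k) (@PS1_D R k (pi - c)) (sval (sval X)) ->
  projective (@Fc_exact R k c) X.
Proof. exact: (full_shift_type_projective sd Fc_root root_Fc). Qed.

Lemma Fc_shift_type_injective (X : Fc k c) :
  @shift_type k PS (@t_endo R k) (@PS1_D R k (pi - c)) (sval (sval X)) ->
  injective_ob (@Fc_exact R k c) X.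
Proof. exact: (full_shift_type_injective sd Fc_root root_Fc). Qed.

Lemma Fc_shift_type_adm_epi (T X : Fc k c) V V' e e' i1 i2 p1 p2
    (q : arr PS V (tag (sval (sval X)))) q' :
  @shift_pair k PS (@t_endo R k) (@PS1_D R k (pi - c)) V V' e e' ->
  @biproduct k PS V V' (tag (sval (sval T))) i1 i2 p1 p2 ->
  tagged (sval (sval T)) ** i1 = i2 ** e -> tagged (sval (sval T)) ** i2 = i1 ** e' ->
  q' ** q = idm PS _ -> q ** q' = idm PS _ ->
  exists g, @adm_epi k (Fc k c) (@Fc_exact R k c) T X g.
Proof. exact: (full_shift_type_adm_epi sd Fc_root root_Fc). Qed.

End FcFrobenius.

(** * The functor G^ *)

Lemma fsum_seq (V : zmodType) (f : int -> V) (l : seq int) : uniq l ->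
  (forall n, n \notin l -> f n = 0) -> \sum_(n \in [set: int]) f n = \sum_(n <- l) f n.
Proof.
move=> ul f0; rewrite (fsbigE l) // => [|n _]; last exact: f0.
by apply: eq_bigl => n; rewrite in_setT.
Qed.

Lemma fsum_single (V : zmodType) (f : int -> V) (m : int) :
  (forall n, n != m -> f n = 0) -> \sum_(n \in [set: int]) f n = f m.
Proof.
move=> f0; rewrite (@fsum_seq _ _ [:: m]) ?big_seq1 // => n.
by rewrite inE; apply: f0.
Qed.

Definition oddz (n : int) : bool := odd `|n|%N.

Lemma oddzD (m n : int) : oddz (m + n) = oddz m (+) oddz n.
Proof. by rewrite /oddz; lia. Qed.

Lemma oddz_even (n : int) : oddz n = false -> exists w : int, n = 2 * w.
Proof. by rewrite /oddz => o; exists (n %/ 2)%Z; lia. Qed.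

Lemma oddz0 : oddz 0 = false. Proof. by []. Qed.

Lemma oddzN (n : int) : oddz (- n) = oddz n. Proof. by rewrite /oddz abszN. Qed.

Section GhatCoefficients.
Context {R : realType} {k : fieldType} {r s : R}.
Hypotheses (r_gt0 : 0 < r) (r_le_s : r <= s).
Local Notation pi := (@pi R).
Local Notation PS := (PS1 R k).
Local Notation BF := (BFhat k r s).
Local Notation Gh f := (@Ghat_mor R k r s r_gt0 r_le_s _ _ f).
Local Notation "g ** f" := (comp PS g f) (at level 40, left associativity).
Implicit Types M N L : mob r.

Let s_gt0 : 0 < s. Proof. exact: lt_le_trans r_le_s. Qed.
Let pi_gt0' : 0 < pi. Proof. exact: pi_gt0. Qed.

Definition crd (M : mob r) (tau : bool) : R := if tau then my M else mx M.

Lemma Fs_iter (u : R) m M : msgn (iter m (Fs u) M) = msgn M (+) odd m /\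
  forall tau, crd (iter m (Fs u) M) tau = crd M (tau (+) odd m) + m%:R * u.
Proof.
elim: m => [|m [IH1 IH2]].
  by split=> [|tau]; rewrite ?addbF ?mul0r ?addr0.
split=> [|tau]; first by rewrite /= IH1 -addbN.
have -> : crd (iter m.+1 (Fs u) M) tau = crd (iter m (Fs u) M) (~~ tau) + u.
  by case: tau.
by rewrite IH2 /= -natr1 mulrDl mul1r addrA addbN addNb.
Qed.

Lemma Fs_powP n M : msgn (Fs_pow s n M) = msgn M (+) oddz n /\
  forall tau, crd (Fs_pow s n M) tau = crd M (tau (+) oddz n) + n%:~R * s.
Proof.
case: n => m /=; first exact: Fs_iter.
have [h1 h2] := Fs_iter (- s) m.+1 M; split; first exact: h1.
move=> tau; rewrite h2 NegzE mulrNz mulNr mulrN.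
by [].
Qed.

Lemma msgn_pow n M : msgn (Fs_pow s n M) = msgn M (+) oddz n.
Proof. by case: (Fs_powP n M). Qed.

Lemma crd_pow n M tau : crd (Fs_pow s n M) tau = crd M (tau (+) oddz n) + n%:~R * s.
Proof. by case: (Fs_powP n M). Qed.

Lemma mleP M N : mle M N <-> forall tau, crd M tau <= crd N tau.
Proof.
split=> [[h1 h2] []//|h]; split; [exact: (h false)|exact: (h true)].
Qed.

(* Whether the summand [b] of [G M] lies above the second coordinate of [M]. *)
Definition sort_of M (b : bool) : bool := b (+) ~~ msgn M.

Definition pos0 M b : R := pi / s * crd M (sort_of M b).

Definition Gpt M (b : bool) : S1 R := pt (if b then Gy s M else Gx s M).

Lemma Gpt_pos M b : Gpt M b = pt (pos0 M b + (if sort_of M b then pi else 0)).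
Proof.
rewrite /Gpt /pos0 /sort_of /Gx /Gy; case: (msgn M); case: b; rewrite /= ?addr0 //.
by rewrite -[LHS]pt_2pi; congr pt; ring.
Qed.

(** The exponent of e on the component from summand [b] of G M to summand [c] of G N of a basic
    morphism from M to F_s^n N; each application of F_s contributes pi. *)
Definition eps M b N c (n : int) : R := pos0 N c - pos0 M b + pi * n%:~R.

(** The parity of n at which this component is a diagonal entry of the middle matrix: F_s exchanges
    the two coordinates, hence the two sorts. *)
Definition matched M b N c (n : int) : bool := sort_of M b (+) sort_of N c == oddz n.

Lemma arc_eps M b N c : exists2 z : int, oddz z = sort_of M b (+) sort_of N c &
  arc (Gpt M b) (Gpt N c) = pos0 N c - pos0 M b + pi * z%:~R.
Proof.
rewrite !Gpt_pos; set x := _ + _; set y := _ + _.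
have [z ->] := arc_intr x y.
exists (2 * z + (sort_of N c)%:Z - (sort_of M b)%:Z).
  by rewrite !oddzD oddzN /oddz; move: (sort_of _ _) (sort_of _ _) => [] []; lia.
rewrite /x /y !intrD intrN intrM; case: (sort_of M b); case: (sort_of N c) => /=; ring.
Qed.

(** The degree n whose component carries t^m, obtained by solving [eps = degree] for n. The quotient
    is an integer, so the floor loses nothing. *)
Definition nn M b N c (m : nat) : int :=
  Num.floor ((degree (Gpt M b) (Gpt N c) m - (pos0 N c - pos0 M b)) / pi).

Lemma nnE M b N c m : matched M b N c (nn M b N c m) /\
  eps M b N c (nn M b N c m) = degree (Gpt M b) (Gpt N c) m.
Proof.
have [z oz Ez] := arc_eps M b N c.
have D : degree (Gpt M b) (Gpt N c) m = pos0 N c - pos0 M b + pi * (z + 2 * m%:Z)%:~R.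
  by rewrite /degree Ez intrD intrM; ring.
have E : nn M b N c m = z + 2 * m%:Z.
  rewrite /nn D [pos0 N c - _ + _]addrC addrK [pi * _]mulrC mulfK ?gt_eqF //.
  by rewrite intrKfloor.
rewrite E /eps D; split=> //; rewrite /matched -oz oddzD.
by rewrite (_ : oddz (2 * m%:Z) = false) ?addbF // /oddz; lia.
Qed.

Lemma eps_degree M b N c n : matched M b N c n -> 0 <= eps M b N c n ->
  degree (Gpt M b) (Gpt N c) (Num.truncn (eps M b N c n / (2 * pi))) = eps M b N c n.
Proof.
move=> /eqP mn e0; have [z oz Ez] := arc_eps M b N c.
set T := Num.truncn _; have p0 := pi2_gt0 R.
have odd0 : oddz (n - z) = false by rewrite oddzD oddzN oz mn addbb.
have [w Ew] : exists w : int, n - z = 2 * w.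
  exact: oddz_even.
have E1 : eps M b N c n = arc (Gpt M b) (Gpt N c) + 2 * pi * w%:~R.
  have -> : n = z + 2 * w by rewrite -Ew addrC subrK.
  by rewrite /eps Ez intrD intrM; ring.
have ET : (T%:R : R) = w%:~R.
  rewrite -floor_truncn; last by rewrite divr_ge0 // ltW.
  congr (_%:~R); apply: floor_def; rewrite ler_pdivlMr // ltr_pdivrMr // E1 intrD.
  have := arc_ge0 (Gpt M b) (Gpt N c); have := arc_lt (Gpt M b) (Gpt N c).
  move: (2 * pi) (arc _ _) => q a h1 h2.
  by apply/andP; split; lra.
by rewrite /degree ET E1.
Qed.

Lemma nn_eps M b N c n : matched M b N c n -> 0 <= eps M b N c n ->
  nn M b N c (Num.truncn (eps M b N c n / (2 * pi))) = n.
Proof.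
move=> mn e0; rewrite /nn eps_degree // /eps [pos0 N c - _ + _]addrC addrK.
by rewrite [pi * _]mulrC mulfK ?gt_eqF // intrKfloor.
Qed.

Lemma eps_inj M b N c n n' : eps M b N c n = eps M b N c n' -> n = n'.
Proof.
by move=> /addrI/(mulfI (lt0r_neq0 pi_gt0'))/intr_inj.
Qed.

Lemma degree_inj (a b : S1 R) m m' : degree a b m = degree a b m' -> m = m'.
Proof.
by move=> /addrI/(mulfI (@pi2_neq0 R))/eqP; rewrite eqr_nat => /eqP.
Qed.

Lemma sort_pow n N c : sort_of (Fs_pow s n N) c = sort_of N c (+) oddz n.
Proof. by rewrite /sort_of msgn_pow -!addNb addbA. Qed.

Lemma G_basic_pow M N n b c :
  G_basic k s M (Fs_pow s n N) b c = if matched M b N c n then epow k (eps M b N c n) else 0.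
Proof.
have E (tau : bool) : sort_of M b = tau -> sort_of N c = tau (+) oddz n ->
    pi / s * (crd (Fs_pow s n N) tau - crd M tau) = eps M b N c n.
  move=> h1 h2; rewrite /eps /pos0 h1 h2 crd_pow mulrBr mulrDr.
  have -> : pi / s * (n%:~R * s) = pi * n%:~R by field; rewrite gt_eqF.
  ring.
rewrite /G_basic -/(sort_of M b) -/(sort_of (Fs_pow s n N) c) sort_pow /matched.
case Eb: (sort_of M b); case Ec: (sort_of N c); case En: (oddz n) => //=; congr epow.
- by rewrite -(E true) // Ec En.
- by rewrite -(E true) // Ec En.
- by rewrite -(E false) // Ec En.
- by rewrite -(E false) // Ec En.
Qed.

Lemma eps_crd M b N c n : matched M b N c n ->
  eps M b N c n = pi / s * (crd (Fs_pow s n N) (sort_of M b) - crd M (sort_of M b)).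
Proof.
move=> /eqP mn; rewrite /eps /pos0 crd_pow.
have -> : sort_of M b (+) oddz n = sort_of N c by rewrite -mn addbA addbb.
have -> : pi * n%:~R = pi / s * (n%:~R * s) by field; rewrite gt_eqF.
by ring.
Qed.

Lemma eps_ge0 M b N c n : matched M b N c n ->
  (0 <= eps M b N c n) = (crd M (sort_of M b) <= crd (Fs_pow s n N) (sort_of M b)).
Proof.
by move=> mn; rewrite eps_crd // pmulr_rge0 ?subr_ge0 // divr_gt0.
Qed.

(** The two coordinate inequalities belong to the two matched pairs of summands, and [eps] is pi / s
    times the difference of the coordinates. *)
Lemma mle_eps M N n : mle M (Fs_pow s n N) <->
  forall b c, matched M b N c n -> 0 <= eps M b N c n.
Proof.
split=> [/mleP h b c mn|h]; first by rewrite eps_ge0.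
apply/mleP => tau; pose b := tau (+) ~~ msgn M.
have sb : sort_of M b = tau by rewrite /sort_of /b -addbA addbb addbF.
pose c := tau (+) oddz n (+) ~~ msgn N.
have mn : matched M b N c n.
  by rewrite /matched sb /sort_of /c -!addbA addbb addbF addbA addbb.
by have := h _ _ mn; rewrite eps_ge0 // sb.
Qed.

Lemma Ghat_coef (X Y : BF) (f : arr BF X Y) (p : idx X * bool) (q : idx Y * bool) m :
  hom BF X Y f -> (Gh f : arr PS (GV r_gt0 r_le_s X) (GV r_gt0 r_le_s Y)) p q m = f (nn (X p.1) p.2 (Y q.1) q.2 m) p.1 q.1.
Proof.
move=> hf; rewrite /Ghat_mor; set n0 := nn _ _ _ _ _.
have [mn0 en0] := nnE (X p.1) p.2 (Y q.1) q.2 m.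
rewrite (@fsum_single _ _ n0) => [|n nn0].
  rewrite -[LHS]/(f n0 p.1 q.1 * G_basic k s (X p.1) (Fs_pow s n0 (Y q.1)) p.2 q.2 m).
  rewrite G_basic_pow mn0 /epow /tpow (_ : (m == _) = true) ?mulr1 //.
  apply/eqP/(@degree_inj (Gpt (X p.1) p.2) (Gpt (Y q.1) q.2)).
  by rewrite eps_degree // en0 /degree addr_ge0 ?arc_ge0 // mulr_ge0 // ltW // pi2_gt0.
rewrite -[LHS]/(f n p.1 q.1 * G_basic k s (X p.1) (Fs_pow s n (Y q.1)) p.2 q.2 m).
rewrite G_basic_pow; case: ifP => [mn|_]; last by rewrite mulr0.
have [le|nle] := pselect (mle (X p.1) (Fs_pow s n (Y q.1))); last by rewrite hf ?mul0r.
have e0 := (mle_eps _ _ _).1 le _ _ mn.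
rewrite /epow /tpow; case: eqP => [Em|_]; last by rewrite mulr0.
by case/eqP: nn0; rewrite /n0 Em nn_eps.
Qed.

End GhatCoefficients.

(** * Full faithfulness and functoriality of G^ on coefficients *)

Section GhatFunctor.
Context {R : realType} {k : fieldType} {r s : R}.
Hypotheses (r_gt0 : 0 < r) (r_le_s : r <= s).
Local Notation pi := (@pi R).
Local Notation PS := (PS1 R k).
Local Notation BF := (BFhat k r s).
Local Notation Gh f := (@Ghat_mor R k r s r_gt0 r_le_s _ _ f).
Local Notation "g ** f" := (comp PS g f) (at level 40, left associativity).

Let s_gt0 : 0 < s. Proof. exact: lt_le_trans r_le_s. Qed.

Definition GE (X : BF) : PS := EV k (fun i => Gx s (X i)) (fun i => Gy s (X i)).

Definition Gd (X : BF) : arr PS (GE X) (GE X) :=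
  @Ed R k _ (fun i => Gx s (X i)) (fun i => Gy s (X i)).
Arguments Gd X : clear implicits.

Definition Gmor (X Y : BF) (f : arr BF X Y) : arr PS (GE X) (GE Y) := Gh f.

Let mt (X Y : BF) (p : idx X * bool) (q : idx Y * bool) n : bool :=
  matched (X p.1) p.2 (Y q.1) q.2 n.
Let ep (X Y : BF) (p : idx X * bool) (q : idx Y * bool) n : R :=
  eps (s := s) (X p.1) p.2 (Y q.1) q.2 n.
Let nu (X Y : BF) (p : idx X * bool) (q : idx Y * bool) m : int :=
  nn (s := s) (X p.1) p.2 (Y q.1) q.2 m.
Arguments mt : clear implicits.
Arguments ep : clear implicits.
Arguments nu : clear implicits.

(* The coefficient of [F] at the exponent at which [Ghat] places the component
   of degree [n]. *)
Definition cf (X Y : BF) (F : arr PS (GE X) (GE Y)) (p : idx X * bool) (q : idx Y * bool) (n : int) : k :=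
  if mt X Y p q n && (0 <= ep X Y p q n) then F p q (Num.truncn (ep X Y p q n / (2 * pi))) else 0.

Lemma F_cf X Y (F : arr PS (GE X) (GE Y)) p q m : F p q m = cf F p q (nu X Y p q m).
Proof.
have [mn en] := nnE r_gt0 r_le_s (X p.1) p.2 (Y q.1) q.2 m.
have d0 : 0 <= eps (s := s) (X p.1) p.2 (Y q.1) q.2 (nu X Y p q m).
  by rewrite /nu en /degree addr_ge0 ?arc_ge0 // mulr_ge0 // ltW // pi2_gt0.
rewrite /cf /mt /ep mn d0 /=; congr (F p q _).
apply: (@degree_inj R (Gpt (s := s) (X p.1) p.2) (Gpt (s := s) (Y q.1) q.2)).
by rewrite (eps_degree r_gt0 r_le_s) // -en.
Qed.

Lemma cf_ext X Y (F F' : arr PS (GE X) (GE Y)) :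
  (forall p q n, cf F p q n = cf F' p q n) -> F = F'.
Proof. by move=> E; apply: PS1_ext => p q; apply/funext => m; rewrite !F_cf. Qed.

Lemma Gmor_coef X Y (f : arr BF X Y) (p : idx X * bool) (q : idx Y * bool) m :
  hom BF X Y f -> Gmor f p q m = f (nu X Y p q m) p.1 q.1.
Proof. by move=> hf; exact: (Ghat_coef r_gt0 r_le_s p q m hf). Qed.

Lemma hom_eps X Y (f : arr BF X Y) p q n : hom BF X Y f -> mt X Y p q n ->
  ep X Y p q n < 0 -> f n p.1 q.1 = 0.
Proof.
move=> hf mn en; apply: (hf n p.1 q.1) => le.
have := (mle_eps r_gt0 r_le_s _ _ _).1 le _ _ mn.
by rewrite leNgt -/(ep X Y p q n) en.
Qed.

Lemma cf_Gmor X Y (f : arr BF X Y) p q n : hom BF X Y f ->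
  cf (Gmor f) p q n = if mt X Y p q n then f n p.1 q.1 else 0.
Proof.
move=> hf; rewrite /cf; case: ifP => [/andP[mn e0]|]; last first.
  case: ifP => //= mn /negbT; rewrite -ltNge => en.
  by rewrite (hom_eps hf mn en).
by rewrite mn Gmor_coef // /nu (nn_eps r_gt0 r_le_s).
Qed.

Lemma Gmor_linear X Y a (f f' : arr BF X Y) : hom BF X Y f -> hom BF X Y f' ->
  hom BF X Y (a *: f + f') -> Gmor (a *: f + f') = a *: Gmor f + Gmor f'.
Proof.
move=> hf hf' h; apply: PS1_ext => p q; apply/funext => m.
rewrite Gmor_coef // -[RHS]/(a * Gmor f p q m + Gmor f' p q m).
by rewrite !Gmor_coef.
Qed.

Lemma Gmor_inj X Y (f f' : arr BF X Y) : hom BF X Y f -> hom BF X Y f' ->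
  Gmor f = Gmor f' -> f = f'.
Proof.
move=> hf hf' E; apply/funext => n; apply/funext => i; apply/funext => j.
pose c := oddz n (+) sort_of (X i) false (+) ~~ msgn (Y j).
have mn : mt X Y (i, false) (j, c) n.
  rewrite /mt /matched /sort_of /c /sort_of /=.
  by case: (msgn (X i)); case: (msgn (Y j)); case: (oddz n).
have := cf_Gmor (i, false) (j, c) n hf.
by rewrite E cf_Gmor // mn.
Qed.

Definition flip (X : BF) (p : idx X * bool) : idx X * bool := (p.1, ~~ p.2).
Arguments flip : clear implicits.

Lemma sort_flip (M : mob r) b : sort_of M (~~ b) = ~~ sort_of M b.
Proof. by rewrite /sort_of addNb. Qed.

(** The exponent of d from summand [b] of G M to the other one; it is nonnegative because |x - y| <=
    r <= s. *)
Definition Gdist (M : mob r) b : R := pos0 (s := s) M (~~ b) - pos0 (s := s) M b + pi.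

Lemma Gdist_ge0 (M : mob r) b : 0 <= Gdist M b.
Proof.
have := mob_bound M; rewrite ler_norml => /andP[h1 h2].
have ps : 0 < pi / s by rewrite divr_gt0 ?pi_gt0.
have : pi / s * r <= pi by rewrite mulrAC ler_pdivrMr // ler_wpM2l ?pi_ge0.
have := ler_wpM2l (ltW ps) h1; have := ler_wpM2l (ltW ps) h2.
rewrite /Gdist /pos0 sort_flip !mulrBr mulrN.
by case: (sort_of M b) => /=; lra.
Qed.

Lemma Gpt_flip (M : mob r) b : Gpt (s := s) M (~~ b) = pt (pos0 (s := s) M b + (if sort_of M b then pi else 0) + Gdist M b).
Proof.
rewrite Gpt_pos /Gdist sort_flip; case: (sort_of M b) => /=; last by congr pt; ring.
by rewrite -[LHS]pt_2pi; congr pt; ring.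
Qed.

Lemma Gd_E X p q : Gd X p q = if q == flip X p then epow k (Gdist (X p.1) p.2) else 0.
Proof.
case: p q => i b [j c]; rewrite /Gd /Ed /flip /= xpair_eqE [j == i]eq_sym.
case: eqP => [_|_] //=; rewrite /Gdist /pos0 /sort_of.
by case: b c => [] [] //=; congr epow; rewrite /Gx /Gy; case: (msgn (X i)) => /=; ring.
Qed.

Lemma Gd_r X Y (F : arr PS (GE X) (GE Y)) p q :
  (F ** Gd X) p q = P_comp (GE X p) (GE X (flip X p)) (GE Y q) (F (flip X p) q) (epow k (Gdist (X p.1) p.2)).
Proof.
rewrite PS1_compE (bigD1 (flip X p)) //= big1 ?addr0; first by rewrite Gd_E eqxx.
by move=> l /negPf ne; rewrite Gd_E ne P_comp0.
Qed.

Lemma Gd_l X Y (F : arr PS (GE X) (GE Y)) p q :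
  (Gd Y ** F) p q = P_comp (GE X p) (GE Y (flip Y q)) (GE Y q) (epow k (Gdist (Y q.1) (~~ q.2))) (F p (flip Y q)).
Proof.
have ff : flip Y (flip Y q) = q by case: q => j c; rewrite /flip /= negbK.
rewrite PS1_compE (bigD1 (flip Y q)) //= big1 ?addr0; first by rewrite Gd_E ff eqxx.
move=> l ne; rewrite Gd_E; case: eqP => [E|_]; last by rewrite P_comp0l.
by case/eqP: ne; rewrite E; case: l {E} => j c; rewrite /flip /= negbK.
Qed.

Lemma P_comp_epow_r (x alpha : R) c (g : pseries k) m : 0 <= alpha ->
  (degree (pt x) c m < alpha -> P_comp (pt x) (pt (x + alpha)) c g (epow k alpha) m = 0) /\
  (forall m', degree (pt x) c m = degree (pt (x + alpha)) c m' + alpha ->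
    P_comp (pt x) (pt (x + alpha)) c g (epow k alpha) m = g m').
Proof.
move=> a0; rewrite P_comp_tpow; set T := Num.truncn _; set w := wind _ _ _.
have Ea := arc_pt x a0; have Ew := arcD (pt x) (pt (x + alpha)) c.
rewrite -/T in Ea; rewrite -/w in Ew; rewrite /degree.
have p0 := pi2_gt0 R; have a1 := arc_ge0 (pt (x + alpha)) c.
split=> [lt|m' E].
  case: ltnP => // le; exfalso; have : ((T + w)%:R : R) <= m%:R by rewrite ler_nat.
  rewrite -(ler_pM2l p0); move: Ea Ew lt a1; move: (2 * pi) => q; rewrite natrD mulrDr; lra.
have -> : m = (T + w + m')%N.
  apply/eqP; rewrite -(eqr_nat R); apply/eqP/(mulfI (@pi2_neq0 R)).
  move: Ea Ew E; move: (2 * pi) => q; rewrite !natrD !mulrDr; lra.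
by rewrite ltnNge leq_addr /= addKn.
Qed.

Lemma P_comp_epow_l (x alpha : R) c (g : pseries k) m : 0 <= alpha ->
  (degree c (pt (x + alpha)) m < alpha -> P_comp c (pt x) (pt (x + alpha)) (epow k alpha) g m = 0) /\
  (forall m', degree c (pt (x + alpha)) m = degree c (pt x) m' + alpha ->
    P_comp c (pt x) (pt (x + alpha)) (epow k alpha) g m = g m').
Proof.
move=> a0; rewrite P_compC_tpow; set T := Num.truncn _; set w := wind _ _ _.
have Ea := arc_pt x a0; have Ew := arcD c (pt x) (pt (x + alpha)).
rewrite -/T in Ea; rewrite -/w in Ew; rewrite /degree.
have p0 := pi2_gt0 R; have a1 := arc_ge0 c (pt x).
split=> [lt|m' E].
  case: ltnP => // le; exfalso; have : ((T + w)%:R : R) <= m%:R by rewrite ler_nat.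
  rewrite -(ler_pM2l p0); move: Ea Ew lt a1; move: (2 * pi) => q; rewrite natrD mulrDr; lra.
have -> : m = (T + w + m')%N.
  apply/eqP; rewrite -(eqr_nat R); apply/eqP/(mulfI (@pi2_neq0 R)).
  move: Ea Ew E; move: (2 * pi) => q; rewrite !natrD !mulrDr; lra.
by rewrite ltnNge leq_addr /= addKn.
Qed.

Lemma mt_flipl X Y p q n : mt X Y (flip X p) q n = mt X Y p q (n + 1).
Proof.
by rewrite /mt /matched /flip /= sort_flip oddzD; do 2!case: (sort_of _ _); case: (oddz n).
Qed.

Lemma mt_flipr X Y p q n : mt X Y p (flip Y q) n = mt X Y p q (n + 1).
Proof.
by rewrite /mt /matched /flip /= sort_flip oddzD; do 2!case: (sort_of _ _); case: (oddz n).
Qed.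

Lemma ep_flipl X Y p q n : ep X Y p q (n + 1) = ep X Y (flip X p) q n + Gdist (X p.1) p.2.
Proof. by rewrite /ep /eps /flip /Gdist /= intrD; ring. Qed.

Lemma ep_flipr X Y p q n : ep X Y p q (n + 1) = ep X Y p (flip Y q) n + Gdist (Y q.1) (~~ q.2).
Proof. by rewrite /ep /eps /flip /Gdist /= negbK intrD; ring. Qed.

Let epd X Y p q n : mt X Y p q n -> 0 <= ep X Y p q n ->
  degree (Gpt (s := s) (X p.1) p.2) (Gpt (s := s) (Y q.1) q.2)
    (Num.truncn (ep X Y p q n / (2 * pi))) = ep X Y p q n.
Proof. by move=> mn e0; apply: (eps_degree r_gt0 r_le_s). Qed.

(** Like one step of F_s, composition with d exchanges the two summands, so it raises the degree n
    by one. When the exponent on the right is negative, the one on the left is smaller than that of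
    d and both coefficients vanish. *)
Lemma cf_Gd_r X Y (F : arr PS (GE X) (GE Y)) p q n :
  cf (F ** Gd X) p q (n + 1) = cf F (flip X p) q n.
Proof.
rewrite /cf mt_flipl; case mn: (mt X Y p q (n + 1)); rewrite ?andTb //.
have mn' : mt X Y (flip X p) q n by rewrite mt_flipl.
have D0 := Gdist_ge0 (X p.1) p.2; have Ee := ep_flipl p q n.
rewrite Gd_r.
have -> : GE X p = pt (pos0 (s := s) (X p.1) p.2 + (if sort_of (X p.1) p.2 then pi else 0)).
  exact: Gpt_pos.
have -> : GE X (flip X p) = pt (pos0 (s := s) (X p.1) p.2 + (if sort_of (X p.1) p.2 then pi else 0)
    + Gdist (X p.1) p.2) by exact: Gpt_flip.
have [lt0|ge0] := ltP (ep X Y (flip X p) q n) 0.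
  case: ifP => // e0.
  apply: (P_comp_epow_r _ _ _ _ D0).1; rewrite -Gpt_pos.
  by rewrite (epd mn e0) Ee; lra.
have e0 : 0 <= ep X Y p q (n + 1) by rewrite Ee addr_ge0.
rewrite e0; apply: (P_comp_epow_r _ _ _ _ D0).2.
by rewrite -Gpt_pos -Gpt_flip (epd mn e0) Ee; congr (_ + _); apply/esym/(epd mn' ge0).
Qed.

Lemma cf_Gd_l X Y (F : arr PS (GE X) (GE Y)) p q n :
  cf (Gd Y ** F) p q (n + 1) = cf F p (flip Y q) n.
Proof.
rewrite /cf mt_flipr; case mn: (mt X Y p q (n + 1)); rewrite ?andTb //.
have mn' : mt X Y p (flip Y q) n by rewrite mt_flipr.
have D0 := Gdist_ge0 (Y q.1) (~~ q.2); have Ee := ep_flipr p q n.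
have ptq : GE Y q = pt (pos0 (s := s) (Y q.1) (~~ q.2) + (if sort_of (Y q.1) (~~ q.2) then pi else 0)
    + Gdist (Y q.1) (~~ q.2)) by rewrite -Gpt_flip negbK.
have ptq' : GE Y (flip Y q) = pt (pos0 (s := s) (Y q.1) (~~ q.2) + (if sort_of (Y q.1) (~~ q.2) then pi else 0)).
  exact: Gpt_pos.
rewrite Gd_l ptq ptq'.
have [lt0|ge0] := ltP (ep X Y p (flip Y q) n) 0.
  case: ifP => // e0.
  apply: (P_comp_epow_l _ _ _ _ D0).1; rewrite -ptq.
  by rewrite [degree _ _ _](epd mn e0) Ee; lra.
have e0 : 0 <= ep X Y p q (n + 1) by rewrite Ee addr_ge0.
rewrite e0; apply: (P_comp_epow_l _ _ _ _ D0).2.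
rewrite -ptq -ptq' [degree _ _ _](epd mn e0) Ee; congr (_ + _); apply/esym.
exact: (epd mn' ge0).
Qed.

Lemma commute_cf X Y (F : arr PS (GE X) (GE Y)) :
  F ** Gd X = Gd Y ** F <-> forall p q n, cf F (flip X p) q n = cf F p (flip Y q) n.
Proof.
split=> [E p q n|E]; first by rewrite -cf_Gd_r -cf_Gd_l E.
by apply: cf_ext => p q n; rewrite -(subrK 1 n) cf_Gd_r cf_Gd_l E.
Qed.

Lemma Gmor_commute X Y (f : arr BF X Y) : hom BF X Y f -> Gmor f ** Gd X = Gd Y ** Gmor f.
Proof.
by move=> hf; apply/commute_cf => p q n; rewrite !cf_Gmor // mt_flipl mt_flipr.
Qed.

Lemma Gmor_full X Y (F : arr PS (GE X) (GE Y)) : F ** Gd X = Gd Y ** F ->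
  exists2 f, hom BF X Y f & Gmor f = F.
Proof.
move=> /commute_cf E.
(* The summand of G (Y j) that is matched in degree n with the summand [false] of G (X i). *)
pose c i j n := oddz n (+) sort_of (X i) false (+) ~~ msgn (Y j).
have cE i j n e : mt X Y (i, false) (j, e) n -> e = c i j n.
  rewrite /mt /matched /sort_of /c /sort_of /=.
  by case: (msgn (X i)); case: (msgn (Y j)); case: (oddz n); case: e.
pose f : arr BF X Y := fun n i j => cf F (i, false) (j, c i j n) n.
have hf : hom BF X Y f.
  (* A nonzero entry makes both matched exponents nonnegative, the second one through commutation
     with d; then [mle_eps] yields the order relation. *)
  move=> n i j nle; apply/eqP; apply: contrapT => /negP f0; apply: nle.
  apply/(mle_eps r_gt0 r_le_s) => b e mn.
  have F0 : cf F (i, b) (j, e) n != 0.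
    case: b mn => mn; last by rewrite (cE _ _ _ _ mn).
    have mn' : mt X Y (i, false) (j, ~~ e) n.
      by rewrite -[(j, ~~ e)]/(flip Y (j, e)) mt_flipr -mt_flipl.
    have := E (i, false) (j, e) n; rewrite /flip /= => ->.
    by rewrite (cE _ _ _ _ mn').
  by move: F0; rewrite /cf; case: ifP => [/andP[]|]; rewrite ?eqxx.
exists f => //; apply: cf_ext => -[i b] [j e] n; rewrite cf_Gmor //.
case: ifP => [mn|nm]; last by rewrite /cf nm.
case: b mn => mn; last by rewrite /f /= (cE _ _ _ _ mn).
have mn' : mt X Y (i, false) (j, ~~ e) n.
  by rewrite -[(j, ~~ e)]/(flip Y (j, e)) mt_flipr -mt_flipl.
have := E (i, false) (j, e) n; rewrite /flip /= => ->.
by rewrite /f /= (cE _ _ _ _ mn').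
Qed.

Lemma idm_BF_hom X : hom BF X X (idm BF X).
Proof.
move=> n i j nle; rewrite /=; case: eqP => // n0; case: eqP => // ij.
by case: nle; rewrite n0 ij /=; split.
Qed.

Lemma Gmor_id X : Gmor (idm BF X) = idm PS (GE X).
Proof.
apply: PS1_ext => p q; apply/funext => m; rewrite Gmor_coef; last exact: idm_BF_hom.
have [mn en] := nnE r_gt0 r_le_s (X p.1) p.2 (X q.1) q.2 m.
rewrite -/(nu X X p q m) in mn en *.
have [E|pq] := eqVneq p q.
  (* F_s^2 is a translation which G turns into a full rotation, so t^m sits in degree 2 m. *)
  subst q; have -> : nu X X p p m = Posz (2 * m).
    apply: (@eps_inj R r s (X p.1) p.2 (X p.1) p.2); rewrite en.
    rewrite /degree arcxx /eps subrr !add0r -[(Posz _)%:~R]/((2 * m)%:R) natrM.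
    by ring.
  by rewrite /= eqxx /tpow; case: m {mn en} => [|m] /=; rewrite ?eqxx.
have -> : idm PS (GE X) p q m = 0 by rewrite /= (negPf pq).
rewrite /=; case: eqP => [n0|//]; rewrite -[LHS]/(if p.1 == q.1 then _ else _).
case: eqP => [ij|//]; case/eqP: pq; case: p q mn {en} n0 ij => i b [j c] /= mn n0 ij.
subst j; congr (_, _); apply/eqP; move: mn; rewrite n0 /matched oddz0 /sort_of {n0}.
by case: (msgn _); case: b; case: c.
Qed.

(** The exponents [eps] add under composition just as the degrees n do, so the Cauchy product of two
    series becomes a convolution over the integers. Terms outside the Cauchy product have an
    unmatched or negative exponent. *)
Lemma P_comp_cf X Y Z (G : arr PS (GE Y) (GE Z)) (F : arr PS (GE X) (GE Y)) p q l m :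
  P_comp (GE X p) (GE Y q) (GE Z l) (G q l) (F p q) m =
  \sum_(j \in [set: int]) cf F p q j * cf G q l (nu X Z p l m - j).
Proof.
set n := nu X Z p l m; set w := wind (GE X p) (GE Y q) (GE Z l).
have Ew : arc (GE X p) (GE Y q) + arc (GE Y q) (GE Z l) = arc (GE X p) (GE Z l) + 2 * pi * w%:R by apply: arcD.
have en : ep X Z p l n = degree (GE X p) (GE Z l) m by case: (nnE r_gt0 r_le_s (X p.1) p.2 (Z l.1) l.2 m).
have enu b : ep X Y p q (nu X Y p q b) = degree (GE X p) (GE Y q) b.
  by case: (nnE r_gt0 r_le_s (X p.1) p.2 (Y q.1) q.2 b).
have epD j : ep X Y p q j + ep Y Z q l (n - j) = ep X Z p l n.
  by rewrite /ep /eps intrB; ring.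
have [mw|wm] := ltnP m w.
  rewrite (@fsum_seq _ _ [::]) // => [|j _].
    by rewrite big_nil /P_comp /epow -/(wind _ _ _) -/w psmul_tpowE mw.
  rewrite /cf; case: ifP => [/andP[mn e0]|]; last by rewrite mul0r.
  case: ifP => [/andP[mn' e0']|]; last by rewrite mulr0.
  exfalso; have := epD j; rewrite en -(epd mn e0) -(epd mn' e0').
  rewrite /degree -[Gpt _ _]/(GE X p) -[Gpt (Y q.1) _]/(GE Y q) -[Gpt _ _]/(GE Z l).
  move: (Num.truncn _) (Num.truncn _) => a b; move: Ew.
  have : (m%:R : R) + 1 <= w%:R by rewrite natr1 ler_nat.
  have := pi2_gt0 R; move: (2 * pi) => u u0 h1 h2 h3.
  have h4 : u * (m%:R + 1) <= u * w%:R by rewrite ler_pM2l.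
  have h5 : 0 <= u * a%:R by rewrite mulr_ge0 // ltW.
  have h6 : 0 <= u * b%:R by rewrite mulr_ge0 // ltW.
  lra.
rewrite /P_comp /epow -/(wind _ _ _) -/w psmul_tpowE ltnNge wm /=.
rewrite (@fsum_seq _ _ [seq nu X Y p q (m - w - i)%N | i <- iota 0 (m - w).+1]); first last.
- move=> j; rewrite /cf; case: ifP => [/andP[mn e0]|]; last by rewrite mul0r.
  case: ifP => [/andP[mn' e0']|]; last by rewrite mulr0.
  move=> /negP H; exfalso; apply: H.
  have := epD j; rewrite en -(epd mn e0) -(epd mn' e0').
  set b := Num.truncn (ep X Y p q j / _); set a := Num.truncn _ => E.
  have Eabw : (b + a + w = m)%N.
    apply/eqP; rewrite -(eqr_nat R); apply/eqP/(mulfI (@pi2_neq0 R)).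
    move: E Ew; rewrite /degree -[Gpt _ _]/(GE X p) -[Gpt (Y q.1) _]/(GE Y q) -[Gpt _ _]/(GE Z l).
    by move: (2 * pi) => u; rewrite !natrD !mulrDr; lra.
  apply/mapP; exists a; first by rewrite mem_iota /= add0n; lia.
  have -> : (m - w - a)%N = b by lia.
  by rewrite /b /nu (nn_eps r_gt0 r_le_s).
- rewrite map_inj_in_uniq ?iota_uniq // => i i'; rewrite !mem_iota /= !add0n => ilt ilt' E.
  have := congr1 (ep X Y p q) E; rewrite !enu => /degree_inj; lia.
rewrite big_map -[iota 0 _]/(index_iota 0 (m - w).+1) big_mkord /psmul.
apply: eq_bigr => i _; rewrite mulrC (F_cf F) (F_cf G); congr (_ * cf G q l _).
have ile : (i <= m - w)%N by rewrite -ltnS.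
apply: (@eps_inj R r s (Y q.1) q.2 (Z l.1) l.2).
have := epD (nu X Y p q (m - w - i)%N); rewrite en enu.
have [_ ->] := nnE r_gt0 r_le_s (Y q.1) q.2 (Z l.1) l.2 i.
rewrite /degree -[Gpt _ _]/(GE Y q) -[Gpt _ _]/(GE Z l).
have mE : m%:R = (m - w - i)%:R + i%:R + w%:R :> R by rewrite -!natrD subnK // subnK.
rewrite -/(ep Y Z q l _); move: Ew; rewrite {}mE; move: (2 * pi) (_%:R) (i%:R) (w%:R) => u x y z.
by rewrite !mulrDr; lra.
Qed.

(** For negative j the functor F_s^j moves objects down by |j| s, eventually out of reach of [X]. *)
Lemma hom_bounded X Y (f : arr BF X Y) : hom BF X Y f ->
  exists N : nat, forall j : int, j < - N%:Z -> f j = 0.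
Proof.
move=> hf; pose bd : R := \sum_i `|mx (X i)| + \sum_i (`|mx (Y i)| + `|my (Y i)|).
have b0 : 0 <= bd by rewrite addr_ge0 // sumr_ge0 // => i _; rewrite addr_ge0.
exists (Num.truncn (bd / s)).+1 => j jN; apply/funext => i; apply/funext => i'.
apply: (hf j i i') => -[+ _]; rewrite -[mx _]/(crd _ false) -[mx (FB_ob _ _ _ _)]/(crd _ false).
rewrite crd_pow; apply/negP; rewrite -ltNge.
have hX : `|mx (X i)| <= \sum_i `|mx (X i)|.
  by rewrite (bigD1 i) //= lerDl sumr_ge0.
have hY : `|mx (Y i')| + `|my (Y i')| <= \sum_i (`|mx (Y i)| + `|my (Y i)|).
  by rewrite (bigD1 i') //= lerDl sumr_ge0 // => ? _; rewrite addr_ge0.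
have jR : (j%:~R : R) < - (Num.truncn (bd / s)).+1%:R.
  by rewrite -[_%:R]/((Posz _)%:~R) -intrN ltr_int.
have bs : bd < (Num.truncn (bd / s)).+1%:R * s.
  rewrite -ltr_pdivrMr //; have d0 : 0 <= bd / s by rewrite divr_ge0 // ltW.
  by have /andP[] := truncn_itv d0.
have js : j%:~R * s < - bd.
  apply: lt_trans (_ : - (Num.truncn (bd / s)).+1%:R * s < _).
    by rewrite ltr_pM2r.
  by rewrite mulNr ltrN2.
have cY : crd (Y i') (false (+) oddz j) <= `|mx (Y i')| + `|my (Y i')|.
  rewrite /crd; case: (_ (+) _); have := ler_norm (mx (Y i')); have := ler_norm (my (Y i'));
  have := normr_ge0 (mx (Y i')); have := normr_ge0 (my (Y i')); lra.
have cX : - `|mx (X i)| <= crd (X i) false by rewrite lerNl -normrN ler_norm.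
move: hX hY cX cY js; rewrite /bd; lra.
Qed.

Lemma comp_support X Y Z (g : arr BF Y Z) (f : arr BF X Y) (n : int) :
  hom BF Y Z g -> hom BF X Y f -> exists2 L : seq int, uniq L &
  forall j : int, j \notin L -> f j = 0 \/ g (n - j) = 0.
Proof.
move=> /hom_bounded[N2 h2] /hom_bounded[N1 h1].
(* Nonzero terms require -N1 <= j <= n + N2; the list runs from -N1 to N2 + |n|. *)
exists [seq (a%:Z - N1%:Z) | a <- iota 0 (N1 + N2 + `|n|).+1].
  by rewrite map_inj_in_uniq ?iota_uniq // => a b _ _; lia.
move=> j jL; have [jlt|jge] := ltP j (- N1%:Z); first by left; apply: h1.
right; apply: h2; rewrite ltNge; apply/negP => le.
case/negP: jL; apply/mapP; exists (absz (j + N1%:Z)%R); last lia.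
by rewrite mem_iota; lia.
Qed.

Lemma comp_BF_coef X Y Z (g : arr BF Y Z) (f : arr BF X Y) n L : uniq L ->
  (forall j, j \notin L -> f j = 0 \/ g (n - j) = 0) ->
  forall i l, comp BF g f n i l = \sum_(j <- L) \sum_(a : idx Y) g (n - j) a l * f j i a.
Proof.
move=> uL fg i l; rewrite /= /orb_comp (@fsum_seq _ _ L) //.
  by rewrite !fct_sumE.
move=> j /fg fg0; apply/funext => i'; apply/funext => l'.
rewrite -[LHS]/(\sum_(a : idx Y) g (n - j) a l' * f j i' a) big1 // => a _.
by case: fg0 => ->; rewrite ?mulr0 ?mul0r.
Qed.

Lemma comp_BF_hom X Y Z (g : arr BF Y Z) (f : arr BF X Y) :
  hom BF Y Z g -> hom BF X Y f -> hom BF X Z (comp BF g f).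
Proof.
move=> hg hf n i l nle; have [L uL HL] := comp_support n hg hf.
rewrite (comp_BF_coef uL HL) big1 // => j _; rewrite big1 // => a _.
have [le1|n1] := pselect (mle (X i) (Fs_pow s j (Y a))); last first.
  by rewrite (hf j i a n1) mulr0.
have [le2|n2] := pselect (mle (Y a) (Fs_pow s (n - j) (Z l))); last first.
  by rewrite (hg (n - j) a l n2) mul0r.
case: nle; move/mleP: le1 => le1; move/mleP: le2 => le2; apply/mleP => tau.
apply: (le_trans (le1 tau)); rewrite -[X in _ <= X]/(crd (Fs_pow s n (Z l)) tau) !crd_pow.
have := le2 (tau (+) oddz j); rewrite crd_pow -addbA.
have -> : oddz j (+) oddz (n - j) = oddz n by rewrite -oddzD addrC subrK.
rewrite intrB mulrBl; lra.
Qed.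

Lemma Gmor_comp X Y Z (g : arr BF Y Z) (f : arr BF X Y) :
  hom BF Y Z g -> hom BF X Y f -> Gmor (comp BF g f) = Gmor g ** Gmor f.
Proof.
move=> hg hf; apply: PS1_ext => p l; apply/funext => m.
rewrite Gmor_coef; last exact: comp_BF_hom.
set n := nu X Z p l m; have [L uL HL] := comp_support n hg hf.
have mn : mt X Z p l n by case: (nnE r_gt0 r_le_s (X p.1) p.2 (Z l.1) l.2 m).
rewrite (comp_BF_coef uL HL) PS1_compE fct_sumE.
transitivity (\sum_(q : idx Y * bool) \sum_(j <- L) cf (Gmor f) p q j * cf (Gmor g) q l (n - j)).
  rewrite [RHS]exchange_big; apply: eq_bigr => j _.
  rewrite -(pair_bigA _ (fun a b => cf (Gmor f) p (a, b) j * cf (Gmor g) (a, b) l (n - j))) /=.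
  apply: eq_bigr => a _.
  (* Of the two summands over [a] exactly one is matched with [p] in degree j. It is then matched
     with [l] in degree n - j, so each [a] contributes one product. *)
  pose c := oddz j (+) sort_of (X p.1) p.2 (+) ~~ msgn (Y a).
  have mc : mt X Y p (a, c) j.
    rewrite /mt /matched /c /sort_of /=.
    by case: (msgn (X _)); case: (msgn (Y a)); case: (oddz j); case: (p.2).
  have mc' : mt Y Z (a, c) l (n - j).
    move: mc mn; rewrite /mt /matched /= oddzD oddzN => /eqP <- /eqP <-.
    by do 3!case: (sort_of _ _).
  have nc : mt X Y p (a, ~~ c) j = false.
    move: mc; rewrite /mt /matched /= sort_flip.
    by do 2!case: (sort_of _ _); case: (oddz j).
  have F1 : cf (Gmor f) p (a, c) j = f j p.1 a by rewrite cf_Gmor // mc.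
  have F2 : cf (Gmor f) p (a, ~~ c) j = 0 by rewrite cf_Gmor // nc.
  have F3 : cf (Gmor g) (a, c) l (n - j) = g (n - j) a l.1 by rewrite cf_Gmor // mc'.
  by rewrite big_bool; case: (c) F1 F2 F3 => /= F1 F2 F3;
    rewrite F1 F2 F3 mul0r ?addr0 ?add0r mulrC.
apply: eq_bigr => q _; rewrite P_comp_cf -/n (@fsum_seq _ _ L) // => j /HL h.
rewrite !cf_Gmor //; case: h => ->; case: ifP; case: ifP; rewrite ?mul0r ?mulr0 //.
Qed.

End GhatFunctor.

(** * Category axioms for the completed orbit category *)

Section GhatEquivalence.
Context {R : realType} {k : fieldType} {r s : R}.
Hypotheses (r_gt0 : 0 < r) (r_le_s : r <= s).
Local Notation pi := (@pi R).
Local Notation PS := (PS1 R k).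
Local Notation BF := (BFhat k r s).
Local Notation c := (r * pi / s).
Local Notation FCc := (Fc k c).
Local Notation "g ** f" := (comp PS g f) (at level 40, left associativity).
Local Notation Gm := (Gmor r_gt0 r_le_s).

Let s_gt0 : 0 < s. Proof. exact: lt_le_trans r_le_s. Qed.

Lemma angle_ge0 : 0 <= c.
Proof. by rewrite !mulr_ge0 ?pi_ge0 ?invr_ge0 // ltW. Qed.

Lemma angle_le_pi : c <= pi.
Proof. by rewrite ler_pdivrMr // mulrC ler_wpM2l ?pi_ge0. Qed.

Lemma BF_strict : strict BF. Proof. by []. Qed.

Lemma BF_heq (X Y : BF) (f g : arr BF X Y) : heq f g <-> f = g.
Proof. by rewrite /heq /=; split=> [/eqP|->]; rewrite ?subr_eq0 ?subrr // => /eqP. Qed.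

Lemma BF_hom_subspace (X Y : BF) : is_subspace (hom BF X Y).
Proof.
split=> // a u v hu hv n i j nle.
by rewrite -[LHS]/(a * u n i j + v n i j) (hu n i j nle) (hv n i j nle) mulr0 addr0.
Qed.

(** [Gmor] is injective on morphisms and multiplicative, so linearity, associativity and units
    follow from P_{S^1} without rearranging infinite convolutions. *)
Lemma BF_is_kcat : is_kcat BF.
Proof.
have cH := @comp_BF_hom R k r s r_gt0 r_le_s; have iH := @idm_BF_hom R k r s.
have GM := @Gmor_comp R k r s r_gt0 r_le_s; have GI := @Gmor_inj R k r s r_gt0 r_le_s.
have G1 := @Gmor_id R k r s r_gt0 r_le_s; have GL := @Gmor_linear R k r s r_gt0 r_le_s.
have hL X Y a (u v : arr BF X Y) : hom BF X Y u -> hom BF X Y v -> hom BF X Y (a *: u + v).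
  exact: (BF_hom_subspace X Y).2.
have h0 X Y : hom BF X Y 0 by exact: (BF_hom_subspace X Y).1.
have linr (X Y Z : BF) a g (f f' : arr BF X Y) : hom BF Y Z g -> hom BF X Y f -> hom BF X Y f' ->
    comp BF g (a *: f + f') = a *: comp BF g f + comp BF g f'.
  move=> hg hf hf'; have h1 := hL _ _ a _ _ hf hf'.
  have h2 := hL _ _ a _ _ (cH _ _ _ _ _ hg hf) (cH _ _ _ _ _ hg hf').
  apply: GI => //; first exact: cH.
  by rewrite GM // GL // GL ?GM //; [rewrite PS1_compZDr|apply: cH|apply: cH].
have linl (X Y Z : BF) a (g g' : arr BF Y Z) (f : arr BF X Y) : hom BF Y Z g -> hom BF Y Z g' -> hom BF X Y f ->
    comp BF (a *: g + g') f = a *: comp BF g f + comp BF g' f.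
  move=> hg hg' hf; have h1 := hL _ _ a _ _ hg hg'.
  have h2 := hL _ _ a _ _ (cH _ _ _ _ _ hg hf) (cH _ _ _ _ _ hg' hf).
  apply: GI => //; first exact: cH.
  by rewrite GM // GL // GL ?GM //; [rewrite PS1_compZDl|apply: cH|apply: cH].
split.
- exact: BF_hom_subspace.
- by move=> X Y; split=> //= a u v -> ->; rewrite scaler0 addr0.
- by move=> X Y f /= ->; exact: h0.
- exact: iH.
- by move=> X Y Z g f; apply: cH.
- by move=> X Y Z a g f f' hg hf hf'; apply/BF_heq/linr.
- by move=> X Y Z a g g' f hg hg' hf; apply/BF_heq/linl.
- move=> X Y Z g f hg /BF_strict ->.
  have := linr X Y Z (-1) g 0 0 hg (h0 _ _) (h0 _ _).
  by rewrite scaler0 addr0 scaleN1r addNr => E; exact: E.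
- move=> X Y Z g f /BF_strict -> hf.
  have := linl X Y Z (-1) 0 0 f (h0 _ _) (h0 _ _) hf.
  by rewrite scaler0 addr0 scaleN1r addNr => E; exact: E.
- move=> W X Y Z h g f hh hg hf; apply/BF_heq; apply: GI.
  + by apply: (cH) => //; apply: (cH).
  + by apply: (cH) => //; apply: (cH).
  + by rewrite !GM ?PS1_compA //; apply: (cH).
- move=> X Y f hf; apply/BF_heq; apply: GI => //; first by apply: (cH).
  by rewrite GM // G1 PS1_id_l.
- move=> X Y f hf; apply/BF_heq; apply: GI => //; first by apply: (cH).
  by rewrite GM // G1 PS1_id_r.
Qed.

Lemma Gmor0 (X Y : BF) : Gm (0 : arr BF X Y) = 0.
Proof.
have h0 : hom BF X Y 0 by exact: (BF_hom_subspace X Y).1.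
by apply: PS1_ext => p q; apply/funext => m; rewrite Gmor_coef.
Qed.

Let sd : @shift_data k PS (@t_endo R k) (@PS1_D R k (pi - c)) :=
  Fc_shift_data angle_ge0 angle_le_pi.
Let FK := @Fc_is_kcat R k c angle_ge0 angle_le_pi.
Let FS := @Fc_strict R k c angle_ge0 angle_le_pi.

Local Notation Go X := (@Ghat_ob R k r s r_gt0 r_le_s X).

Let G_homP (X Y : BF) (g : arr PS (GE X) (GE Y)) :
  hom FCc (Go X) (Go Y) g <-> g ** @Gd R k r s X = @Gd R k r s Y ** g.
Proof. exact (@endo_homP k PS _ _ sd (sval (sval (Go X))) (sval (sval (Go Y))) g). Qed.

Let G_hom (X Y : BF) (f : arr BF X Y) : hom BF X Y f ->
  hom FCc (Go X) (Go Y) (@Ghat_mor R k r s r_gt0 r_le_s X Y f).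
Proof. by move=> /(Gmor_commute r_gt0 r_le_s) E; exact: ((G_homP (Gm f)).2 E). Qed.

Let FK_heq (X Y : FCc) (f g : arr FCc X Y) : f = g -> heq f g.
Proof. by move=> ->; exact: (heq_refl FK). Qed.

Let G_full (X Y : BF) (g : arr FCc (Go X) (Go Y)) : hom FCc (Go X) (Go Y) g ->
  exists2 f, hom BF X Y f & heq (@Ghat_mor R k r s r_gt0 r_le_s X Y f) g.
Proof.
move=> hg; have [f hf E] := Gmor_full r_gt0 r_le_s ((G_homP g).1 hg).
exists f; [exact: hf|apply: FK_heq; exact: E].
Qed.

Let G_faithful (X Y : BF) (f : arr BF X Y) : hom BF X Y f ->
  null FCc (Go X) (Go Y) (@Ghat_mor R k r s r_gt0 r_le_s X Y f) -> null BF X Y f.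
Proof.
move=> hf /FS nf.
apply: (@Gmor_inj R k r s r_gt0 r_le_s _ _ _ _ hf (BF_hom_subspace X Y).1).
by rewrite Gmor0; exact: nf.
Qed.

Let G_linear (X Y : BF) a (f g : arr BF X Y) : hom BF X Y f -> hom BF X Y g ->
  @Ghat_mor R k r s r_gt0 r_le_s X Y (a *: f + g) =
  a *: @Ghat_mor R k r s r_gt0 r_le_s X Y f + @Ghat_mor R k r s r_gt0 r_le_s X Y g.
Proof.
move=> hf hg.
exact: (Gmor_linear r_gt0 r_le_s hf hg ((BF_hom_subspace X Y).2 a _ _ hf hg)).
Qed.

Definition Ghat : functor BF FCc.
Proof.
refine (@Functor k BF FCc (@Ghat_ob R k r s r_gt0 r_le_s) (fun X Y f => @Ghat_mor R k r s r_gt0 r_le_s X Y f)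
  G_hom _ _ _ _).
- by move=> X Y f /BF_strict ->; exact: Gmor0.
- by move=> X Y a f g hf hg; apply: FK_heq; exact: G_linear.
- by move=> X; apply: FK_heq; exact: Gmor_id.
- by move=> X Y Z g f hg hf; apply: FK_heq; exact: (Gmor_comp r_gt0 r_le_s hg hf).
Defined.

Lemma Ghat_ff : fully_faithful Ghat.
Proof. exact: (FullyFaithful (F := Ghat) G_full G_faithful). Qed.

End GhatEquivalence.

Lemma full_sub_iso (k : fieldType) (C : kcat k) (P : C -> Prop) (X Y : full_sub P)
  (f : arr C (sval X) (sval Y)) : is_iso f -> @is_iso k (full_sub P) X Y f.
Proof. by []. Qed.

(** * Essential surjectivity and the transported Frobenius structure *)

Section GhatFrobenius.
Context {R : realType} {k : fieldType} {r s : R}.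
Hypotheses (r_gt0 : 0 < r) (r_le_s : r <= s).
Local Notation pi := (@pi R).
Local Notation PS := (PS1 R k).
Local Notation BF := (BFhat k r s).
Local Notation c := (r * pi / s).
Local Notation FCc := (Fc k c).
Local Notation FC := (Fcat R k).
Local Notation "g ** f" := (comp PS g f) (at level 40, left associativity).
Local Notation Go X := (@Ghat_ob R k r s r_gt0 r_le_s X).
Local Notation Gf := (@Ghat R k r s r_gt0 r_le_s).

Let s_gt0 : 0 < s. Proof. exact: lt_le_trans r_le_s. Qed.
Let c0 := angle_ge0 r_gt0 r_le_s.
Let c1 := angle_le_pi r_gt0 r_le_s.
Let FK := @Fc_is_kcat R k c c0 c1.
Let FS := @Fc_strict R k c c0 c1.
Let BK := @BF_is_kcat R k r s r_gt0 r_le_s.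
Let BS := @BF_strict R k r s.

(** Objects of sign + suffice: solving for the coordinates turns the condition defining F_c into |x
    - y| <= r. *)
Lemma is_Fc_mob (I : finType) (x y : I -> R) :
  (forall i, x i + (pi - c) <= y i <= x i + 2 * pi - (pi - c)) ->
  exists X : I -> mob r, (fun i => Gx s (X i)) = x /\ (fun i => Gy s (X i)) = y.
Proof.
move=> H; have p0 : pi != 0 by rewrite gt_eqF ?pi_gt0.
have s0 : s != 0 by rewrite gt_eqF.
have bd i : `|s / pi * x i - s / pi * (y i - pi)| <= r.
  have sp : 0 < s / pi by rewrite divr_gt0 ?pi_gt0.
  rewrite -mulrBr normrM gtr0_norm // mulrC -ler_pdivlMr // ler_norml.
  have -> : r / (s / pi) = c by rewrite invf_div mulrA.
  by have /andP[h1 h2] := H i; apply/andP; split; lra.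
exists (fun i => Mob true (bd i)); split; apply/funext => i; rewrite /Gx /Gy /=.
  by move: (pi) p0 => q q0; field; rewrite s0 q0.
by move: (pi) p0 => q q0; field; rewrite s0 q0.
Qed.

Let es_Fc (Y : FCc) : exists (X : BF) (f : arr FCc (Go X) Y), is_iso f.
Proof.
have [I [x [y [H [Hc ds]]]]] := svalP Y.
have [X [xE yE]] := is_Fc_mob Hc; subst x y.
pose XX : BF := @Fam (mob r) I X; exists XX.
have ds' := @Esum_dsum R k I (fun i => Gx s (X i)) (fun i => Gy s (X i)) (fun i => G_bound2pi r_gt0 r_le_s (XX i)).
have HE : H = fun i => G_bound2pi r_gt0 r_le_s (XX i) by exact: Prop_irrelevance.
subst H; have [f hf] := is_dsum_iso (@Fcat_is_kcat R k) (@Fcat_strict R k) ds' ds.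
by exists f; exact (@full_sub_iso k FC (@is_Fc R k c) (Go XX) Y f hf).
Qed.

Lemma Ghat_es : essentially_surjective Gf.
Proof. exact: es_Fc. Qed.

Local Notation exB := (BFhat_exact k r_gt0 r_le_s).
Local Notation exF := (@Fc_exact R k c).

Let exE (X Y Z : BF) f g : exB X Y Z f g <->
  [/\ hom BF X Y f, hom BF Y Z g & @Fc_exact R k c (Gf X) (Gf Y) (Gf Z) (fmor Gf f) (fmor Gf g)].
Proof. exact: iff_refl. Qed.

Let ff := @Ghat_ff R k r s r_gt0 r_le_s.
Let exF_hom := @Fc_exact_hom R k c.
Let icF : iso_closed exF := Fc_iso_closed c0 c1.

Lemma BFhat_additive : additive BF.
Proof. exact: (additive_transport BK FK BS FS ff Ghat_es (Fc_additive c0 c1)). Qed.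

Lemma BFhat_frobenius : frobenius exB.
Proof.
apply: (half_frobenius_frobenius BK BS BFhat_additive).
- exact: (lift_iso_closed BK FK BS FS exE icF).
- exact: (lift_half_frobenius BK FK BS FS ff Ghat_es exE exF_hom icF (Fc_half_frobenius c0 c1)).
- exact: (lift_half_frobenius_op BK FK BS FS ff Ghat_es exE exF_hom icF (Fc_half_frobenius_op c0 c1)).
Qed.

Lemma BFhat_exact_hom (X Y Z : BF) f g : exB X Y Z f g -> hom BF X Y f /\ hom BF Y Z g.
Proof. by case/exE. Qed.

Lemma BFhat_stable_equivalent : equivalent (stable exB) (stable exF).
Proof.
exact: (stable_equivalent BK FK BS FS ff Ghat_es exE exF_hom icF (Fc_additive c0 c1)).
Qed.

(** The points enter through equations because those at hand are shifts by theta only modulo 2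
    pi. *)
Lemma PS1_shift_pair_pt (theta : R) (I : finType) (x : I -> R) (a b : I -> S1 R) :
  0 <= theta -> theta <= pi -> a = (fun i => pt (x i)) -> b = (fun i => pt (x i + theta)) ->
  @shift_pair k PS (@t_endo R k) (@PS1_D R k theta) (@Fam (S1 R) I a) (@Fam (S1 R) I b)
    (dg a b (fun=> epow k theta)) (dg b a (fun=> epow k (2 * pi - theta))).
Proof. by move=> h1 h2 -> ->; apply: PS1_shift_pair. Qed.

Let th0 : 0 <= pi - c. Proof. by rewrite subr_ge0. Qed.
Let thpi : pi - c <= pi. Proof. by rewrite gerBl. Qed.

Definition Gslot (X : BF) (i : idx X) (b : bool) : R := slot (fun i => Gx s (X i)) (fun i => Gy s (X i)) i b.

Lemma Gslot_dist (X : BF) (i : idx X) b :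
  Gdist (s := s) (X i) b = Gslot i (~~ b) + (if b then 2 * pi else 0) - Gslot i b.
Proof.
rewrite /Gdist /pos0 sort_flip /sort_of /Gslot /slot /Gx /Gy.
by case: b => /=; case: (msgn (X i)) => /=; ring.
Qed.

(** [sl i] marks the summand from which d has exponent theta = pi - c; the marked summands together
    form [V]. *)
Lemma boundary_data (Z : BF) (sl : idx Z -> bool) :
  (forall i, Gdist (s := s) (Z i) (sl i) = pi - c) ->
  exists V' e e' i1 i2 p1 p2,
    [/\ @shift_pair k PS (@t_endo R k) (@PS1_D R k (pi - c))
          (@Fam (S1 R) (idx Z) (fun i => pt (Gslot i (sl i)))) V' e e',
        @biproduct k PS (@Fam (S1 R) (idx Z) (fun i => pt (Gslot i (sl i)))) V'
          (tag (sval (sval (Go Z)))) i1 i2 p1 p2,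
        tagged (sval (sval (Go Z))) ** i1 = i2 ** e
      & tagged (sval (sval (Go Z))) ** i2 = i1 ** e'].
Proof.
move=> D.
pose x := fun i => Gx s (Z i); pose y := fun i => Gy s (Z i).
pose a := fun i => pt (Gslot i (sl i)); pose b := fun i => pt (Gslot i (~~ sl i)).
have bE : b = fun i => pt (Gslot i (sl i) + (pi - c)).
  apply/funext => i; rewrite -(D i) Gslot_dist /b; case: (sl i) => /=.
    by rewrite -[LHS]pt_2pi; congr pt; ring.
  by congr pt; ring.
have pr := PS1_shift_pair_pt th0 thpi (erefl a) bE.
have bp := @slot_biproduct R k (idx Z) x y sl.
have d1 := @Ed_slot R k (idx Z) x y sl false.
have d2 := @Ed_slot R k (idx Z) x y sl true.
exists (@Fam (S1 R) (idx Z) b), (dg a b (fun=> epow k (pi - c))),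
  (dg b a (fun=> epow k (2 * pi - (pi - c)))),
  (slot_in x y sl false), (slot_in x y sl true), (slot_out x y sl false), (slot_out x y sl true).
split; [exact: pr|exact: bp| |].
- apply: (etrans d1); congr (comp PS _ _); rewrite /dg.
  apply: PS1_ext => i j /=; case: eqP => // _; congr epow.
  by rewrite -(D i) Gslot_dist.
- apply: (etrans d2); congr (comp PS _ _); rewrite /dg.
  apply: PS1_ext => i j /=; case: eqP => // _; congr epow.
  rewrite -(D i) Gslot_dist /Gslot /x /y; case: (sl i) => /=; ring.
Qed.

End GhatFrobenius.

(** * The stable category of the completed orbit category *)

Section BoundaryObjects.
Context {R : realType} {k : fieldType} {r s : R}.
Hypotheses (r_gt0 : 0 < r) (r_le_s : r <= s).
Local Notation pi := (@pi R).
Local Notation PS := (PS1 R k).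
Local Notation BF := (BFhat k r s).
Local Notation c := (r * pi / s).
Local Notation "g ** f" := (comp PS g f) (at level 40, left associativity).
Local Notation Go X := (@Ghat_ob R k r s r_gt0 r_le_s X).
Local Notation exB := (BFhat_exact k r_gt0 r_le_s).

Let s_gt0 : 0 < s. Proof. exact: lt_le_trans r_le_s. Qed.
Let c0 := angle_ge0 r_gt0 r_le_s.
Let c1 := angle_le_pi r_gt0 r_le_s.
Let FK := @Fc_is_kcat R k c c0 c1.
Let FS := @Fc_strict R k c c0 c1.
Let BK := @BF_is_kcat R k r s r_gt0 r_le_s.
Let BS := @BF_strict R k r s.
Let ff := @Ghat_ff R k r s r_gt0 r_le_s.
Let es := @Ghat_es R k r s r_gt0 r_le_s.
Let exF_hom := @Fc_exact_hom R k c.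
Let icF : iso_closed (@Fc_exact R k c) := Fc_iso_closed c0 c1.

Definition boundary (Z : BF) : Prop := forall i : idx Z, `|mx (Z i) - my (Z i)| = r.

Lemma Gdist_boundary (M : mob r) : `|mx M - my M| = r -> exists b, Gdist (s := s) M b = pi - c.
Proof.
have G b tau : sort_of M b = tau -> crd M tau - crd M (~~ tau) = r ->
    Gdist (s := s) M b = pi - c.
  move=> sb E; have -> : c = pi / s * (crd M tau - crd M (~~ tau)).
    by rewrite E [RHS]mulrAC [r * pi]mulrC.
  by rewrite /Gdist /pos0 sort_flip sb; ring.
move=> /eqP; rewrite eqr_norml => /andP[/orP[/eqP E|/eqP E] _].
  by exists (~~ msgn M); apply: (G _ false); rewrite // /sort_of addbb.
exists (msgn M); apply: (G _ true); first by rewrite /sort_of addbN addbb.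
by rewrite -opprB -[RHS]opprK -E.
Qed.

Lemma boundary_shift_type (Z : BF) : boundary Z ->
  @shift_type k PS (@t_endo R k) (@PS1_D R k (pi - c)) (sval (sval (Go Z))).
Proof.
move=> bZ; have D i := cid (Gdist_boundary (bZ i)).
have [V' [e [e' [i1 [i2 [p1 [p2 H]]]]]]] :=
  @boundary_data R k r s r_gt0 r_le_s Z (fun i => sval (D i)) (fun i => svalP (D i)).
by do 8!eexists; exact: H.
Qed.

Lemma boundary_projective (Z : BF) : boundary Z -> projective exB Z.
Proof.
move=> bZ; apply/(projectiveE BK FK BS FS ff es (fun X Y Z f g => iff_refl _) exF_hom icF).
exact: (Fc_shift_type_projective c0 c1 (boundary_shift_type bZ)).
Qed.

Lemma boundary_injective (Z : BF) : boundary Z -> injective_ob exB Z.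
Proof.
move=> bZ; apply/(injectiveE BK FK BS FS ff es (fun X Y Z f g => iff_refl _) exF_hom icF).
exact: (Fc_shift_type_injective c0 c1 (boundary_shift_type bZ)).
Qed.

Lemma dg_idm (I : finType) (a b : I -> S1 R) : a = b ->
  dg b a (fun=> tpow k 0) ** dg a b (fun=> tpow k 0) = idm PS (@Fam (S1 R) I a).
Proof.
move=> <-; apply: PS1_ext => i j; rewrite comp_dg_r /dg /=.
by case: eqP => [->|_]; rewrite ?P_comp1 ?P_comp0l.
Qed.

Lemma corner_bound (u : R) : `|u - (u - r)| <= r.
Proof. by rewrite opprB addrCA subrr addr0 gtr0_norm. Qed.

(** For each summand P_[z] underlying G P take M(u, u - r)_+ with u = s z / pi, whose summand
    [false] is again P_[z]. The marked half of the sum [Z] is then the object underlying G P, as the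
    construction of the epimorphism requires. *)
Lemma boundary_cover (P : BF) : exists (Z : BF) (g : arr BF Z P), boundary Z /\ adm_epi exB g.
Proof.
pose u (p : idx P * bool) := s / pi * (if p.2 then Gy s (P p.1) else Gx s (P p.1)).
pose Z : BF := @Fam (mob r) (idx P * bool)%type (fun p => Mob true (corner_bound (u p))).
have ps : pi / s * (s / pi) = 1.
  by have := pi_gt0 R; move: (pi) => q q0; field; rewrite !gt_eqF.
have zx p : pi / s * u p = if p.2 then Gy s (P p.1) else Gx s (P p.1).
  by rewrite /u mulrA ps mul1r.
have dZ p : Gdist (s := s) (Z p) false = pi - c by rewrite /Gdist /pos0 /=; ring.
have [V' [e [e' [i1 [i2 [p1 [p2 [pr bp d1 d2]]]]]]]] :=
  @boundary_data R k r s r_gt0 r_le_s Z (fun=> false) dZ.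
have ab : (fun p => pt (Gslot (X := Z) p false)) =
    (fun p : idx P * bool => pt (if p.2 then Gy s (P p.1) else Gx s (P p.1))).
  by apply/funext => p; congr pt; exact: zx.
have [G aG] := Fc_shift_type_adm_epi (T := Go Z) (X := Go P) c0 c1 pr bp d1 d2
  (dg_idm ab) (dg_idm (esym ab)).
have [K [F EG]] := aG; have [_ hG] := exF_hom EG.
have [g hg /(heqP FK FS) gG] := (ff_full ff) _ _ _ hG.
exists Z, g; split; first by move=> p; rewrite /= opprB addrCA subrr addr0 gtr0_norm.
apply/(adm_epiE BK FK BS FS ff es (fun X Y Z f g => iff_refl _) exF_hom icF).
by split=> //; rewrite gG.
Qed.

End BoundaryObjects.

(** * Stably trivial families and the orbit category *)

Section OrbitStable.
Context {R : realType} {k : fieldType} {r s : R}.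
Hypotheses (r_gt0 : 0 < r) (r_le_s : r <= s).
Local Notation B := (B2 k r).
Local Notation BF := (BFhat k r s).
Local Notation exB := (BFhat_exact k r_gt0 r_le_s).
Local Notation D2null X Y n u := (null (D2 k r) X (FB_ob s n Y) u).

Let s_gt0 : 0 < s. Proof. exact: lt_le_trans r_le_s. Qed.
Let BK := @BF_is_kcat R k r s r_gt0 r_le_s.
Let BS := @BF_strict R k r s.
Let exB_hom := @BFhat_exact_hom R k r s r_gt0 r_le_s.
Let aB := @BFhat_additive R k r s r_gt0 r_le_s.
Let SK : is_kcat (stable exB) := stable_is_kcat BK BS exB_hom aB.

Lemma mle_trans (L M N : mob r) : mle L M -> mle M N -> mle L N.
Proof. by move=> [h1 h2] [h3 h4]; split; [apply: le_trans h3|apply: le_trans h4]. Qed.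

Lemma mle_pow (M N : mob r) (j n : int) :
  mle M (Fs_pow s (n - j) N) -> mle (Fs_pow s j M) (Fs_pow s n N).
Proof.
move=> /mleP le; apply/mleP => tau; have := le (tau (+) oddz j).
rewrite !crd_pow -addbA -oddzD [j + _]addrC subrK intrB mulrBl; lra.
Qed.

Lemma boundary_pow (Z : BF) (j : int) : boundary Z ->
  forall i : idx Z, `|mx (FB_ob s j Z i) - my (FB_ob s j Z i)| = r.
Proof.
move=> bZ i; rewrite -[mx _]/(crd (Fs_pow s j (Z i)) false).
rewrite -[my _]/(crd (Fs_pow s j (Z i)) true) !crd_pow opprD addrACA subrr addr0.
by case: (oddz j); [rewrite distrC|]; apply: bZ.
Qed.

Lemma D2_null_subspace (X Y : B) : is_subspace (null (D2 k r) X Y).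
Proof.
split=> [|a u v [Z [g [h [bZ hg hh ->]]]] [Z' [g' [h' [bZ' hg' hh' ->]]]]].
  exists (@Fam (mob r) void (fun i : void => match i with end)), (fun _ _ => 0), (fun _ _ => 0).
  split=> //.
  apply/funext => i; apply/funext => j.
  by rewrite -[RHS]/(\sum_(l : void) 0 * 0) big1 // => -[].
pose ZZ : B := @Fam (mob r) (idx Z + idx Z')%type
  (fun i => match i with inl i => Z i | inr i => Z' i end).
exists ZZ, (fun i l => match l with inl l => a * g i l | inr l => g' i l end),
  (fun l j => match l with inl l => h l j | inr l => h' l j end).
split.
- by case.
- move=> i [l|l] nle; last exact: hg'.
  by rewrite (hg i l nle) mulr0.
- by case.
apply/funext => i; apply/funext => j.
rewrite [RHS]big_sumType /= -[LHS]/(a * _ + _) mulr_sumr; congr (_ + _).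
by apply: eq_bigr => l _; rewrite mulrCA.
Qed.

(* A projective object is a retract of a boundary object. *)
Lemma stable_null_D2 (X Y : BF) (f : arr BF X Y) n : null (stable exB) X Y f ->
  D2null X Y n (f n).
Proof.
move=> [hf [P [g [h [pP _ hg hh /BF_heq Ef]]]]].
have [Z [q [bZ aq]]] := boundary_cover r_gt0 r_le_s P.
have [l hl /BF_heq ql] := pP _ _ _ _ aq (idm_hom BK P).
have [K [i /exB_hom[_ hq]]] := aq.
have E : f = comp BF (comp BF h q) (comp BF l g).
  rewrite Ef (compA BK BS) //; last exact: (comp_hom BK).
  by rewrite -(compA BK BS hh hq hl) ql (comp1r BK BS).
have h1 : hom BF Z Y (comp BF h q) by exact: (comp_hom BK).
have h2 : hom BF X Z (comp BF l g) by exact: (comp_hom BK).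
move: h1 h2 E; move: (comp BF h q) (comp BF l g) => h' g' hh' hg' E.
have [L uL HL] := comp_support r_gt0 r_le_s n hh' hg'.
(* The n-th component of the composite is a finite sum of morphisms through the objects F_s^j Z,
   which are again on the boundary. *)
pose F j : arr B X (FB_ob s n Y) :=
  comp B (X := X) (Y := FB_ob s j Z) (Z := FB_ob s n Y) (h' (n - j)) (g' j).
have -> : f n = \sum_(j <- L) F j.
  apply/funext => a; apply/funext => b; rewrite E (comp_BF_coef uL HL).
  by rewrite !fct_sumE.
apply: (subspace_sum (D2_null_subspace X (FB_ob s n Y))) => j _.
exists (FB_ob s j Z), (g' j), (h' (n - j)); split=> //.
- exact (boundary_pow j bZ).
- by move=> a b nle; apply: hh' => le; apply: nle; apply: mle_pow.
Qed.

Definition single (X Y : BF) (n : int) (u : idx X -> idx Y -> k^o) : arr BF X Y :=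
  fun m => if m == n then u else 0.

Lemma boundary_stable_null (X Y Z : BF) (g : arr BF X Z) (h : arr BF Z Y) : boundary Z ->
  hom BF X Z g -> hom BF Z Y h -> null (stable exB) X Y (comp BF h g).
Proof.
move=> bZ hg hh; split; first exact: (comp_hom BK).
exists Z, g, h; split=> //; [exact: boundary_projective|exact: boundary_injective|].
exact: (heq_refl BK).
Qed.

Lemma single_hom (X Y : BF) n u : hom B X (FB_ob s n Y) u -> hom BF X Y (single n u).
Proof. by move=> hu m; rewrite /single; case: eqP => [->|]. Qed.

Lemma comp_single0 (X Y Z : BF) (h : arr BF Z Y) (u : idx X -> idx Z -> k^o) n i l :
  comp BF h (single 0 u) n i l = \sum_(a : idx Z) h n a l * u i a.
Proof.
rewrite (@comp_BF_coef R k r s _ _ _ _ _ n [:: 0]) //.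
  by rewrite big_seq1 subr0 /single eqxx.
by move=> j; rewrite inE => /negPf j0; left; rewrite /single j0.
Qed.

Lemma single_null (X Y : BF) n u : D2null X Y n u -> null (stable exB) X Y (single n u).
Proof.
move=> [Z [g [h [bZ hg hh E]]]].
have -> : single n u = comp BF (single n h) (single 0 g) :> arr BF X Y.
  apply/funext => m; apply/funext => i; apply/funext => l.
  apply: etrans (esym (@comp_single0 X Y Z (single n h) g m i l)).
  rewrite /single; case: eqP => _; first by rewrite E.
  by rewrite big1 // => a _; rewrite mul0r.
apply: (@boundary_stable_null X Y Z) => //; last exact: single_hom.
exact: (@single_hom X Z 0 g hg).
Qed.

(* Morphisms from [X] to objects whose summands lie far enough above factor
   through this boundary object. *)
Definition corner (X : BF) : BF :=
  @Fam (mob r) (idx X) (fun i => Mob true (corner_bound r_gt0 (mx (X i) + 2 * r))).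

Lemma corner_boundary X : boundary (corner X).
Proof. by move=> i; rewrite /= opprB addrCA subrr addr0 gtr0_norm. Qed.

(** The shift by 2 r leaves mx + r as second coordinate, and this is at least my because |mx - my|
    <= r. *)
Lemma mle_corner (X : BF) (i : idx X) : mle (X i) (corner X i).
Proof.
have := mob_bound (X i); rewrite ler_norml => /andP[h1 h2].
by split; rewrite /=; lra.
Qed.

Lemma corner_mle (X Y : BF) : exists N : nat, forall n : int, N%:Z <= n ->
  forall (i : idx X) (j : idx Y), mle (corner X i) (Fs_pow s n (Y j)).
Proof.
(* Bounds the difference between any coordinate of [corner X], which is at most mx + 2 r, and any
   coordinate of [Y]. *)
pose bd : R := \sum_i `|mx (X i)| + 2 * r + \sum_j (`|mx (Y j)| + `|my (Y j)|).
have b0 : 0 <= bd.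
  rewrite !addr_ge0 ?mulr_ge0 ?(ltW r_gt0) //;
    by apply: sumr_ge0 => ? _; rewrite ?addr_ge0.
exists (Num.truncn (bd / s)).+1 => n nN i j.
have bs : bd <= n%:~R * s.
  rewrite -ler_pdivrMr //; apply: le_trans (_ : (Num.truncn (bd / s)).+1%:R <= _).
    by have /andP[_ /ltW] := truncn_itv (divr_ge0 b0 (ltW s_gt0)).
  by rewrite -[_%:R]/((Posz _)%:~R) ler_int.
have hX : `|mx (X i)| <= \sum_i `|mx (X i)|.
  by rewrite (bigD1 i) //= lerDl sumr_ge0.
have hY : `|mx (Y j)| + `|my (Y j)| <= \sum_j (`|mx (Y j)| + `|my (Y j)|).
  by rewrite (bigD1 j) //= lerDl sumr_ge0 // => ? _; rewrite addr_ge0.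
have := ler_norm (mx (X i)).
have := normr_ge0 (mx (Y j)); have := normr_ge0 (my (Y j)).
have := ler_norm (- mx (Y j)); have := ler_norm (- my (Y j)); rewrite !normrN.
have r0 := r_gt0; move: bs hX hY; rewrite /bd => *.
by apply/mleP => tau; rewrite crd_pow /crd; case: (_ (+) _); case: tau => /=; lra.
Qed.

Section Tail.
Variables (X Y : BF) (N : nat).
Hypothesis N_far : forall n : int, N%:Z <= n ->
  forall (i : idx X) (j : idx Y), mle (corner X i) (Fs_pow s n (Y j)).

Let iota_X : idx X -> idx (corner X) -> k^o := fun i a => if i == a then 1 else 0.

Let iota_hom : hom B X (corner X) iota_X.
Proof.
move=> i a nle; rewrite /iota_X; case: eqP => // E; case: nle; rewrite -E.
exact: mle_corner.
Qed.

Let iotaE (u : idx X -> idx Y -> k^o) i l : \sum_(a : idx X) u a l * iota_X i a = u i l.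
Proof.
rewrite (bigD1 i) //= /iota_X eqxx mulr1 big1 ?addr0 // => a.
by rewrite eq_sym => /negPf ->; rewrite mulr0.
Qed.

Lemma tail_D2_null n u : N%:Z <= n -> D2null X Y n u.
Proof.
move=> nN; exists (corner X), iota_X, u; split=> //.
- exact: corner_boundary.
- by move=> i j; case; apply: N_far.
- by apply/funext => i; apply/funext => l; rewrite [RHS]iotaE.
Qed.

(** The family [f] itself, read as starting at [corner X], is the second factor: it is nonzero only
    in degrees where all of [corner X] lies below F_s^n Y. Hence one object serves all these degrees
    at once. *)
Lemma tail_stable_null (f : arr BF X Y) : (forall n, n < N%:Z -> f n = 0) ->
  null (stable exB) X Y f.
Proof.
move=> f0; have -> : f = comp BF (f : arr BF (corner X) Y) (single 0 iota_X).
  apply/funext => n; apply/funext => i; apply/funext => l.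
  apply: etrans (esym (@comp_single0 X Y (corner X) f iota_X n i l)).
  by rewrite iotaE.
apply: (@boundary_stable_null X Y (corner X)).
- exact: corner_boundary.
- exact: (@single_hom X (corner X) 0 iota_X iota_hom).
- move=> n i j nle; have [nN|nN] := ltP n N%:Z; first by rewrite f0.
  by case: nle; apply: N_far.
Qed.

End Tail.

Definition window (N1 N0 : nat) : seq int := [seq a%:Z - N1%:Z | a <- iota 0 (N0 + N1)].

Lemma mem_window N1 N0 n : (n \in window N1 N0) = (- N1%:Z <= n < N0%:Z).
Proof.
apply/mapP/idP => [[a]|h]; first by rewrite mem_iota; lia.
by exists (absz (n + N1%:Z)%R); [rewrite mem_iota|]; lia.
Qed.

Lemma window_uniq N1 N0 : uniq (window N1 N0).
Proof. by rewrite map_inj_in_uniq ?iota_uniq // => a b _ _; lia. Qed.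

Lemma D2_null_finite (X Y : BF) (f : arr BF X Y) : hom BF X Y f ->
  finite_set [set n | ~ D2null X Y n (f n)].
Proof.
move=> /(hom_bounded r_gt0 r_le_s)[N1 f0]; have [N0 far] := corner_mle X Y.
apply: (@sub_finite_set _ _ [set` window N1 N0]); last exact: finite_seq.
move=> n /= nn; rewrite mem_window; apply/andP; split.
  rewrite leNgt; apply/negP => /f0 E; apply: nn; rewrite E.
  exact: (D2_null_subspace X (FB_ob s n Y)).1.
by rewrite ltNge; apply/negP => nN; apply: nn; apply: (tail_D2_null far).
Qed.

Lemma stable_nullE (X Y : BF) (f : arr BF X Y) : hom BF X Y f ->
  null (stable exB) X Y f <-> forall n, D2null X Y n (f n).
Proof.
move=> hf; split=> [nf n|nf]; first exact: stable_null_D2.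
have [N1 f0] := hom_bounded r_gt0 r_le_s hf; have [N0 far] := corner_mle X Y.
pose T : arr BF X Y := fun n => if n < N0%:Z then 0 else f n.
have -> : f = T + \sum_(n <- window N1 N0) single n (f n).
  apply/funext => m; rewrite -[RHS]/(T m + (\sum_(n <- window N1 N0) single n (f n)) m).
  rewrite fct_sumE; have [mW|mW] := boolP (m \in window N1 N0).
    rewrite (bigD1_seq m) ?window_uniq //= big1 ?addr0 => [|n]; last first.
      by rewrite /single eq_sym => /negPf ->.
    by move: mW; rewrite mem_window /single eqxx /T => /andP[_ ->]; rewrite add0r.
  rewrite big_seq big1 ?addr0 => [|n nW]; last first.
    by rewrite /single; case: eqP => // E; rewrite E nW in mW.
  rewrite /T; case: ifP => // mN; apply: f0; rewrite ltNge; apply/negP => h.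
  by rewrite mem_window h mN in mW.
have sN := null_subspace SK X Y.
apply: (subspaceD sN).
  by apply: (tail_stable_null far) => n nN; rewrite /T nN.
by apply: (subspace_sum sN) => n _; apply: single_null.
Qed.

(** Representatives, identities and composition agree by definition, and the finiteness condition in
    the orbit category holds for every family in [hom]; only [hom] and [null] have to be compared as
    sets. *)
Lemma Crs_stable : Crs k r s = stable exB.
Proof.
have kE (A : B -> B -> lmodType k) (h h' n n' : forall X Y, set (A X Y)) i c :
    h = h' -> n = n' -> @KCat k B A h n i c = @KCat k B A h' n' i c.
  by move=> -> ->.
apply: kE; apply: functional_extensionality_dep => X;
  apply: functional_extensionality_dep => Y; apply/funext => f; apply/propext.
  by split=> [[]//|hf]; split=> //; apply: D2_null_finite.
split=> [nf|nf n]; last exact: stable_null_D2.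
(* A component that factors through a boundary object is a morphism of B, by transitivity of the
   order. *)
have hf : hom BF X Y f.
  move=> n; have [Z [g [h [_ hg hh ->]]]] := nf n; move=> i j nle.
  rewrite -[LHS]/(\sum_l h l j * g i l) big1 // => l _.
  have [le1|n1] := pselect (mle (X i) (Z l)); last by rewrite (hg i l n1) mulr0.
  rewrite (hh l j) ?mul0r // => le2; apply: nle; exact: mle_trans le2.
exact: ((stable_nullE hf).2 nf).
Qed.

End OrbitStable.

Theorem corollary2p3p2 (R : realType) (k : fieldType) (r s : R)
    (r_gt0 : 0 < r) (r_le_s : r <= s) :
  [/\ frobenius (BFhat_exact k r_gt0 r_le_s),
      equivalent (stable (BFhat_exact k r_gt0 r_le_s)) (Crs k r s)
    & equivalent (Crs k r s) (Cc k (r * pi / s))].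
Proof.
have S := BFhat_stable_equivalent (k := k) r_gt0 r_le_s.
(* After this rewriting the second claim is the reflexivity of equivalence. *)
rewrite (Crs_stable r_gt0 r_le_s); split; last exact: S.
  exact: BFhat_frobenius.
by case: S => kS _ _; apply: equivalent_refl.
Qed.
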